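(* Let $\Lambda$ be a critical lattice associated to the multiplier $g$ (associated to $\phi$), and let $c=(c_\lambda)_{\lambda\in\Lambda}$ be a sequence of complex numbers. There exists $f\in\mathcal{F}^1_\phi$ satisfying $f|\Lambda=c$ if and only if - $\sum_{\lambda\in\Lambda}|c_\lambda| e^{-\phi(\lambda)}<+\infty$, - $\sum_{\lambda'\in\Lambda}\Bigl|\sum_{\lambda\in\Lambda_{\lambda'}}\frac{c_\lambda}{g'(\lambda)(\lambda-\lambda')}\Bigr|<+\infty$, and - $\sum_{\lambda'\in\Lambda}\Bigl|\rho(\lambda')\sum_{\lambda\in\Lambda_{\lambda'}}\frac{c_\lambda}{g'(\lambda)(\lambda-\lambda')^2}\Bigr|<+\infty$.
   Context: Throughout, $\phi:\mathbb{C}\to\mathbb{R}$ is a (non-harmonic) subharmonic function, assumed $\mathcal{C}^\infty$, whose Laplacian $\mu=\Delta\phi$ is a doubling measure: there is $C>0$ with $\mu(D(z,2r))\le C\mu(D(z,r))$ for all $z\in\mathbb{C}$, $r>0$, where $D(z,r)$ is the disc of centre $z$ and radius $r$. For $z\in\mathbb{C}$, $\rho(z)=\rho_\phi(z)$ is the radius such that $\mu(D(z,\rho(z)))=1$. $d_\phi$ is the distance induced by the metric $\rho(z)^{-2}dz\otimes d\overline{z}$, i.e. $d_\phi(z,\zeta)=\inf_\gamma\int_\gamma\frac{|dw|}{\rho(w)}$ over piecewise $C^1$ curves $\gamma$ from $z$ to $\zeta$, and $d_\phi(z,S)=\inf_{s\in S}d_\phi(z,s)$. $\Lambda\subset\mathbb{C}$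 is $\rho$-separated if there is $\delta>0$ with $|\lambda-\lambda'|\ge\delta\max\{\rho(\lambda),\rho(\lambda')\}$ for all $\lambda\ne\lambda'$ in $\Lambda$. A multiplier associated to $\phi$ is an entire function $g$ with zero sequence $\mathcal{Z}(g)$ such that $\mathcal{Z}(g)$ is $\rho$-separated, $\sup_{z\in\mathbb{C}}d_\phi(z,\mathcal{Z}(g))<\infty$, and $|g(z)|\simeq e^{\phi(z)}d_\phi(z,\mathcal{Z}(g))$ for all $z\in\mathbb{C}$ (two-sided bounds with constants independent of $z$). Then $\Lambda=\mathcal{Z}(g)$ is called a critical lattice associated to the multiplier $g$. It is assumed throughout that $0\in\Lambda$. The generalised Fock space is $\mathcal{F}^1_\phi=\{f\in H(\mathbb{C}):\int_{\mathbb{C}}|f(z)|e^{-\phi(z)}\frac{dm(z)}{\rho(z)^2}<+\infty\}$, where $H(\mathbb{C})$ denotes the entire functions and $m$ is Lebesgue measure. $f|\Lambda=c$ means $f(\lambda)=c_\lambda$ for all $\lambda\in\Lambda$. $\Lambda_{\lambda'}=\Lambda\setminus\{\lambda'\}$. *)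

(* Defs.v *)
From HB Require Import structures.
From mathcomp Require Import all_boot all_order all_algebra.
From mathcomp Require Import all_classical all_reals all_analysis.
From mathcomp.analysis.showcase Require summability.
From mathcomp Require Import complex.

Set Implicit Arguments.
Unset Strict Implicit.
Unset Printing Implicit Defensive.

Import Order.TTheory GRing.Theory Num.Theory numFieldNormedType.Exports.

Local Open Scope classical_set_scope.
Local Open Scope ring_scope.
Local Open Scope complex_scope.

Section GeneralisedFock.
Context {R : realType}.
Implicit Types (phi : R[i] -> R) (z w : R[i]) (S : set R[i]).

(* The norm `|z| of R[i] is itself an element of R[i]. *)
Definition cabs z : R := complex.Re `|z|.

Definition disc z (r : R) : set R[i] := [set w | cabs (w - z) < r].

Definition toC (p : R * R) : R[i] := p.1 +i* p.2.

Definition leb2 :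
    {measure set (measurableTypeR R * measurableTypeR R) -> \bar R} :=
  (@lebesgue_measure R \x @lebesgue_measure R)%E.

(* Real differentiation of functions on the complex plane is carried out on
   R * R, because R[i] is a normed module over R[i], not over R. *)
Definition partial (b : bool) (u : R * R -> R) : R * R -> R :=
  if b then 'D_((0, 1) : R * R) u else 'D_((1, 0) : R * R) u.

Definition smooth phi : Prop :=
  forall s : seq bool,
    let u := foldr partial (phi \o toC) s in
    continuous u /\
    forall p, derivable u p ((1, 0) : R * R) /\ derivable u p ((0, 1) : R * R).

Definition laplacian phi (p : R * R) : R :=
  partial false (partial false (phi \o toC)) p +
  partial true (partial true (phi \o toC)) p.

Definition subharmonic phi : Prop :=
  lower_semicontinuous (fun p : R * R => (- phi (toC p))%:E) /\
  forall z (r : R), 0 < r ->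
    ((phi z)%:E <= ((2 * pi)^-1)%:E *
      \int[lebesgue_measure]_(t in `[0%R, (2 * pi)%R])
         (phi (z + (r * cos t) +i* (r * sin t)))%:E)%E.

(* Only used for smooth phi. *)
Definition is_harmonic phi : Prop := forall p, laplacian phi p = 0.

Definition lap_mass phi S : \bar R :=
  (\int[leb2]_(p in toC @^-1` S) (laplacian phi p)%:E)%E.

Definition doubling phi : Prop :=
  exists C : R, 0 < C /\ forall z (r : R), 0 < r ->
    (lap_mass phi (disc z (2 * r)) <= C%:E * lap_mass phi (disc z r))%E.

Definition weight phi : Prop :=
  [/\ smooth phi, subharmonic phi, ~ is_harmonic phi & doubling phi].

(* For a weight the radius exists and is unique; otherwise the value may be
   the default 0. *)
Definition rho phi z : R :=
  xget 0 [set r | 0 < r /\ lap_mass phi (disc z r) = 1%E].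

Definition C1 (u : R -> R) : Prop :=
  (forall t, derivable u t 1) /\ continuous (derive1 u).

(* Being C^1 on a closed interval, with one-sided derivatives at the end
   points, is expressed as having a C^1 extension to the line. *)
Definition piecewise_C1 (gamma : R -> R[i]) : Prop :=
  exists s : seq R, itv_partition 0 1 s /\
    forall k : nat, (k < size s)%N ->
      exists eta : R -> R[i],
        [/\ C1 (fun t => complex.Re (eta t)), C1 (fun t => complex.Im (eta t)) &
            {in `[nth 0 (0 :: s) k, nth 0 s k], gamma =1 eta}].

Definition speed (gamma : R -> R[i]) (t : R) : R :=
  cabs (derive1 (fun x => complex.Re (gamma x)) t +i*
        derive1 (fun x => complex.Im (gamma x)) t).

(* The finitely many break points, where [speed] is a junk value, are
   negligible for the integral. *)
Definition rho_length phi (gamma : R -> R[i]) : \bar R :=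
  (\int[lebesgue_measure]_(t in `[0%R, 1%R])
     (speed gamma t / rho phi (gamma t))%:E)%E.

Definition dphi phi z w : \bar R :=
  ereal_inf [set rho_length phi gamma | gamma in
    [set gamma | [/\ piecewise_C1 gamma, gamma 0 = z & gamma 1 = w]]].

Definition dphi_set phi z S : \bar R :=
  ereal_inf [set dphi phi z s | s in S].

Definition entire (f : R[i] -> R[i]) : Prop :=
  forall z, derivable (f : R[i]^o -> R[i]^o) z 1.

Definition cderiv (f : R[i] -> R[i]) z : R[i] :=
  derive1 (f : R[i] -> R[i]^o) z.

Definition zeros (g : R[i] -> R[i]) : set R[i] := [set z | g z = 0].

Definition rho_separated phi S : Prop :=
  exists delta : R, 0 < delta /\
    forall l l', S l -> S l' -> l <> l' ->
      delta * Num.max (rho phi l) (rho phi l') <= cabs (l - l').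

(* The lower and upper bounds force the zeros of a multiplier to be simple, so
   the zero sequence is represented by the zero set. *)
Definition multiplier phi (g : R[i] -> R[i]) : Prop :=
  [/\ entire g,
      rho_separated phi (zeros g),
      exists M : R, forall z, (dphi_set phi z (zeros g) <= M%:E)%E &
      exists C : R, 0 < C /\ forall z,
        ((C^-1 * expR (phi z))%:E * dphi_set phi z (zeros g)
           <= (cabs (g z))%:E)%E /\
        ((cabs (g z))%:E
           <= (C * expR (phi z))%:E * dphi_set phi z (zeros g))%E].

Definition critical_lattice phi (g : R[i] -> R[i]) (L : set R[i]) : Prop :=
  multiplier phi g /\ L = zeros g.

Definition fock1 phi (f : R[i] -> R[i]) : Prop :=
  entire f /\
  (\int[leb2]_p
     (cabs (f (toC p)) * expR (- phi (toC p)) / rho phi (toC p) ^+ 2)%:E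
   < +oo)%E.

(* Unordered sum over S: the limit of the finite partial sums along the
   directed set of finite subsets of S. *)
Definition csum S (a : R[i] -> R[i]) : R[i] :=
  summability.sum (fun l : S => (a (val l) : R[i]^o)).

End GeneralisedFock.

(* Main.v *)
(* Near each zero [l] of [g], [|g|] is comparable to [e^phi |z - l| / rho l], so
   [b l = c l / g'(l)] has size [rho l |c l| e^(- phi l)], and the Lagrange series
   [f1 = g * sum_l b l / (z - l)] converges as soon as the first sum is finite.
   Necessity: sub-mean value inequalities over squares around the points [l'] of
   the lattice, applied to [f (z - l') / g], to [f / g - b l' / (z - l')] and to the
   divided difference of the latter at [l'], bound the three sums by the norm of
   [f]. The second function is [sum_(l <> l') b l / (z - l)], because [(f - f1) / g]
   is entire and tends to [0] at infinity.
   Sufficiency: near [l'] expand [1 / (z - l)], for [l <> l'], to second order at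
   [l']. The first two terms give the second and third sums, and the remainder is
   controlled by the Schur bound
   [sum_(l' <> l) rho l' ^ 2 / |l - l'| ^ 3 <= C / rho l].
   The complex analysis (maximum principle, removable singularities, sub-mean value
   inequality) all comes from a Cauchy inequality on squares, obtained by Goursat's
   bisection. *)

Require Import Defs.
From HB Require Import structures.
From mathcomp Require Import all_boot all_order all_algebra finmap.
From mathcomp Require Import all_classical all_reals all_analysis.
From mathcomp.analysis.showcase Require summability.
From mathcomp Require Import measurable_realfun complex ring lra.

Set Implicit Arguments.
Unset Strict Implicit.
Unset Printing Implicit Defensive.

Import Order.TTheory GRing.Theory Num.Theory numFieldNormedType.Exports.

Local Open Scope classical_set_scope.
Local Open Scope ring_scope.
Local Open Scope complex_scope.

(** * Complex modulus and derivative *)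

(** The inner sums converge absolutely, but the first condition does not bound the total of their
    absolute terms over [l']. After a first-order expansion, absolute values would leave the kernel
    [rho l' / |l - l'| ^ 2], whose sum over [l'] diverges logarithmically already for constant
    [rho]; at second order it is [rho l' ^ 2 / |l - l'| ^ 3], summable by comparing areas. Hence two
    terms are kept whole and there are three conditions. The factor [d z] contained in [|g z|]
    absorbs the singularity when [z] is close to another pole. A cell of size [rho l] has area of
    order [rho l ^ 2], which cancels the weight [rho ^ -2] and turns the norm into a sum over the
    lattice. Removable singularities are derived from the maximum principle for divided differences,
    which at their node are only known to be continuous. So the Cauchy inequality asks only for
    continuity at the centre. Its rational constant [92 / 15] replaces [2 pi] and still exceeds 6.
    Lower bounds for the distance come from a logarithmic potential with gradient at most [4 / rho];
    no geodesics are involved. *)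

Section ComplexModulus.
Variable R : realType.
Implicit Types (z w : R[i]) (f g k : R[i] -> R[i]).

Lemma normcE z : `|z| = (cabs z)%:C.
Proof. by rewrite /cabs; case: z => a b /=. Qed.

Lemma cabs_sqrt (x y : R) : cabs (x +i* y) = Num.sqrt (x ^+ 2 + y ^+ 2).
Proof. by []. Qed.

Lemma cabs_ge0 z : 0 <= cabs z.
Proof. by case: z => x y; rewrite cabs_sqrt sqrtr_ge0. Qed.
Hint Resolve cabs_ge0 : core.

Lemma realC_inj : injective (fun x : R => x%:C).
Proof. by move=> x y [->]. Qed.

Lemma cabsM z w : cabs (z * w) = cabs z * cabs w.
Proof. by apply: realC_inj; rewrite rmorphM /= -!normcE normrM. Qed.

Lemma cabsD z w : cabs (z + w) <= cabs z + cabs w.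
Proof. by rewrite -lecR rmorphD /= -!normcE ler_normD. Qed.

Lemma cabsN z : cabs (- z) = cabs z.
Proof. by apply: realC_inj; rewrite -!normcE normrN. Qed.

Lemma cabsC z w : cabs (z - w) = cabs (w - z).
Proof. by rewrite -cabsN opprB. Qed.

Lemma cabsB_ge z w : cabs z - cabs w <= cabs (z - w).
Proof. by rewrite lerBlDr -{1}(subrK w z) cabsD. Qed.

Lemma cabsB_le z w : cabs (z - w) <= cabs z + cabs w.
Proof. by rewrite -(cabsN w) cabsD. Qed.

Lemma cabs_triangle u z w : cabs (z - w) <= cabs (z - u) + cabs (u - w).
Proof. by rewrite -{1}(subrK u z) -addrA cabsD. Qed.

Lemma cabs0 : cabs (0 : R[i]) = 0.
Proof. by apply: realC_inj; rewrite -normcE normr0. Qed.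

Lemma cabs1 : cabs (1 : R[i]) = 1.
Proof. by apply: realC_inj; rewrite -normcE normr1. Qed.

Lemma cabs_eq0 z : (cabs z == 0) = (z == 0).
Proof.
apply/eqP/eqP => [z0|->]; last exact: cabs0.
by apply/eqP; rewrite -normr_eq0 normcE z0.
Qed.

Lemma cabs_gt0 z : (0 < cabs z) = (z != 0).
Proof. by rewrite lt_neqAle cabs_ge0 andbT eq_sym cabs_eq0. Qed.

Lemma cabsV z : cabs z^-1 = (cabs z)^-1.
Proof. by apply: realC_inj; rewrite -normcE normfV normcE fmorphV. Qed.

Lemma cabsX z n : cabs (z ^+ n) = cabs z ^+ n.
Proof. by elim: n => [|n IH]; rewrite ?expr0 ?cabs1// !exprS cabsM IH. Qed.

Lemma cabs_real (x : R) : cabs x%:C = `|x|.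
Proof. by rewrite cabs_sqrt expr0n/= addr0 sqrtr_sqr. Qed.

Lemma cabs_i : cabs ('i : R[i]) = 1.
Proof. by rewrite cabs_sqrt expr0n/= add0r expr1n sqrtr1. Qed.

Lemma ler_Re_cabs z : `|complex.Re z| <= cabs z.
Proof.
case: z => x y; rewrite cabs_sqrt /= -sqrtr_sqr ler_wsqrtr//.
by rewrite lerDl sqr_ge0.
Qed.

Lemma ler_Im_cabs z : `|complex.Im z| <= cabs z.
Proof.
case: z => x y; rewrite cabs_sqrt /= -sqrtr_sqr ler_wsqrtr//.
by rewrite lerDr sqr_ge0.
Qed.

Lemma cabs_le_ReIm z : cabs z <= `|complex.Re z| + `|complex.Im z|.
Proof.
case: z => x y /=.
have -> : x +i* y = x%:C + 'i * y%:C.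
  by apply/eqP; rewrite eq_complex /= !mul0r !mul1r !subr0 !addr0 !add0r !eqxx.
by rewrite (le_trans (cabsD _ _))// cabsM cabs_i mul1r !cabs_real.
Qed.

Lemma cabs_sum (I : Type) (s : seq I) (P : pred I) (F : I -> R[i]) :
  cabs (\sum_(i <- s | P i) F i) <= \sum_(i <- s | P i) cabs (F i).
Proof.
elim/big_ind2 : _ => //; first by rewrite cabs0.
by move=> x a y b xa yb; rewrite (le_trans (cabsD _ _))// lerD.
Qed.

End ComplexModulus.

#[global] Hint Resolve cabs_ge0 : core.

Section GenericDerivative.
Variable K : numFieldType.
Implicit Types f g : K^o -> K^o.

Lemma derivable1_lim f (z a : K) :
  (forall e : K, 0 < e -> exists2 d : K, 0 < d & forall h, `|h| < d ->
    `|f (z + h) - f z - a * h| <= e * `|h|) ->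
  derivable f z 1 /\ derive1 (f : K -> K^o) z = a.
Proof.
move=> fza.
have cv : (fun h : K => h^-1 *: (f (h *: (1 : K^o) + z) - f z))
    @ 0^' --> (a : K^o).
  apply/cvgrPdist_le => /= e e0; have [d d0 H] := fza _ e0.
  exists d => // h /=; rewrite sub0r normrN => hd h0.
  have := H _ hd; rewrite {1}/GRing.scale/= [h *: 1]mulr1 => {}H.
  have h0' : 0 < `|h| by rewrite normr_gt0.
  rewrite -(ler_pM2r h0') -normrM mulrBl [h^-1 * _]mulrC mulfVK//.
  by rewrite distrC [h + z]addrC.
split; first by apply/cvg_ex; exists a; apply: cv.
rewrite derive1E /derive; exact: (@cvg_lim K^o).
Qed.

Lemma lim_derivable1 f (z : K) : derivable f z 1 ->
  forall e : K, 0 < e -> exists2 d : K, 0 < d & forall h, `|h| < d ->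
    `|f (z + h) - f z - derive1 (f : K -> K^o) z * h| <= e * `|h|.
Proof.
move=> /cvg_ex[/= a cv] e e0.
have -> : derive1 (f : K -> K^o) z = a.
  by rewrite derive1E /derive; exact: (@cvg_lim K^o).
move/cvgrPdist_le : cv => /(_ _ e0)[d /= d0 H].
exists d => // h hd.
have [->|h0] := eqVneq h 0; first by rewrite addr0 subrr mulr0 subr0 normr0 mulr0.
have := H h; rewrite /= sub0r normrN => /(_ hd h0).
rewrite {1}/GRing.scale/= [h *: 1]mulr1.
have h0' : 0 < `|h| by rewrite normr_gt0.
rewrite -(ler_pM2r h0') -normrM mulrBl [h^-1 * _]mulrC mulfVK//.
by rewrite distrC [h + z]addrC.
Qed.

Lemma derivable1M f g (z : K) : derivable f z 1 -> derivable g z 1 ->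
  derivable (fun w : K^o => f w * g w : K^o) z 1.
Proof. exact: derivableM. Qed.

End GenericDerivative.

Section ComplexDerivative.
Variable R : realType.
Implicit Types (z w a : R[i]) (f g k : R[i] -> R[i]).

(** Real [e] and [d] with [cabs] replace the complex-valued norm of [R[i]]; the quotient is
    multiplied out, so [h = 0] need not be excluded. *)
Definition cdiff f z a := forall e : R, 0 < e -> exists2 d : R, 0 < d &
  forall h, cabs h < d -> cabs (f (z + h) - f z - a * h) <= e * cabs h.

Definition cdifferentiable f z := exists a, cdiff f z a.

Definition ccontinuous f z := forall e : R, 0 < e -> exists2 d : R, 0 < d &
  forall w, cabs (w - z) < d -> cabs (f w - f z) <= e.

Lemma cdiff_continuous f z a : cdiff f z a -> ccontinuous f z.
Proof.
move=> fza e e0; have [d d0 H] := fza 1 ltr01.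
have c0 : 0 < 1 + cabs a by rewrite ltr_wpDr// cabs_ge0.
exists (Num.min d (e / (1 + cabs a))) => [|w]; first by rewrite lt_min d0 divr_gt0.
rewrite lt_min => /andP[wd we].
have := H _ wd; rewrite [z + _]addrC subrK mul1r => {}H.
rewrite -[f w - f z](subrK (a * (w - z))) (le_trans (cabsD _ _))//.
rewrite (le_trans (lerD H (lexx _)))// cabsM.
rewrite -[X in X + _]mul1r -mulrDl mulrC -ler_pdivlMr//; exact: ltW.
Qed.

Lemma cdiff_derivable f z a : cdiff f z a ->
  derivable (f : R[i]^o -> R[i]^o) z 1 /\ cderiv f z = a.
Proof.
move=> fza; apply: derivable1_lim => e e0.
have er : e = (cabs e)%:C by rewrite -normcE gtr0_norm.
have ce0 : 0 < cabs e by rewrite cabs_gt0 gt_eqF.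
have [d d0 H] := fza _ ce0; exists d%:C => [|h]; first by rewrite ltcR.
by rewrite !normcE ltcR er -rmorphM lecR; exact: H.
Qed.

Lemma derivable_cdiff f z :
  derivable (f : R[i]^o -> R[i]^o) z 1 -> cdiff f z (cderiv f z).
Proof.
move=> /lim_derivable1 fz e e0.
have eC : 0 < e%:C by rewrite ltcR.
have [d d0 H] := fz _ eC.
exists (cabs d) => [|h hd]; first by rewrite cabs_gt0 gt_eqF.
have := H h; rewrite !normcE -rmorphM lecR; apply.
by rewrite -[d](gtr0_norm d0) normcE ltcR.
Qed.

Lemma derivableP_cdiff f z :
  derivable (f : R[i]^o -> R[i]^o) z 1 <-> cdifferentiable f z.
Proof.
split => [/derivable_cdiff ?|[a /cdiff_derivable[]]//].
by exists (cderiv f z).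
Qed.

Lemma cdiff_uniq f z a b : cdiff f z a -> cdiff f z b -> a = b.
Proof. by move=> /cdiff_derivable[_ <-] /cdiff_derivable[_ <-]. Qed.

Lemma cdiff_near f g z a (d : R) : 0 < d ->
  (forall w, cabs (w - z) < d -> f w = g w) -> cdiff f z a -> cdiff g z a.
Proof.
move=> d0 fg fza e e0; have [d1 d10 H] := fza e e0.
exists (Num.min d d1) => [|h]; first by rewrite lt_min d0.
rewrite lt_min => /andP[hd hd1]; rewrite -!fg ?subrr ?cabs0//; first exact: H.
by rewrite addrC addKr.
Qed.

Lemma cdifferentiable_near f g z (d : R) : 0 < d ->
  (forall w, cabs (w - z) < d -> f w = g w) ->
  cdifferentiable f z -> cdifferentiable g z.
Proof. by move=> d0 fg [a fa]; exists a; exact: (cdiff_near d0 fg fa). Qed.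

Lemma cdifferentiable_cst (c : R[i]) z : cdifferentiable (fun=> c) z.
Proof. by apply/derivableP_cdiff; exact: derivable_cst. Qed.

Lemma cdifferentiable_id z : cdifferentiable (fun w => w) z.
Proof. by apply/derivableP_cdiff; exact: derivable_id. Qed.

Lemma cdifferentiableD f g z : cdifferentiable f z -> cdifferentiable g z ->
  cdifferentiable (fun w => f w + g w) z.
Proof.
by move=> /derivableP_cdiff ? /derivableP_cdiff ?; apply/derivableP_cdiff; exact: derivableD.
Qed.

Lemma cdifferentiableN f z : cdifferentiable f z ->
  cdifferentiable (fun w => - f w) z.
Proof. by move=> /derivableP_cdiff ?; apply/derivableP_cdiff; exact: derivableN. Qed.

Lemma cdifferentiableB f g z : cdifferentiable f z -> cdifferentiable g z ->
  cdifferentiable (fun w => f w - g w) z.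
Proof. by move=> fz gz; apply: cdifferentiableD => //; exact: cdifferentiableN. Qed.

Lemma cdifferentiableM f g z : cdifferentiable f z -> cdifferentiable g z ->
  cdifferentiable (fun w => f w * g w) z.
Proof.
by move=> /derivableP_cdiff ? /derivableP_cdiff ?; apply/derivableP_cdiff; exact: derivable1M.
Qed.

Lemma cdifferentiableV f z : f z != 0 -> cdifferentiable f z ->
  cdifferentiable (fun w => (f w)^-1) z.
Proof.
by move=> ? /derivableP_cdiff ?; apply/derivableP_cdiff; exact: derivableV.
Qed.

Lemma cdifferentiable_div f g z : g z != 0 ->
  cdifferentiable f z -> cdifferentiable g z ->
  cdifferentiable (fun w => f w / g w) z.
Proof. by move=> gz0 fz gz; apply: cdifferentiableM => //; exact: cdifferentiableV. Qed.

Lemma cdifferentiableX f z n : cdifferentiable f z ->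
  cdifferentiable (fun w => f w ^+ n) z.
Proof.
move=> fz; elim: n => [|n IH]; first exact: cdifferentiable_cst.
by under eq_fun do rewrite exprS; exact: cdifferentiableM.
Qed.

Lemma cdifferentiable_continuous f z : cdifferentiable f z -> ccontinuous f z.
Proof. by move=> [a]; exact: cdiff_continuous. Qed.

Lemma ccontinuous_near f g z (d : R) : 0 < d ->
  (forall w, cabs (w - z) < d -> f w = g w) -> ccontinuous f z -> ccontinuous g z.
Proof.
move=> d0 fg fz e e0; have [d1 d10 H] := fz e e0.
exists (Num.min d d1) => [|w]; first by rewrite lt_min d0.
by rewrite lt_min => /andP[hd hd1]; rewrite -!fg ?subrr ?cabs0//; exact: H.
Qed.

Lemma ccontinuousM f g z : ccontinuous f z -> ccontinuous g z ->
  ccontinuous (fun w => f w * g w) z.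
Proof.
move=> fz gz e e0.
pose M := cabs (f z) + 1.
pose N := cabs (g z) + 1.
have M0 : 0 < M by rewrite ltr_wpDl// cabs_ge0.
have N0 : 0 < N by rewrite ltr_wpDl// cabs_ge0.
have /fz[d1 d10 H1] : 0 < e / 2 / N by rewrite !divr_gt0.
have /gz[d2 d20 H2] : 0 < Num.min 1 (e / 2 / M) by rewrite lt_min ltr01/= !divr_gt0.
exists (Num.min d1 d2) => [|w]; first by rewrite lt_min d10.
rewrite lt_min => /andP[/H1 a2 /H2]; rewrite le_min => /andP[b1 b2].
have -> : f w * g w - f z * g z = (f w - f z) * g w + f z * (g w - g z) by ring.
rewrite (le_trans (cabsD _ _))// !cabsM (splitr e) lerD//.
  have : cabs (g w) <= N.
    by rewrite -(subrK (g z) (g w)) (le_trans (cabsD _ _))// addrC lerD2l.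
  by move=> /(ler_pM (cabs_ge0 _) (cabs_ge0 _) a2); rewrite mulfVK// gt_eqF.
have : cabs (f z) <= M by rewrite lerDl.
move=> /(fun h => ler_pM (cabs_ge0 _) (cabs_ge0 _) h b2) /le_trans; apply.
by rewrite mulrC mulfVK// gt_eqF.
Qed.

Lemma ccontinuous_cst (c : R[i]) z : ccontinuous (fun=> c) z.
Proof. by move=> e e0; exists 1 => // w _; rewrite subrr cabs0 ltW. Qed.

Lemma ccontinuousX f z n : ccontinuous f z -> ccontinuous (fun w => f w ^+ n) z.
Proof.
move=> fz; elim: n => [|n IH]; first exact: ccontinuous_cst.
by under eq_fun do rewrite exprS; exact: ccontinuousM.
Qed.

Lemma ccontinuous_cabs f z : ccontinuous f z -> forall e : R, 0 < e ->
  exists2 d : R, 0 < d &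
  forall w, cabs (w - z) < d -> `|cabs (f w) - cabs (f z)| <= e.
Proof.
move=> fz e /fz[d d0 H]; exists d => // w /H; apply: le_trans.
rewrite ler_norml cabsB_ge andbT lerNl opprB cabsC; exact: cabsB_ge.
Qed.

End ComplexDerivative.

(** * Goursat's theorem *)

Section Goursat.
Variable R : realType.
Implicit Types (A B P Q : R -> R -> R) (x y w h : R).

(** With [A] a primitive of [P] in the first variable and [B] one of [Q] in the second, this is the
    counterclockwise integral of [P dx + Q dy] around the rectangle. *)
Definition circulation A B x y w h :=
  (A (x + w) y - A x y) - (A (x + w) (y + h) - A x (y + h)) +
  (B (x + w) (y + h) - B (x + w) y) - (B x (y + h) - B x y).

Lemma circulation_quarter A B x y w h :
  circulation A B x y w h =
    circulation A B x y (w / 2) (h / 2) +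
    circulation A B (x + w / 2) y (w / 2) (h / 2) +
    circulation A B x (y + h / 2) (w / 2) (h / 2) +
    circulation A B (x + w / 2) (y + h / 2) (w / 2) (h / 2).
Proof.
rewrite /circulation.
have -> : x + w / 2 + w / 2 = x + w by field.
have -> : y + h / 2 + h / 2 = y + h by field.
ring.
Qed.

Section Bisection.
Variables (A B : R -> R -> R) (x0 y0 w0 h0 e : R).
Hypotheses (w0_gt0 : 0 < w0) (h0_gt0 : 0 < h0) (e_gt0 : 0 < e).

Let side n : R := 2 ^- n.
Let bad n (p : R * R) :=
  e * ((w0 + h0) * side n) ^+ 2 <
    `|circulation A B p.1 p.2 (w0 * side n) (h0 * side n)|.
(** Halving both sides divides the allowance [e * (w + h) ^ 2] by four, and circulations add up over
    the quarters. So a bad rectangle has a bad quarter, and the fourth one needs no test. *)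
Let next n (p : R * R) : R * R :=
  let w := w0 * side n / 2 in let h := h0 * side n / 2 in
  if bad n.+1 p then p else if bad n.+1 (p.1 + w, p.2) then (p.1 + w, p.2) else
  if bad n.+1 (p.1, p.2 + h) then (p.1, p.2 + h) else (p.1 + w, p.2 + h).
Let corner := fix corner n := if n is m.+1 then next m (corner m) else (x0, y0).

Let sideS n : side n.+1 = side n / 2.
Proof. by rewrite /side exprS invfM mulrC. Qed.

Let side_gt0 n : 0 < side n.
Proof. by rewrite /side invr_gt0 exprn_gt0. Qed.

Let bad_next n p : bad n p -> bad n.+1 (next n p).
Proof.
move=> bp; rewrite /next; case: ifPn => // b1; case: ifPn => // b2.
case: ifPn => // b3; apply: contraLR bp => b4.
move: b1 b2 b3 b4; rewrite /bad -!leNgt /= => b1 b2 b3 b4.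
rewrite circulation_quarter.
move: b1 b2 b3 b4; rewrite sideS !mulrA.
set c1 := circulation _ _ _ _ _ _; set c2 := circulation _ _ _ _ _ _.
set c3 := circulation _ _ _ _ _ _; set c4 := circulation _ _ _ _ _ _.
move=> b1 b2 b3 b4.
rewrite (le_trans (ler_normD _ _))// (le_trans (lerD (ler_normD _ _) (lexx _)))//.
rewrite (le_trans (lerD (lerD (ler_normD _ _) (lexx _)) (lexx _)))//.
rewrite (le_trans (lerD (lerD (lerD b1 b2) b3) b4))//.
by rewrite le_eqVlt; apply/orP; left; apply/eqP; field.
Qed.

Let corner_bad n : bad 0 (x0, y0) -> bad n (corner n).
Proof. by move=> b0; elim: n => [//|n IH] /=; exact: bad_next. Qed.

Let cornerS1 n : (corner n).1 <= (corner n.+1).1 /\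
  (corner n.+1).1 + w0 * side n.+1 <= (corner n).1 + w0 * side n.
Proof.
have s0 : 0 <= w0 * side n by rewrite mulr_ge0// ltW.
rewrite sideS mulrA /= /next; move: s0; set w := w0 * side n => s0.
by case: ifPn => _; [|case: ifPn => _; [|case: ifPn => _]] => /=; lra.
Qed.

Let cornerS2 n : (corner n).2 <= (corner n.+1).2 /\
  (corner n.+1).2 + h0 * side n.+1 <= (corner n).2 + h0 * side n.
Proof.
have s0 : 0 <= h0 * side n by rewrite mulr_ge0// ltW.
rewrite sideS mulrA /= /next; move: s0; set w := h0 * side n => s0.
by case: ifPn => _; [|case: ifPn => _; [|case: ifPn => _]] => /=; lra.
Qed.

Lemma nested_intervals (u v : nat -> R) :
  (forall n, u n <= v n) -> (forall n, u n <= u n.+1) -> (forall n, v n.+1 <= v n) ->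
  exists c, forall n, u n <= c <= v n.
Proof.
move=> uv un vn.
have mu m n : (m <= n)%N -> u m <= u n.
  by elim: n m => [|n IH] m; [rewrite leqn0 => /eqP->|
    rewrite leq_eqVlt => /predU1P[->//|]; rewrite ltnS => /IH/le_trans; apply].
have mv m n : (m <= n)%N -> v n <= v m.
  by elim: n m => [|n IH] m; [rewrite leqn0 => /eqP->|
    rewrite leq_eqVlt => /predU1P[->//|]; rewrite ltnS => /IH; exact: le_trans].
have umv m n : u m <= v n.
  rewrite (le_trans (mu m (maxn m n) (leq_maxl _ _)))// (le_trans (uv _))//.
  exact/mv/leq_maxr.
have ne : range u !=set0 by exists (u 0), 0%N.
exists (sup (range u)) => n; apply/andP; split.
  apply: ub_le_sup; last by exists n.
  by exists (v 0) => _ [m _ <-].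
by apply: ge_sup => // _ [m _ <-].
Qed.

Hypothesis loc : forall x y, x0 <= x <= x0 + w0 -> y0 <= y <= y0 + h0 ->
  exists2 d : R, 0 < d & forall x' y' w h,
    x0 <= x' -> x' + w <= x0 + w0 -> y0 <= y' -> y' + h <= y0 + h0 ->
    x' <= x <= x' + w -> y' <= y <= y' + h -> w + h < d ->
    `|circulation A B x' y' w h| <= e * (w + h) ^+ 2.

(** Otherwise the nested bad rectangles shrink to a point that lies in all of them, and [loc] at
    this point is violated once they are small. *)
Lemma bisection : `|circulation A B x0 y0 w0 h0| <= e * (w0 + h0) ^+ 2.
Proof.
rewrite leNgt; apply/negP => b0.
have {}b0 : bad 0 (x0, y0) by rewrite /bad /side expr0 invr1 !mulr1.
have [X HX] : exists c, forall n, (corner n).1 <= c <= (corner n).1 + w0 * side n.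
  apply: nested_intervals => n; [|by have [] := cornerS1 n|by have [] := cornerS1 n].
  by rewrite lerDl mulr_ge0// ltW.
have [Y HY] : exists c, forall n, (corner n).2 <= c <= (corner n).2 + h0 * side n.
  apply: nested_intervals => n; [|by have [] := cornerS2 n|by have [] := cornerS2 n].
  by rewrite lerDl mulr_ge0// ltW.
have in1 n : x0 <= (corner n).1 /\ (corner n).1 + w0 * side n <= x0 + w0.
  elim: n => [|n [a b]]; first by rewrite /= /side expr0 invr1 mulr1.
  by have [c d] := cornerS1 n; split; [exact: le_trans c|exact: le_trans b].
have in2 n : y0 <= (corner n).2 /\ (corner n).2 + h0 * side n <= y0 + h0.
  elim: n => [|n [a b]]; first by rewrite /= /side expr0 invr1 mulr1.
  by have [c d] := cornerS2 n; split; [exact: le_trans c|exact: le_trans b].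
have [||d d0 H] := @loc X Y.
- by have := HX 0; rewrite /= /side expr0 invr1 mulr1.
- by have := HY 0; rewrite /= /side expr0 invr1 mulr1.
have [n nd] : exists n, (w0 + h0) * side n < d.
  have [n Hn] : exists n, (w0 + h0) / d < n%:R.
    exists (Num.bound ((w0 + h0) / d)); apply: archi_boundP.
    by rewrite divr_ge0 ?addr_ge0 ?ltW.
  exists n; rewrite /side ltr_pdivrMr ?exprn_gt0//.
  rewrite ltr_pdivrMr// in Hn; rewrite (lt_le_trans Hn)// mulrC ler_pM2l//.
  by rewrite -natrX ler_nat ltnW// ltn_expl.
have := corner_bad n b0; rewrite /bad ltNge => /negP; apply.
rewrite mulrDl; apply: H; rewrite -?mulrDl//.
- by have [] := in1 n.
- by have [] := in1 n.
- by have [] := in2 n.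
- by have [] := in2 n.
Qed.

End Bisection.

(** All that Goursat's argument asks of a primitive: the increments of [F] follow any affine
    approximation [al + be * x] of [f], whose exact integral is subtracted. Neither measurability
    nor an integral enters. *)
Definition is_integral (f F : R -> R) (a b : R) :=
  forall a' b' (al be eta : R), a <= a' -> a' <= b' -> b' <= b ->
  (forall x, a' <= x <= b' -> `|f x - (al + be * x)| <= eta) ->
  `|F b' - F a' - (al * (b' - a') + be * (b' ^+ 2 - a' ^+ 2) / 2)| <= eta * (b' - a').

(* The shared coefficient [p2] is the vanishing of the differential of [P dx + Q dy]. *)
Definition closed_form P Q x y := exists p1 p2 q2 : R,
  forall e, 0 < e -> exists2 d : R, 0 < d & forall x' y', `|x' - x| + `|y' - y| < d ->
   `|P x' y' - (P x y + p1 * (x' - x) + p2 * (y' - y))| <= e * (`|x' - x| + `|y' - y|) /\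
   `|Q x' y' - (Q x y + p2 * (x' - x) + q2 * (y' - y))| <= e * (`|x' - x| + `|y' - y|).

Lemma norm4_le (a b c d a' b' c' d' : R) : `|a| <= a' -> `|b| <= b' ->
  `|c| <= c' -> `|d| <= d' -> `|a - b + c - d| <= a' + b' + c' + d'.
Proof.
rewrite !ler_norml => /andP[? ?] /andP[? ?] /andP[? ?] /andP[? ?].
by apply/andP; split; lra.
Qed.

(** At each point [P] and [Q] are close to affine functions that share the coefficient [p2]. Such an
    affine form has no circulation, and the error is of the order of the squared size, as
    [bisection] requires. *)
Lemma goursat A B P Q x0 y0 w0 h0 : 0 < w0 -> 0 < h0 ->
  (forall y, y0 <= y <= y0 + h0 -> is_integral (P ^~ y) (A ^~ y) x0 (x0 + w0)) ->
  (forall x, x0 <= x <= x0 + w0 -> is_integral (Q x) (B x) y0 (y0 + h0)) ->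
  (forall x y, x0 <= x <= x0 + w0 -> y0 <= y <= y0 + h0 -> closed_form P Q x y) ->
  circulation A B x0 y0 w0 h0 = 0.
Proof.
move=> w00 h00 AP BQ PQ.
suff H (e : R) : 0 < e -> `|circulation A B x0 y0 w0 h0| <= e.
  apply/eqP; rewrite -normr_eq0 eq_le normr_ge0 andbT.
  by apply/ler_addgt0Pl => e e0; rewrite addr0; exact: H.
move=> e0; have wh0 : 0 < (w0 + h0) ^+ 2 by rewrite exprn_gt0// addr_gt0.
rewrite -(@mulfVK _ ((w0 + h0) ^+ 2) _ e) ?gt_eqF//.
apply: bisection => // X Y HX HY.
have [p1 [p2 [q2 /(_ (e / (w0 + h0) ^+ 2 / 2))[|d d0 H]]]] := PQ _ _ HX HY.
  by rewrite !divr_gt0.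
move: H; set eta := e / _ / 2 => H.
(* The factor 2 pays for the perimeter [2 * (w + h)]: each side is off by at most [eta * (w + h)]
   times its length. *)
have -> : e / (w0 + h0) ^+ 2 = eta * 2 by rewrite /eta mulfVK.
have eta0 : 0 < eta by rewrite !divr_gt0.
exists d => // x y w h xl xr yl yr /andP[X1 X2] /andP[Y1 Y2] whd.
have w_ge0 : 0 <= w by lra.
have h_ge0 : 0 <= h by lra.
have bd x' y' : x <= x' <= x + w -> y <= y' <= y + h ->
    `|x' - X| + `|y' - Y| <= w + h.
  move=> /andP[H0 H1] /andP[H2 H3].
  apply: lerD; rewrite ler_norml lerBlDr lerBrDr.
    by clear -X1 X2 H0 H1; apply/andP; split; lra.
  by clear -Y1 Y2 H2 H3; apply/andP; split; lra.
have PE x' y' : x <= x' <= x + w -> y <= y' <= y + h ->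
  `|P x' y' - (P X Y - p1 * X + p2 * (y' - Y) + p1 * x')| <= eta * (w + h).
  move=> hx hy; have b := bd _ _ hx hy.
  have [+ _] := H x' y' (le_lt_trans b whd).
  rewrite (_ : P X Y - p1 * X + p2 * (y' - Y) + p1 * x' =
    P X Y + p1 * (x' - X) + p2 * (y' - Y)); last by ring.
  by move/le_trans; apply; rewrite ler_pM2l.
have QE x' y' : x <= x' <= x + w -> y <= y' <= y + h ->
  `|Q x' y' - (Q X Y - q2 * Y + p2 * (x' - X) + q2 * y')| <= eta * (w + h).
  move=> hx hy; have b := bd _ _ hx hy.
  have [_ +] := H x' y' (le_lt_trans b whd).
  rewrite (_ : Q X Y - q2 * Y + p2 * (x' - X) + q2 * y' =
    Q X Y + p2 * (x' - X) + q2 * (y' - Y)); last by ring.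
  by move/le_trans; apply; rewrite ler_pM2l.
have xm : x <= x <= x + w by rewrite lexx lerDl.
have xM : x <= x + w <= x + w by rewrite lexx lerDl w_ge0.
have ym : y <= y <= y + h by rewrite lexx lerDl.
have yM : y <= y + h <= y + h by rewrite lexx lerDl h_ge0.
have xw : x <= x + w by rewrite lerDl.
have yh : y <= y + h by rewrite lerDl.
have hy1 : y0 <= y <= y0 + h0 by rewrite yl (le_trans yh yr).
have hy2 : y0 <= y + h <= y0 + h0 by rewrite yr (le_trans yl yh).
have hx1 : x0 <= x <= x0 + w0 by rewrite xl (le_trans xw xr).
have hx2 : x0 <= x + w <= x0 + w0 by rewrite xr (le_trans xl xw).
have I1 := AP y hy1 x (x + w) _ _ _ xl xw xr (fun t ht => PE t y ht ym).
have I2 := AP (y + h) hy2 x (x + w) _ _ _ xl xw xr (fun t ht => PE t (y + h) ht yM).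
have I3 := BQ x hx1 y (y + h) _ _ _ yl yh yr (fun t ht => QE x t xm ht).
have I4 := BQ (x + w) hx2 y (y + h) _ _ _ yl yh yr (fun t ht => QE (x + w) t xM ht).
move: I4 I3 I2 I1.
rewrite (addrAC x w (- x)) (addrAC y h (- y)) !subrr !add0r /circulation.
set a1 := A _ _; set a2 := A _ _; set a3 := A _ _; set a4 := A _ _.
set b1 := B _ _; set b2 := B _ _; set b3 := B _ _; set b4 := B _ _.
set PX := P X Y; set QX := Q X Y => I4 I3 I2 I1.
set t4 := (X in `|X| <= _) in I4; set t3 := (X in `|X| <= _) in I3.
set t2 := (X in `|X| <= _) in I2; set t1 := (X in `|X| <= _) in I1.
(* The affine parts cancel around the rectangle, because [p2] is shared; the four error terms
   remain. *)
have -> : a3 - a4 - (a1 - a2) + (b1 - b2) - (b3 - b4) = t1 - t2 + t4 - t3.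
  by rewrite /t1 /t2 /t3 /t4; ring.
move: I1 I2 I3 I4; clearbody t1 t2 t3 t4 => I1 I2 I3 I4.
have := norm4_le I1 I2 I4 I3.
have -> : eta * (w + h) * w + eta * (w + h) * w + eta * (w + h) * h +
  eta * (w + h) * h = eta * 2 * (w + h) ^+ 2 by ring.
by [].
Qed.

(** The mean value theorem is applied to the integral minus the primitive of the affine function;
    its derivative is [f] minus that function, hence at most [eta]. *)
Lemma is_integral_Rintegral (f : R -> R) (a b : R) : a < b ->
  (forall x, a <= x <= b -> {for x, continuous f}) ->
  is_integral f (fun x => \int[lebesgue_measure]_(t in `[a, x]) f t) a b.
Proof.
move=> ab fc a' b' al be eta aa' a'b' b'b H.
have [ab'|a'lb'] := eqVneq a' b'.
  by rewrite ab' !subrr !mulr0 mul0r addr0 subr0 normr0.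
have {a'lb'}a'b'' : a' < b' by rewrite lt_neqAle a'lb'.
have fw : {within `[a, b], continuous f}.
  by apply: continuous_in_subspaceT => x; rewrite inE/= in_itv/= => /fc.
have fi : lebesgue_measure.-integrable `[a, b] (EFin \o f).
  by apply: continuous_compact_integrable => //; exact: segment_compact.
pose F x := \int[lebesgue_measure]_(t in `[a, x]) f t.
rewrite -/(F b') -/(F a').
pose G x := F x - (al * x + be / 2 * x ^+ 2).
have dG x : x \in `]a', b'[ -> is_derive x 1 G (f x - (al + be * x)).
  rewrite in_itv/= => /andP[ax xb].
  have ax' : a < x by exact: le_lt_trans ax.
  have xb' : x < b by exact: lt_le_trans b'b.
  have axb : a <= x <= b by rewrite !ltW.
  have [|Fd Fx] := continuous_FTC1 xb' fi _ (fc x axb).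
    by first [exact: ax' | exact: (ltW ax') | by rewrite bnd_simp ltW | by rewrite ltBSide/= ltW | by rewrite /Order.lt /= ltW].
  have dF : is_derive x 1 F (f x) by split; [exact: Fd|rewrite -derive1E; exact: Fx].
  rewrite /G; apply: is_deriveB.
  by apply: is_derive_eq; rewrite /GRing.scale/= !mulr1; field.
have cG : {within `[a', b'], continuous G}.
  have cF : {within `[a', b'], continuous F}.
    apply: (@continuous_subspaceW _ _ _ `[a, b]).
      by apply: subset_itv; rewrite bnd_simp.
    by apply: parameterized_integral_continuous => //; exact: ltW.
  have cp : {within `[a', b'], continuous (fun x : R => al * x + be / 2 * x ^+ 2)}.
    apply: continuous_subspaceT => x; apply: differentiable_continuous.
    by apply/derivable1_diffP.
  by move=> x; apply: continuousB; [exact: cF|exact: cp].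
have [c] := MVT a'b'' dG cG.
rewrite in_itv/= => /andP[c1 c2] E.
have -> : F b' - F a' - (al * (b' - a') + be * (b' ^+ 2 - a' ^+ 2) / 2) = G b' - G a'.
  by rewrite /G; field.
rewrite E normrM (@ger0_norm _ (b' - a')) ?subr_ge0//.
by rewrite ler_pM2r ?subr_gt0// H// !ltW.
Qed.

End Goursat.

(** * A Cauchy inequality on squares *)

Section Frechet2.
Variable R : realType.
Implicit Types (F G : R -> R -> R) (x y : R).

(** Total differentiability at one point, with gradient [(p, q)]. Goursat's argument needs it
    pointwise, without continuity of the partial derivatives. *)
Definition frechet2 F x y (p q : R) := forall e : R, 0 < e ->
  exists2 d : R, 0 < d & forall h l, `|h| + `|l| < d ->
    `|F (x + h) (y + l) - F x y - (p * h + q * l)| <= e * (`|h| + `|l|).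

Lemma frechet2_lin_le (p q h l : R) :
  `|p * h + q * l| <= (`|p| + `|q|) * (`|h| + `|l|).
Proof.
rewrite (le_trans (ler_normD _ _))// !normrM mulrDl !mulrDr.
by rewrite -addrA lerD2l addrA lerDr addr_ge0 ?mulr_ge0.
Qed.

Lemma frechet2_lip F x y p q : frechet2 F x y p q ->
  exists2 d : R, 0 < d & forall h l, `|h| + `|l| < d ->
    `|F (x + h) (y + l) - F x y| <= (1 + `|p| + `|q|) * (`|h| + `|l|).
Proof.
move=> /(_ 1 ltr01)[d d0 H]; exists d => // h l hl.
rewrite -[_ - _](subrK (p * h + q * l)) (le_trans (ler_normD _ _))//.
by rewrite -[1 + _ + _]addrA mulrDl lerD//; [exact: H|exact: frechet2_lin_le].
Qed.

Lemma frechet2_cst (c : R) x y : frechet2 (fun _ _ => c) x y 0 0.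
Proof.
move=> e e0; exists 1 => // h l _.
by rewrite !mul0r subrr addr0 subrr normr0 mulr_ge0 ?addr_ge0// ltW.
Qed.

Lemma frechet2_x x y : frechet2 (fun x _ => x) x y 1 0.
Proof.
move=> e e0; exists 1 => // h l _.
rewrite (_ : _ - _ = 0); last by ring.
by rewrite normr0 mulr_ge0 ?addr_ge0// ltW.
Qed.

Lemma frechet2_y x y : frechet2 (fun _ y => y) x y 0 1.
Proof.
move=> e e0; exists 1 => // h l _.
rewrite (_ : _ - _ = 0); last by ring.
by rewrite normr0 mulr_ge0 ?addr_ge0// ltW.
Qed.

Lemma frechet2D F G x y p q p' q' :
  frechet2 F x y p q -> frechet2 G x y p' q' ->
  frechet2 (fun x y => F x y + G x y) x y (p + p') (q + q').
Proof.
move=> HF HG e e0; have e20 : 0 < e / 2 by rewrite divr_gt0.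
have [d1 d10 H1] := HF _ e20; have [d2 d20 H2] := HG _ e20.
exists (Num.min d1 d2) => [|h l]; first by rewrite lt_min d10.
rewrite lt_min => /andP[/H1 a1 /H2 a2].
rewrite (_ : _ - _ = (F (x + h) (y + l) - F x y - (p * h + q * l)) +
  (G (x + h) (y + l) - G x y - (p' * h + q' * l))); last by ring.
by rewrite (le_trans (ler_normD _ _))// [e]splitr mulrDl lerD.
Qed.

Lemma frechet2M F G x y p q p' q' :
  frechet2 F x y p q -> frechet2 G x y p' q' ->
  frechet2 (fun x y => F x y * G x y) x y
    (p * G x y + F x y * p') (q * G x y + F x y * q').
Proof.
move=> HF HG e e0.
have [d3 d30 H3] := frechet2_lip HG.
set c := 1 + `|p'| + `|q'| in H3.
have c0 : 0 < c by rewrite /c -addrA ltr_wpDr// addr_ge0.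
pose M := `|G x y| + 1; pose N := `|F x y| + 1; pose L := `|p| + `|q| + 1.
have M0 : 0 < M by rewrite ltr_wpDl.
have N0 : 0 < N by rewrite ltr_wpDl.
have L0 : 0 < L by rewrite ltr_wpDl ?addr_ge0.
have e30 : 0 < e / 3 by rewrite divr_gt0.
have [d1 d10 H1] := HF _ (divr_gt0 e30 M0).
have [d2 d20 H2] := HG _ (divr_gt0 e30 N0).
exists (Num.min (Num.min d1 d2) (Num.min d3 (Num.min (1 / c) (e / 3 / (L * c))))) => [|h l].
  by rewrite !lt_min d10 d20 d30 !divr_gt0// mulr_gt0.
rewrite !lt_min => /andP[/andP[/H1 a1 /H2 a2] /and3P[/H3 a3 a4 a5]].
set n := `|h| + `|l| in a1 a2 a3 a4 a5 *.
have n0 : 0 <= n by rewrite addr_ge0.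
set F1 := F (x + h) (y + l) in a1 *; set G1 := G (x + h) (y + l) in a2 a3 *.
rewrite (_ : _ - _ = (F1 - F x y - (p * h + q * l)) * G1 +
  (p * h + q * l) * (G1 - G x y) + F x y * (G1 - G x y - (p' * h + q' * l))); last by ring.
have G1M : `|G1| <= M.
  rewrite -(subrK (G x y) G1) (le_trans (ler_normD _ _))// addrC lerD2l.
  rewrite (le_trans a3)// mulrC -ler_pdivlMr//; exact: ltW.
have -> : e * n = e / 3 * n + e / 3 * n + e / 3 * n by field.
rewrite (le_trans (ler_normD _ _))// lerD//; last first.
  rewrite normrM (le_trans (ler_wpM2l _ a2))// mulrA ler_wpM2r//.
  rewrite mulrA ler_pdivrMr// mulrC ler_wpM2l ?(ltW e30)//.
  by rewrite /N lerDl.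
rewrite (le_trans (ler_normD _ _))// lerD//.
  rewrite normrM (le_trans (ler_pM _ _ a1 G1M))//.
  by rewrite mulrAC mulfVK ?gt_eqF.
rewrite normrM (le_trans (ler_pM _ _ (frechet2_lin_le _ _ _ _) a3))//.
rewrite -/n mulrA ler_wpM2r//.
rewrite (@le_trans _ _ (L * c * n))//.
  rewrite -!mulrA [n * c]mulrC ler_wpM2r ?mulr_ge0 ?(ltW c0)// /L lerDl//.
rewrite mulrC -ler_pdivlMr ?mulr_gt0//; exact: ltW.
Qed.

Lemma frechet2V F x y p q : F x y != 0 -> frechet2 F x y p q ->
  frechet2 (fun x y => (F x y)^-1) x y
    (- p / F x y ^+ 2) (- q / F x y ^+ 2).
Proof.
move=> F0 HF e e0.
have [d3 d30 H3] := frechet2_lip HF.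
set c := 1 + `|p| + `|q| in H3.
have c0 : 0 < c by rewrite /c -addrA ltr_wpDr// addr_ge0.
set f := F x y in F0 H3 *; pose a := `|f|.
have a0 : 0 < a by rewrite normr_gt0.
have e40 : 0 < e * a ^+ 2 / 4 by rewrite divr_gt0// mulr_gt0// exprn_gt0.
have [d1 d10 H1] := HF _ e40.
exists (Num.min d1 (Num.min d3 (Num.min (a / 2 / c) (e * a ^+ 3 / 4 / (c * c))))) => [|h l].
  by rewrite !lt_min d10 d30 !divr_gt0// ?mulr_gt0// exprn_gt0.
rewrite !lt_min => /andP[/H1 a1 /and3P[/H3 a3 a4 a5]].
set n := `|h| + `|l| in a1 a3 a4 a5 *.
have n0 : 0 <= n by rewrite addr_ge0.
set F1 := F (x + h) (y + l) in a1 a3 *.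
have F1a : a / 2 <= `|F1|.
  have : `|F1 - f| <= a / 2 by rewrite (le_trans a3)// mulrC -ler_pdivlMr// ltW.
  have : a <= `|F1 - f| + `|F1| by rewrite /a -{1}(subrK F1 f) distrC ler_normD.
  by move=> h1 h2; clear -h1 h2; lra.
have F10 : F1 != 0 by rewrite -normr_gt0 (lt_le_trans _ F1a)// divr_gt0.
rewrite (_ : _ - _ = (- f * (F1 - f - (p * h + q * l)) + (p * h + q * l) * (F1 - f)) /
  (F1 * f ^+ 2)); last by field; rewrite F10 F0.
rewrite normrM normfV normrM normrX -/a ler_pdivrMr; last first.
  by rewrite mulr_gt0 ?exprn_gt0 ?normr_gt0.
rewrite (@le_trans _ _ (e * n * (a / 2 * a ^+ 2)))//; last first.
  by rewrite ler_wpM2l ?mulr_ge0 ?(ltW e0)// ler_wpM2r// exprn_ge0// ltW.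
rewrite (_ : e * n * (a / 2 * a ^+ 2) =
  a * (e * a ^+ 2 / 4 * n) + e * a ^+ 3 / 4 * n); last by field.
rewrite (le_trans (ler_normD _ _))// lerD//.
  by rewrite normrM normrN ler_wpM2l// ltW.
rewrite normrM (le_trans (ler_pM _ _ (frechet2_lin_le _ _ _ _) a3))//.
rewrite -/n (@le_trans _ _ (c * n * (c * n)))//.
  by rewrite ler_wpM2r ?mulr_ge0 ?(ltW c0)// ler_wpM2r// /c -addrA lerDr.
rewrite (_ : c * n * (c * n) = n * (c * c) * n); last by ring.
by rewrite ler_wpM2r// -ler_pdivlMr ?mulr_gt0// ltW.
Qed.

Lemma frechet2_ext F G x y p q p' q' : (forall x y, F x y = G x y) ->
  p = p' -> q = q' -> frechet2 F x y p q -> frechet2 G x y p' q'.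
Proof. by move=> FG <- <- H e /H[d d0 Hd]; exists d => // h l /Hd; rewrite !FG. Qed.

Lemma frechet2_closed F G x y p r q : frechet2 F x y p r -> frechet2 G x y r q ->
  closed_form F G x y.
Proof.
move=> HF HG; exists p, r, q => e e0.
have [d1 d10 H1] := HF _ e0; have [d2 d20 H2] := HG _ e0.
exists (Num.min d1 d2) => [|x' y']; first by rewrite lt_min d10.
rewrite lt_min => /andP[/H1 + /H2]; rewrite ![_ + (_ - _)]addrC !subrK => a1 a2.
by move: a1 a2; rewrite !opprD !addrA.
Qed.

Lemma frechet2_continuous1 F x y p q : frechet2 F x y p q ->
  {for x, continuous (F ^~ y)}.
Proof.
move=> HF; have [d d0 H] := frechet2_lip HF.
set c := 1 + _ + _ in H.
have c0 : 0 < c by rewrite /c -addrA ltr_wpDr// addr_ge0.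
apply/cvgrPdist_le => /= e e0; exists (Num.min d (e / c)) => /=.
  by rewrite lt_min d0 divr_gt0.
move=> t /=; rewrite lt_min => /andP[t1 t2].
have := H (t - x) 0; rewrite normr0 !addr0 [x + _]addrC subrK distrC => /(_ t1).
rewrite [ `|F x y - _|]distrC => /le_trans; apply; rewrite mulrC -ler_pdivlMr//; exact: ltW.
Qed.

Lemma frechet2_continuous2 F x y p q : frechet2 F x y p q ->
  {for y, continuous (F x)}.
Proof.
move=> HF; apply: (@frechet2_continuous1 (fun a b => F b a) _ _ q p).
move=> e /HF[d d0 H]; exists d => // h l hl.
by rewrite [q * h + _]addrC [ `|h| + _]addrC H// addrC.
Qed.

(** Chain rule for [z = s (1 + i t)]: [dz = (1 + i t) ds + i s dt], multiplied by the derivative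
    [a + i b]. *)
Lemma frechet2_cdiff (k : R[i] -> R[i]) (s t : R) (a b : R) :
  cdiff k (s +i* (s * t)) (a +i* b) ->
  frechet2 (fun s t => complex.Re (k (s +i* (s * t)))) s t (a - b * t) (- b * s) /\
  frechet2 (fun s t => complex.Im (k (s +i* (s * t)))) s t (b + a * t) (a * s).
Proof.
move=> H.
suff K (e : R) : 0 < e -> exists2 d : R, 0 < d & forall h l, `|h| + `|l| < d ->
   cabs (k ((s + h) +i* ((s + h) * (t + l))) - k (s +i* (s * t)) -
     (((a - b * t) * h + - b * s * l) +i* ((b + a * t) * h + a * s * l)))
   <= e * (`|h| + `|l|).
  split => e e0; have [d d0 Hd] := K e e0; exists d => // h l /Hd.
    apply: le_trans; rewrite (le_trans _ (ler_Re_cabs _))//.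
    by case: (k _) => ? ?; case: (k _) => ? ? /=.
  apply: le_trans; rewrite (le_trans _ (ler_Im_cabs _))//.
  by case: (k _) => ? ?; case: (k _) => ? ? /=.
move=> e0; pose c : R := 2 + `|s| + `|t|.
have c0 : 0 < c by rewrite /c -addrA ltr_wpDr// addr_ge0.
have ec0 : 0 < e / 2 / c by rewrite !divr_gt0.
have [d d0 Hd] := H _ ec0; pose A : R := cabs (a +i* b) + 1.
have A0 : 0 < A by rewrite ltr_wpDl// cabs_ge0.
exists (Num.min 1 (Num.min (d / c) (e / 2 / A))) => [|h l].
  by rewrite !lt_min ltr01 !divr_gt0.
rewrite !lt_min => /and3P[n1 n2 n3]; set n := `|h| + `|l| in n1 n2 n3 *.
have n0 : 0 <= n by rewrite addr_ge0.
have hn : `|h| <= n by rewrite lerDl.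
have ln : `|l| <= n by rewrite lerDr.
pose Dz := h +i* (s * l + t * h + h * l).
have DzE : s +i* (s * t) + Dz = (s + h) +i* ((s + h) * (t + l)).
  by apply/eqP; rewrite eq_complex /= eqxx/=; apply/eqP; ring.
have Dzn : cabs Dz <= c * n.
  have H1 : `|s * l + t * h + h * l| <= `|s| * n + `|t| * n + n.
    rewrite (le_trans (ler_normD _ _))// (le_trans (lerD (ler_normD _ _) (lexx _)))//.
    rewrite !normrM !lerD ?ler_wpM2l//.
    by rewrite (le_trans (ler_wpM2l _ ln))// ler_piMl// (le_trans hn)// ltW.
  rewrite (le_trans (cabs_le_ReIm _))//= (le_trans (lerD hn H1))//.
  by rewrite le_eqVlt; apply/orP; left; apply/eqP; rewrite /c; ring.
have := Hd Dz; rewrite DzE.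
have {}Hd : cabs Dz < d by rewrite (le_lt_trans Dzn)// mulrC -ltr_pdivlMr.
move=> /(_ Hd) K.
set K1 := k _ - k _ in K *.
(* [Dz] exceeds the linear increment by the cross term [i h l], which is of second order. *)
rewrite (_ : K1 - _ = (K1 - (a +i* b) * Dz) + (a +i* b) * (0 +i* (h * l))); last first.
  case: K1 {K} => u v; apply/eqP; rewrite eq_complex /=; apply/andP; split; apply/eqP; ring.
rewrite (le_trans (cabsD _ _))// [e]splitr mulrDl lerD//.
  rewrite (le_trans K)// (le_trans (ler_wpM2l (ltW ec0) Dzn))//.
  by rewrite mulrA mulfVK// gt_eqF.
rewrite cabsM.
have -> : cabs (0 +i* (h * l)) = `|h| * `|l|.
  by rewrite cabs_sqrt expr0n/= add0r sqrtr_sqr normrM.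
rewrite mulrA ler_pM ?mulr_ge0 ?cabs_ge0//.
rewrite (@le_trans _ _ (A * n))//.
  by rewrite ler_pM ?cabs_ge0// lerDl.
by rewrite mulrC -ler_pdivlMr// ltW.
Qed.

End Frechet2.

(** * The form [Im (k(z) dz / z)] on the four sectors of a square *)

Section CauchySquare.
Variable R : realType.
Implicit Types (k : R[i] -> R[i]) (s t : R).

(** In the coordinates [z = s (1 + i t)] one has [dz / z = ds / s + (t + i) / (1 + t ^ 2) dt]. Hence
    [sideP ds + sideQ dt] is the imaginary part of [k(z) dz / z], and [|t| <= 1] describes one of
    the four sectors of a square centred at [0]. *)
Definition sideP k s t : R := complex.Im (k (s +i* (s * t))) * s^-1.
Definition sideQ k s t : R :=
  (complex.Re (k (s +i* (s * t))) + t * complex.Im (k (s +i* (s * t)))) *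
  (1 + t * t)^-1.

Lemma side_frechet k s t : s != 0 -> cdifferentiable k (s +i* (s * t)) ->
  exists p r q, frechet2 (sideP k) s t p r /\ frechet2 (sideQ k) s t r q.
Proof.
move=> s0 [[a b] /frechet2_cdiff[HR HI]].
have t0 : 1 + t * t != 0 by rewrite gt_eqF// ltr_pwDl// -expr2 sqr_ge0.
have HP := frechet2M HI (frechet2V s0 (frechet2_x s t)).
have HN := frechet2D HR (frechet2M (frechet2_y s t) HI).
have HD := frechet2D (frechet2_cst 1 s t) (frechet2M (frechet2_y s t) (frechet2_y s t)).
have HQ := frechet2M HN (@frechet2V _ (fun _ y => 1 + y * y) _ _ _ _ t0 HD).
do 3 eexists; split; first exact: (frechet2_ext _ erefl erefl HP).
apply: (frechet2_ext _ _ erefl HQ) => //=; move: s0 t0.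
by set u := complex.Im _; set v := complex.Re _ => s0 t0; field; rewrite s0 t0.
Qed.

(** Goursat's theorem on the rectangle [[e, s] x [-1, 1]] of coordinates; [e > 0] keeps away from
    the apex, where [dz / z] is singular. *)
Lemma side_circulation k e s : 0 < e -> e < s ->
  (forall s' t, e <= s' <= s -> -1 <= t <= 1 -> cdifferentiable k (s' +i* (s' * t))) ->
  \int[lebesgue_measure]_(t in `[-1, 1]) sideQ k s t -
  \int[lebesgue_measure]_(t in `[-1, 1]) sideQ k e t =
  \int[lebesgue_measure]_(x in `[e, s]) sideP k x 1 -
  \int[lebesgue_measure]_(x in `[e, s]) sideP k x (-1).
Proof.
move=> e0 es H.
pose A x y := \int[lebesgue_measure]_(u in `[e, x]) sideP k u y.
pose B x y := \int[lebesgue_measure]_(u in `[-1, y]) sideQ k x u.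
have es1 : e + (s - e) = s by ring.
have m12 : -1 + 2 = 1 :> R by ring.
have HF x y : e <= x <= s -> -1 <= y <= 1 ->
    exists p r q, frechet2 (sideP k) x y p r /\ frechet2 (sideQ k) x y r q.
  move=> hx hy; apply: side_frechet; last exact: H.
  by case/andP: hx => ex _; rewrite gt_eqF// (lt_le_trans e0).
have se0 : 0 < s - e by rewrite subr_gt0.
have : circulation A B e (-1) (s - e) 2 = 0.
  apply: (@goursat _ A B (sideP k) (sideQ k)) => //.
  - rewrite m12 es1 => y hy; apply: is_integral_Rintegral => // x hx.
    by have [p [r [q [/frechet2_continuous1]]]] := HF x y hx hy.
  - rewrite m12 es1 => x hx; apply: is_integral_Rintegral => [|y hy].
      by rewrite ltrN10 || lra.
    by have [p [r [q [_ /frechet2_continuous2]]]] := HF x y hx hy.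
  - rewrite m12 es1 => x y hx hy.
    have [p [r [q [HP HQ]]]] := HF x y hx hy; exact: frechet2_closed HP HQ.
rewrite /circulation es1 m12 /A /B !set_itv1 !Rintegral_set1 !subr0.
by move=> E; apply/eqP; rewrite -subr_eq0 -E; apply/eqP; ring.
Qed.

Lemma cdifferentiable_dilation k (c z0 z : R[i]) : cdifferentiable k (z0 + c * z) ->
  cdifferentiable (fun w => k (z0 + c * w)) z.
Proof.
move=> [a H]; exists (c * a) => e e0.
have c0 : 0 < cabs c + 1 by rewrite ltr_wpDl// cabs_ge0.
have [d d0 Hd] := H _ (divr_gt0 e0 c0).
exists (d / (cabs c + 1)) => [|h hd]; first by rewrite divr_gt0.
have ch : cabs (c * h) <= (cabs c + 1) * cabs h.
  by rewrite cabsM ler_wpM2r ?cabs_ge0// lerDl.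
have := Hd (c * h).
have -> : z0 + c * (z + h) = z0 + c * z + c * h by ring.
have -> : c * a * h = a * (c * h) by ring.
have -> : cabs (c * h) < d.
  by rewrite (le_lt_trans ch)// mulrC -ltr_pdivlMr.
move=> /(_ isT)/le_trans; apply.
by rewrite mulrAC ler_pdivrMr// -mulrA [cabs h * _]mulrC ler_wpM2l// ltW.
Qed.

Lemma ccontinuous_dilation k (c z0 z : R[i]) : ccontinuous k (z0 + c * z) ->
  ccontinuous (fun w => k (z0 + c * w)) z.
Proof.
move=> H e e0; have [d d0 Hd] := H _ e0.
have c0 : 0 < cabs c + 1 by rewrite ltr_wpDl// cabs_ge0.
exists (d / (cabs c + 1)) => [|w wd]; first by rewrite divr_gt0.
apply: Hd; rewrite opprD addrACA subrr add0r -mulrBr cabsM.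
rewrite (@le_lt_trans _ _ ((cabs c + 1) * cabs (w - z)))//.
  by rewrite ler_wpM2r ?cabs_ge0// lerDl.
by rewrite mulrC -ltr_pdivlMr.
Qed.

Lemma ccontinuous_side k s t : ccontinuous k (s +i* (s * t)) ->
  {for t, continuous (fun t => cabs (k (s +i* (s * t))))}.
Proof.
move=> /ccontinuous_cabs H; apply/cvgrPdist_le => /= e e0.
have [d d0 Hd] := H _ e0.
have s0 : 0 < `|s| + 1 by rewrite ltr_wpDl.
exists (d / (`|s| + 1)) => /=; first by rewrite divr_gt0.
move=> u /= ud; rewrite distrC; apply: Hd.
have -> : s +i* (s * u) - s +i* (s * t) = 0 +i* (s * (u - t)).
  by apply/eqP; rewrite eq_complex /=; apply/andP; split; apply/eqP; ring.
rewrite cabs_sqrt expr0n/= add0r sqrtr_sqr normrM distrC.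
rewrite (@le_lt_trans _ _ ((`|s| + 1) * `|t - u|))//.
  by rewrite ler_wpM2r// lerDl.
by rewrite mulrC -ltr_pdivlMr.
Qed.

Lemma integrable_segment (f : R -> R) (a b : R) :
  (forall x, a <= x <= b -> {for x, continuous f}) ->
  lebesgue_measure.-integrable `[a, b] (EFin \o f).
Proof.
move=> fc; apply: continuous_compact_integrable; first exact: segment_compact.
by apply: continuous_in_subspaceT => x; rewrite inE/= in_itv/= => /fc.
Qed.

(** Cauchy-Schwarz gives [|k| / sqrt (1 + t ^ 2)]; the weight is then bounded by 1. *)
Lemma sideQ_le k s t : sideQ k s t <= cabs (k (s +i* (s * t))).
Proof.
rewrite /sideQ; set z := k _.
have t1 : 1 <= 1 + t * t by rewrite lerDl -expr2 sqr_ge0.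
rewrite ler_pdivrMr ?(lt_le_trans _ t1)//.
have c0 := cabs_ge0 z.
rewrite (le_trans (ler_norm _))//.
rewrite -(@ler_pXn2r _ 2) ?nnegrE ?mulr_ge0//; last by rewrite (le_trans _ t1).
rewrite real_normK ?num_real//.
have cz : cabs z ^+ 2 = complex.Re z ^+ 2 + complex.Im z ^+ 2.
  by case: (z) => x y; rewrite cabs_sqrt sqr_sqrtr// addr_ge0// sqr_ge0.
rewrite exprMn cz; move: (complex.Re z) (complex.Im z) => x y.
have H1 : (x + t * y) ^+ 2 <= (x ^+ 2 + y ^+ 2) * (1 + t * t).
  rewrite -subr_ge0 (_ : _ - _ = (t * x - y) ^+ 2) ?sqr_ge0//; ring.
rewrite (le_trans H1)// ler_wpM2l ?addr_ge0 ?sqr_ge0// expr2 ler_peMl//.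
exact: le_trans t1.
Qed.

(** The polynomial is a minorant of [1 / (1 + t ^ 2)] on [[-1, 1]], touching it at [t ^ 2 = 1] and
    doubly at [t ^ 2 = 1 / 2]. Its integral [23 / 15] stands in for [pi / 2]; the four sides give
    [92 / 15], which is still above 6, as the maximum principle demands. *)
Lemma sideQ_ge k s t (r e : R) : 0 <= r -> -1 <= t <= 1 ->
  cabs (k (s +i* (s * t)) - r%:C) <= e -> r * (2 / 9 * t ^+ 4 - 2 / 3 * t ^+ 2 + 17 / 18) - e <= sideQ k s t.
Proof.
move=> r0 /andP[t1 t2] H.
have -> : sideQ k s t = r * (1 + t * t)^-1 + sideQ (fun w => k w - r%:C) s t.
  rewrite /sideQ; case: (k _) => x y /=; field.
  by rewrite gt_eqF// ltr_pwDl// -expr2 sqr_ge0.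
have tt : 0 <= t ^+ 2 <= 1.
  by rewrite sqr_ge0 -[leRHS](expr1n _ 2) -real_normK ?num_real// lerXn2r ?nnegrE// ler_norml t1.
apply: lerD.
  rewrite ler_wpM2l// -expr2 -[leRHS]div1r ler_pdivlMr; last by rewrite ltr_pwDl ?sqr_ge0.
  rewrite (_ : t ^+ 4 = (t ^+ 2) ^+ 2); last by rewrite -exprM.
  move: (t ^+ 2) tt => u /andP[u0 u1]; rewrite -subr_ge0.
  rewrite (_ : _ - _ = 2 / 9 * (1 - u) * (u - 1 / 2) ^+ 2); last by field.
  by rewrite mulr_ge0 ?sqr_ge0// mulr_ge0 ?subr_ge0.
have := sideQ_le (fun w => r%:C - k w) s t.
rewrite /= cabsC => /le_trans/(_ H) H2.
have -> : sideQ (fun w => k w - r%:C) s t = - sideQ (fun w => r%:C - k w) s t.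
  by rewrite /sideQ; case: (k _) => x y /=; ring.
by rewrite lerN2.
Qed.

Lemma Rintegral_sqr (r e : R) :
  \int[lebesgue_measure]_(t in `[-1, 1]) (r * (2 / 9 * t ^+ 4 - 2 / 3 * t ^+ 2 + 17 / 18) - e) = r * (23 / 15) - 2 * e.
Proof.
pose F (t : R) : R := r * (2 / 45 * t ^+ 5 - 2 / 9 * t ^+ 3 + 17 / 18 * t) - e * t.
have dF (t : R) : is_derive t 1 F (r * (2 / 9 * t ^+ 4 - 2 / 3 * t ^+ 2 + 17 / 18) - e).
  rewrite /F; apply: is_derive_eq; rewrite /GRing.scale/= ?mulr1.
  by field.
have cf : continuous (fun t : R => r * (2 / 9 * t ^+ 4 - 2 / 3 * t ^+ 2 + 17 / 18) - e).
  by move=> t; apply: differentiable_continuous; exact/derivable1_diffP.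
have cF : continuous F.
  by move=> t; apply: differentiable_continuous; exact/derivable1_diffP.
rewrite /Rintegral (@continuous_FTC2 _ _ F).
- by rewrite /= /F; field.
- by rewrite ltrN10 || lra.
- exact: continuous_subspaceT.
- split.
  + by move=> t _; exact: ex_derive.
  + exact/cvg_at_right_filter/cF.
  + exact/cvg_at_left_filter/cF.
- by move=> t _; rewrite derive1E; exact: derive_val.
Qed.

Lemma cabs_expi n : cabs (('i : R[i]) ^+ n) = 1.
Proof. by rewrite cabsX cabs_i expr1n. Qed.

(** The summand [0] gives the composite the shape expected by [cdifferentiable_dilation]. *)
Let rot k (j : nat) : R[i] -> R[i] := fun w => k (0 + 'i ^+ j * w).

(** The sum of the four integrals of [sideQ] does not depend on the size of the square. It is
    bounded above on the given square and below on a tiny one, where [k] is close to the nonnegative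
    number [k 0]. Only continuity is needed at the centre. *)
Lemma cauchy_square0 k s : 0 < s ->
  (forall w, w != 0 -> `|complex.Re w| <= s -> `|complex.Im w| <= s ->
     cdifferentiable k w) -> ccontinuous k 0 -> 0 <= k 0 ->
  cabs (k 0) * (92 / 15) <= \sum_(j < 4)
    \int[lebesgue_measure]_(t in `[-1, 1]) cabs (k ('i ^+ j * (s +i* (s * t)))).
Proof.
move=> s0 kd kc k0.
have k0E : k 0 = (cabs (k 0))%:C by rewrite -normcE ger0_norm.
set r := cabs (k 0) in k0E *.
have r0 : 0 <= r by exact: cabs_ge0.
have Rei (w : R[i]) (x : R) j : `|complex.Re w| <= x -> `|complex.Im w| <= x ->
    `|complex.Re ('i ^+ j * w)| <= x /\ `|complex.Im ('i ^+ j * w)| <= x.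
  elim: j w => [|j IH] w wr wi; first by rewrite expr0 mul1r.
  rewrite exprSr -mulrA; apply: IH; case: w wr wi => a b /= *.
    by rewrite mul0r mul1r sub0r normrN.
  by rewrite mul0r mul1r add0r.
have rotd (e : R) j s' t : 0 < e -> e <= s' <= s -> -1 <= t <= 1 ->
    cdifferentiable (rot k j) (s' +i* (s' * t)).
  move=> e0 /andP[es' s's] /andP[t1 t2]; apply: cdifferentiable_dilation; rewrite add0r.
  have s'0 : 0 < s' by exact: lt_le_trans es'.
  have [||h1 h2] := Rei (s' +i* (s' * t)) s j.
  - by rewrite /= gtr0_norm.
  - rewrite /= normrM (gtr0_norm s'0) (le_trans _ s's)// ler_piMr ?(ltW s'0)//.
    by rewrite ler_norml t1.
  apply: kd => //; rewrite -cabs_eq0 cabsM cabs_expi mul1r cabs_eq0 eq_complex /=.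
  by rewrite gt_eqF.
have fr (e : R) j s' t : 0 < e -> e <= s' <= s -> -1 <= t <= 1 ->
    exists p r q, frechet2 (sideP (rot k j)) s' t p r /\ frechet2 (sideQ (rot k j)) s' t r q.
  move=> e0 h1 h2; apply: side_frechet; last exact: (rotd e).
  by case/andP: h1 => h _; rewrite gt_eqF// (lt_le_trans e0).
have iQ (e : R) j : 0 < e <= s ->
    lebesgue_measure.-integrable `[-1, 1] (EFin \o sideQ (rot k j) e).
  move=> /andP[e0 es]; apply: integrable_segment => t ht.
  by have [|p [q [u [_ /frechet2_continuous2]]]] := fr e j e t e0 _ ht; rewrite ?lexx.
have mI : measurable (`[-1, 1] : set R) by exact: measurable_itv.
(* the radial sides of the four sectors cancel *)
have cst (e : R) : 0 < e -> e < s ->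
  \sum_(j < 4) \int[lebesgue_measure]_(t in `[-1, 1]) sideQ (rot k j) s t =
  \sum_(j < 4) \int[lebesgue_measure]_(t in `[-1, 1]) sideQ (rot k j) e t.
  move=> e0 es; apply/eqP; rewrite -subr_eq0 -sumrB.
  under eq_bigr => j _.
    rewrite side_circulation//; last by move=> *; apply: (rotd e).
    over.
  pose V j := \int[lebesgue_measure]_(x in `[e, s]) sideP (rot k j) x (-1).
  have VE j : \int[lebesgue_measure]_(x in `[e, s]) sideP (rot k j) x 1 = V j.+1.
    apply: eq_Rintegral => x _; rewrite /sideP /rot !add0r.
    congr (complex.Im (k _) / _); rewrite exprSr -mulrA; congr (_ * _).
    by apply/eqP; rewrite eq_complex /=; apply/andP; split; apply/eqP; ring.
  under eq_bigr do rewrite VE -/(V _).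
  have V4 : V 4 = V 0.
    apply: eq_Rintegral => x _; rewrite /sideP /rot expr0.
    by rewrite (_ : 'i ^+ 4 = 1)// (exprM _ 2 2) sqr_i sqrrN expr1n.
  by rewrite !big_ord_recr big_ord0 /= V4; apply/eqP; ring.
apply: (@le_trans _ _ (\sum_(j < 4)
    \int[lebesgue_measure]_(t in `[-1, 1]) sideQ (rot k j) s t)); last first.
  apply: ler_sum => j _; apply: le_Rintegral => //.
  - by apply: iQ; rewrite s0 lexx.
  - apply: integrable_segment => t ht.
    have rotE : rot k j = (fun w => k ('i ^+ j * w)) by apply/funext => w; rewrite /rot add0r.
    apply: (@ccontinuous_side (fun w => k ('i ^+ j * w)) s t); rewrite -rotE.
    by apply: cdifferentiable_continuous; apply: (rotd s j s t s0 _ ht); rewrite !lexx.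
  - by move=> t _; rewrite (le_trans (sideQ_le _ _ _))// /rot add0r.
apply/ler_addgt0Pl => /= e e0.
(* Four sides, each of length 2 in [t], lose [e / 8] per unit length, hence [e] in total. *)
have e80 : 0 < e / 8 by rewrite divr_gt0.
have [d d0 Hd] := kc _ e80.
pose x := Num.min (s / 2) (d / 4).
have x0 : 0 < x by rewrite lt_min !divr_gt0.
have xs : x < s by rewrite gt_min; apply/orP; left; rewrite ltr_pdivrMr// ltr_pMr// ltr1n.
have xd : x <= d / 4 by rewrite ge_min lexx orbT.
rewrite (cst x)// -lerBlDl.
have -> : r * (92 / 15) - e = \sum_(j < 4) (r * (23 / 15) - 2 * (e / 8)).
  by rewrite sumr_const card_ord -mulr_natl; field.
apply: ler_sum => j _; rewrite -Rintegral_sqr; apply: le_Rintegral => //.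
- apply: integrable_segment => t _; apply: differentiable_continuous.
  exact/derivable1_diffP.
- by apply: iQ; rewrite x0 ltW.
- move=> t /=; rewrite in_itv/= => ht; apply: sideQ_ge => //.
  rewrite -k0E /rot add0r; apply: Hd; rewrite subr0 cabsM cabs_expi mul1r.
  rewrite (le_lt_trans (cabs_le_ReIm _))//= normrM (gtr0_norm x0).
  have : x * `|t| <= x by rewrite ler_piMr ?(ltW x0)// ler_norml.
  by move=> Hx; clear -Hx xd d0; lra.
Qed.

Lemma cauchy_square k z0 s : 0 < s ->
  (forall w, w != z0 -> `|complex.Re (w - z0)| <= s -> `|complex.Im (w - z0)| <= s ->
     cdifferentiable k w) -> ccontinuous k z0 ->
  cabs (k z0) * (92 / 15) <= \sum_(j < 4)
    \int[lebesgue_measure]_(t in `[-1, 1]) cabs (k (z0 + 'i ^+ j * (s +i* (s * t)))).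
Proof.
move=> s0 kd kc.
have [k0|k0] := eqVneq (k z0) 0.
  rewrite k0 cabs0 mul0r; apply: sumr_ge0 => j _; apply: Rintegral_ge0 => t _.
  exact: cabs_ge0.
pose c := (cabs (k z0))%:C / k z0.
have c1 : cabs c = 1.
  by rewrite /c cabsM cabs_real cabsV ger0_norm ?cabs_ge0// divff// cabs_eq0.
pose h w := c * k (z0 + 1 * w).
have hE w : cabs (h w) = cabs (k (z0 + w)) by rewrite /h cabsM c1 !mul1r.
have h0 : h 0 = (cabs (k z0))%:C by rewrite /h mulr0 addr0 /c mulfVK.
have := @cauchy_square0 h s s0; rewrite hE addr0.
under eq_bigr do under eq_Rintegral do rewrite hE.
apply.
- move=> w w0 w1 w2; apply: cdifferentiableM; first exact: cdifferentiable_cst.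
  apply: cdifferentiable_dilation; rewrite mul1r; apply: kd.
  + by rewrite -subr_eq0 addrC addKr.
  + by rewrite addrC addKr.
  + by rewrite addrC addKr.
- apply: ccontinuousM; first exact: ccontinuous_cst.
  by apply: ccontinuous_dilation; rewrite mulr0 addr0.
- by rewrite h0 lecR cabs_ge0.
Qed.

End CauchySquare.

(** * Maximum principle and removable singularities *)

Section MaximumPrinciple.
Variable R : realType.
Implicit Types (f g k q : R[i] -> R[i]) (p z w a : R[i]).

Definition box z (r : R) : set R[i] :=
  [set w | `|complex.Re (w - z)| <= r /\ `|complex.Im (w - z)| <= r].

Definition open_box z (r : R) : set R[i] :=
  [set w | `|complex.Re (w - z)| < r /\ `|complex.Im (w - z)| < r].

(** The regularity of a divided difference at its node before removable singularities are known; the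
    maximum principle must accept it. *)
Definition regular_at k p := ccontinuous k p /\
  exists2 d : R, 0 < d & forall w, w != p -> cabs (w - p) < d -> cdifferentiable k w.

Lemma box_center z r : 0 <= r -> box z r z.
Proof. by move=> r0; split; rewrite subrr normr0. Qed.

Lemma cabs_box z r w : cabs (w - z) <= r -> box z r w.
Proof.
by move=> H; split; rewrite (le_trans _ H) ?ler_Re_cabs ?ler_Im_cabs.
Qed.

Lemma box_cabs z r w : box z r w -> cabs (w - z) <= 2 * r.
Proof.
move=> [h1 h2]; rewrite (le_trans (cabs_le_ReIm _))// mulr_natl mulr2n lerD//.
Qed.

Lemma ccontinuousD f g z : ccontinuous f z -> ccontinuous g z ->
  ccontinuous (fun w => f w + g w) z.
Proof.
move=> fz gz e e0; have e20 : 0 < e / 2 by rewrite divr_gt0.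
have [d1 d10 H1] := fz _ e20; have [d2 d20 H2] := gz _ e20.
exists (Num.min d1 d2) => [|w]; first by rewrite lt_min d10.
rewrite lt_min => /andP[/H1 a1 /H2 a2]; rewrite opprD addrACA [e]splitr.
by rewrite (le_trans (cabsD _ _))// lerD.
Qed.

Lemma ccontinuousN f z : ccontinuous f z -> ccontinuous (fun w => - f w) z.
Proof.
by move=> fz e /fz[d d0 H]; exists d => // w /H; rewrite -opprD cabsN.
Qed.

Lemma toC_continuous k (x : R * R) : ccontinuous k (toC x) ->
  {for x, continuous (fun x : R * R => cabs (k (toC x)))}.
Proof.
move=> /ccontinuous_cabs H; apply/cvgrPdist_le => /= e e0.
have [d d0 Hd] := H _ e0.
have d20 : 0 < d / 2 by rewrite divr_gt0.
have := nbhsx_ballx x (d / 2) d20; apply: filterS => y [/= b1 b2].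
rewrite distrC; apply: Hd; rewrite (le_lt_trans (cabs_le_ReIm _))//= [d]splitr ltrD//.
  by move: b1; rewrite /ball/= distrC.
by move: b2; rewrite /ball/= distrC.
Qed.

Lemma expr_lt_small (x e : R) : 0 <= x < 1 -> 0 < e -> exists n, x ^+ n < e.
Proof.
move=> /andP[x0 x1] e0.
have : (fun n : nat => x ^+ n) @ \oo --> (0 : R).
  by apply: cvg_expr; rewrite ger0_norm.
move=> /cvgrPdist_lt/(_ _ e0)[N _ /(_ N (leqnn N))] /=.
by rewrite sub0r normrN ger0_norm ?exprn_ge0// => H; exists N.
Qed.

Lemma Rintegral_cst_unit (c : R) :
  \int[lebesgue_measure]_(t in `[(-1 : R), 1]) c = c * 2.
Proof.
have := @Rintegral_sqr R 0 (- c).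
under eq_Rintegral do rewrite mul0r sub0r opprK.
by move=> ->; ring.
Qed.

(* The trivial bound 1 on the weights of [cauchy_square] gives total mass 8 for
   the four sides but only 6 for three of them, and 6 < 92 / 15; applied to
   powers of [k] this rules out a strict inequality along a whole side. *)
Lemma no_rightmost_max k p (d : R) : 0 < d -> regular_at k p ->
  (forall w, cabs (w - p) < d -> cabs (k w) <= cabs (k p)) ->
  (forall w, cabs (w - p) < d -> complex.Re p < complex.Re w -> cabs (k w) < cabs (k p)) ->
  (forall w, cabs (w - p) < d -> w != p -> ccontinuous k w) -> False.
Proof.
move=> d0 [kc [d1 d10 kd]] kM kR kcw.
pose s : R := Num.min d d1 / 4.
have s0 : 0 < s by rewrite divr_gt0// lt_min d0.
have s2d : s * 2 < Num.min d d1.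
  have : 0 < Num.min d d1 by rewrite lt_min d0.
  by rewrite /s; move: (Num.min d d1) => m; clear; lra.
have {s2d} [s2d s2d1] : s * 2 < d /\ s * 2 < d1 by move: s2d; rewrite lt_min => /andP.
clearbody s.
pose pt (j : nat) (t : R) := 'i ^+ j * (s +i* (s * t)) : R[i].
have ptd j (t : R) : -1 <= t <= 1 -> cabs (pt j t) <= s * 2.
  move=> ht; rewrite /pt cabsM cabs_expi mul1r (le_trans (cabs_le_ReIm _))//=.
  by rewrite normrM gtr0_norm// (_ : s * 2 = s + s) ?lerD2l ?ler_piMr ?(ltW s0) ?ler_norml//; ring.
have pt0 j t : p + pt j t != p.
  rewrite -subr_eq0 addrAC subrr add0r -cabs_eq0 /pt cabsM cabs_expi mul1r cabs_eq0 eq_complex /=.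
  by rewrite gt_eqF.
have addK t : p + t - p = t by rewrite addrAC subrr add0r.
set M := cabs (k p) in kM kR.
have M0 : 0 <= M by exact: cabs_ge0.
have Mc j t : -1 <= t <= 1 -> cabs (k (p + pt j t)) <= M.
  by move=> ht; apply: kM; rewrite addK (le_lt_trans (ptd j t ht)).
have cont n j t : -1 <= t <= 1 ->
    {for t, continuous (fun t => cabs (k (p + pt j t) ^+ n))}.
  move=> ht.
  apply: (@ccontinuous_side R (fun w => k (p + 'i ^+ j * w) ^+ n)).
  apply: ccontinuousX; apply: ccontinuous_dilation.
  by apply: kcw; rewrite ?pt0// addK (le_lt_trans (ptd j t ht)).
(* Index [0] is the right-hand side of the square, all of whose points have larger real part than
   [p]; by compactness the strict inequality has a gap there. *)
have [t0 t0I Ht0] : exists2 t0, -1 <= t0 <= 1 &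
    forall t, -1 <= t <= 1 -> cabs (k (p + pt 0 t)) <= cabs (k (p + pt 0 t0)).
  have [||t0] := @EVT_max R (fun t => cabs (k (p + pt 0 t))) (-1) 1.
  - by rewrite lerN10 || lra.
  - apply: continuous_in_subspaceT => t; rewrite inE/= in_itv/= => ht.
    exact: (cont 1%N 0%N t ht).
  - rewrite in_itv/= => h1 h2; exists t0 => // t ht; apply: h2; rewrite in_itv.
set m := cabs (k (p + pt 0 t0)) in Ht0.
have mM : m < M.
  apply: kR; first by rewrite addK (le_lt_trans (ptd 0%N t0 t0I)).
  by rewrite /pt expr0 mul1r raddfD/= ltrDl.
have m0 : 0 <= m by exact: cabs_ge0.
have MM : 0 < M by exact: le_lt_trans mM.
(* The surplus of [92 / 15] over the mass 6 of the other three sides is [2 / 15]; it has to beat the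
   right side of length 2, whence the ratio [1 / 15]. *)
have [n] := @expr_lt_small (m / M) (1 / 15) ltac:(by rewrite divr_ge0//= ltr_pdivrMr// mul1r) ltac:(by rewrite divr_gt0).
rewrite expr_div_n ltr_pdivrMr ?exprn_gt0// => Hn.
have := @cauchy_square R (fun w => k w ^+ n) p s s0.
rewrite cabsX -/M !big_ord_recr big_ord0 /= add0r.
have bd j (c : R) : (forall t, -1 <= t <= 1 -> cabs (k (p + pt j t)) <= c) ->
    \int[lebesgue_measure]_(t in `[-1, 1]) cabs (k (p + pt j t) ^+ n) <= c ^+ n * 2.
  move=> hc.
  have -> : c ^+ n * 2 = \int[lebesgue_measure]_(t in `[(-1 : R), 1]) (c ^+ n).
    by rewrite Rintegral_cst_unit.
  apply: le_Rintegral => //.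
  - apply: integrable_segment => t ht.
    exact: (cont n j t ht).
  - by apply: integrable_segment => t ht; exact: cvg_cst.
  - move=> t /=; rewrite in_itv/= => ht; rewrite cabsX lerXn2r ?nnegrE ?cabs_ge0 ?hc//.
    exact: le_trans (cabs_ge0 _) (hc _ ht).
have B0 := bd 0%N m Ht0.
have B1 := bd 1%N M (Mc 1%N).
have B2 := bd 2%N M (Mc 2%N).
have B3 := bd 3%N M (Mc 3%N).
move=> H; have {}H := H _ _.
have Mn0 : 0 < M ^+ n by rewrite exprn_gt0.
suff : M ^+ n * (92 / 15) <= m ^+ n * 2 + M ^+ n * 2 + M ^+ n * 2 + M ^+ n * 2.
  by move=> h; clear -h Hn Mn0; lra.
apply: (@le_trans _ _ _ _ _ (H _ _)).
- move=> w wp w1 w2; apply: cdifferentiableX; apply: kd => //.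
  rewrite (le_lt_trans (box_cabs (conj w1 w2)))//.
  by rewrite mulrC.
- exact: ccontinuousX.
- exact: (lerD (lerD (lerD B0 B1) B2) B3).
Qed.

Lemma open_box_ball z r p : open_box z r p ->
  exists2 d : R, 0 < d & forall w, cabs (w - p) < d -> open_box z r w.
Proof.
move=> [h1 h2]; exists (Num.min (r - `|complex.Re (p - z)|) (r - `|complex.Im (p - z)|)).
  by rewrite lt_min !subr_gt0 h1.
move=> w; rewrite lt_min => /andP[w1 w2].
have E : w - z = (w - p) + (p - z) by ring.
split; rewrite E raddfD /= (le_lt_trans (ler_normD _ _))// -ltrBrDr.
  exact: le_lt_trans (ler_Re_cabs _) w1.
exact: le_lt_trans (ler_Im_cabs _) w2.
Qed.

Definition square z (r : R) : set (R * R) :=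
  `[complex.Re z - r, complex.Re z + r] `*` `[complex.Im z - r, complex.Im z + r].

Lemma squareE z r (x : R * R) : square z r x <-> box z r (toC x).
Proof.
rewrite /square /box /= !in_itv /= /toC; case: x => x y /=; case: z => a b /=.
by rewrite !ler_distl.
Qed.

Lemma square_compact z r : compact (square z r).
Proof. by apply: compact_setX; exact: segment_compact. Qed.

Lemma box_max k z (r : R) : 0 <= r -> (forall p, box z r p -> ccontinuous k p) ->
  exists2 c, box z r c & forall p, box z r p -> cabs (k p) <= cabs (k c).
Proof.
move=> r0 kc.
have [c cK cmax] : exists2 c, c \in square z r & forall t, t \in square z r ->
    cabs (k (toC t)) <= cabs (k (toC c)).
  apply: (@compact_EVT_max _ R (fun x : R * R => cabs (k (toC x)))) => //.
  - exists (complex.Re z, complex.Im z); apply/squareE; rewrite /toC /=.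
    have -> : complex.Re z +i* complex.Im z = z by case: (z).
    exact: box_center.
  - exact: square_compact.
  - apply: continuous_in_subspaceT => x.
    by rewrite inE => /squareE/kc; exact: toC_continuous.
exists (toC c); first by apply/squareE; rewrite inE in cK.
move=> p pb; have pK : square z r (complex.Re p, complex.Im p).
  by apply/squareE; rewrite /toC /=; case: (p) pb.
by have := cmax _ (mem_set pK); rewrite /toC /=; case: (p).
Qed.

(** Suppose the maximum exceeds [m]. The points where it is attained form a compact set; one with
    the largest real part is interior, and to its right the modulus is strictly smaller, which
    [no_rightmost_max] forbids. *)
Lemma max_principle k z (r m : R) : 0 < r ->
  (forall p, open_box z r p -> regular_at k p) ->
  (forall p, box z r p -> ccontinuous k p) ->
  (forall p, box z r p -> ~ open_box z r p -> cabs (k p) <= m) ->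
  forall p, box z r p -> cabs (k p) <= m.
Proof.
move=> r0 kreg kc km.
have [c0 c0b c0max] := box_max (ltW r0) kc.
pose c := (complex.Re c0, complex.Im c0).
have cE : toC c = c0 by rewrite /toC /=; case: (c0).
pose K := square z r.
pose u (x : R * R) := cabs (k (toC x)).
have uc x : K x -> {for x, continuous u}.
  by move=> /squareE/kc; exact: toC_continuous.
have cK : K c by apply/squareE; rewrite cE.
have cmax x : K x -> u x <= u c by rewrite /u cE => /squareE/c0max.
have Kc : compact K by exact: square_compact.
have [um|] := leP (u c) m.
  by move=> p /c0max h; rewrite (le_trans h)// -cE.
move=> mM; exfalso; set M := u c in mM cmax.
pose S := K `&` [set q | M <= u q].
have Scl : closed S.
  rewrite -[S]setCK; apply: open_closedC; rewrite openE => q /= qnS.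
  have [qK|qK] := pselect (K q); last first.
    have : open (~` K).
      by apply: closed_openC; apply: compact_closed => //; exact: norm_hausdorff.
    by rewrite openE => /(_ q qK); apply: filterS => q' h [].
  have uq : u q < M by rewrite ltNge; apply/negP => h; apply: qnS.
  have := uc q qK; move/cvgrPdist_lt => /(_ (M - u q)); rewrite subr_gt0 => /(_ uq).
  apply: filterS => q' /=; rewrite distrC => h [_ /=]; rewrite leNgt => /negP; apply.
  by rewrite -(ltrD2r (- u q)) (le_lt_trans (ler_norm _)).
have Sc : compact S by apply: (subclosed_compact Scl Kc) => q [].
have [p pS pmax] : exists2 p, p \in S & forall t, t \in S -> t.1 <= p.1.
  apply: compact_EVT_max => //.
  - by exists c; split => //=; rewrite lexx.
  - by apply: continuous_subspaceT => q; exact: cvg_fst.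
move: pS; rewrite inE => -[pK /= Mp].
have pM : u p = M by apply/eqP; rewrite eq_le Mp andbT; exact: cmax.
have pb : box z r (toC p) by exact/squareE.
have po : open_box z r (toC p).
  by apply: contrapT => npo; have := km _ pb npo; rewrite leNgt -/(u p) pM mM.
have [d d0 Hd] := open_box_ball po.
have inK w : cabs (w - toC p) < d -> K (complex.Re w, complex.Im w).
  move=> /Hd[h1 h2]; apply/squareE; rewrite /toC /=.
  have -> : complex.Re w +i* complex.Im w = w by case: (w).
  by split; exact: ltW.
have uE w : u (complex.Re w, complex.Im w) = cabs (k w).
  by rewrite /u /toC /=; case: (w).
apply: (@no_rightmost_max k (toC p) d d0 (kreg _ po)).
- by move=> w wd; rewrite -uE -/(u p) pM; apply: cmax; exact: inK.
- move=> w wd wr; rewrite -uE -/(u p) pM lt_neqAle cmax ?andbT; last exact: inK.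
  apply/eqP => h; have /pmax/= : (complex.Re w, complex.Im w) \in S.
    by rewrite inE; split; [exact: inK|rewrite /= h].
  by rewrite leNgt wr.
- by move=> w /Hd[h1 h2] _; apply: kc; split; exact: ltW.
Qed.

(** The infimum of the upper envelopes [e t + C t] is a limit at [0] with the rate [C t]. *)
Lemma lipschitz_limit0 (e : R -> R) (C r : R) : 0 <= C -> 0 < r ->
  (forall s t, 0 < s <= r -> 0 < t <= r -> `|e s - e t| <= C * `|s - t|) ->
  exists A, forall t, 0 < t <= r -> `|e t - A| <= C * t.
Proof.
move=> C0 r0 H; pose S := [set e t + C * t | t in [set t | 0 < t <= r]].
have lb t x : 0 < t <= r -> S x -> e t - C * t <= x.
  move=> ht [s hs <-]; have := H _ _ ht hs.
  move: ht hs => /andP[t0 tr] /andP[s0 sr].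
  rewrite ler_norml => /andP[_ h].
  have : `|t - s| <= t + s by rewrite (le_trans (ler_normB _ _))// !gtr0_norm.
  by move=> /(ler_wpM2l C0); rewrite mulrDr => h'; clear -h h'; lra.
have Sne : S !=set0 by exists (e r + C * r), r => //=; rewrite r0 lexx.
exists (inf S) => t ht.
have h1 : e t - C * t <= inf S by apply: lb_le_inf => // x; exact: lb.
have h2 : inf S <= e t + C * t.
  apply: ge_inf; last by exists t.
  by exists (e t - C * t) => x; exact: lb.
by rewrite ler_norml; apply/andP; split; clear -h1 h2; lra.
Qed.

Lemma differentiable_regular k p (d : R) : 0 < d ->
  (forall w, cabs (w - p) < d -> cdifferentiable k w) -> regular_at k p.
Proof.
move=> d0 H; split; last by exists d => // w _; exact: H.
by apply: cdifferentiable_continuous; apply: H; rewrite subrr cabs0.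
Qed.

(** The difference quotients [E w] at [a] are shown to be Lipschitz in [w], again by the maximum
    principle. Their limit along the positive direction exists therefore, and the Lipschitz bound
    carries it over to all directions. *)
Lemma removable q a (r : R) : 0 < r ->
  (forall w, box a r w -> w != a -> cdifferentiable q w) -> ccontinuous q a ->
  cdifferentiable q a.
Proof.
move=> r0 qd qc.
have qcb w : box a r w -> ccontinuous q w.
  have [->//|wa] := eqVneq w a; move=> wb; apply: cdifferentiable_continuous; exact: qd.
have [B B0 HB] : exists2 B : R, 0 <= B & forall w, box a r w -> cabs (q w) <= B.
  have [c _ Hc] := box_max (ltW r0) qcb.
  by exists (cabs (q c)); [exact: cabs_ge0|].
have regq p : open_box a r p -> regular_at q p.
  move=> po; have [d d0 Hd] := open_box_ball po.
  have [->|pa] := eqVneq p a.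
    split => //; exists r => // w wa wr; apply: qd => //; apply: cabs_box; exact: ltW.
  apply: (@differentiable_regular _ _ (Num.min d (cabs (p - a)))).
    by rewrite lt_min d0 cabs_gt0 subr_eq0.
  move=> w; rewrite lt_min => /andP[/Hd[h1 h2] h3]; apply: qd; first by split; exact: ltW.
  by apply: contraTneq h3 => ->; rewrite cabsC ltxx.
have r20 : 0 < r / 2 by rewrite divr_gt0.
(* The maximum principle bounds the divided difference with node [w] uniformly in [w]. *)
pose Y w z := if z == w then cderiv q w else (q z - q w) / (z - w).
have wdiff w : box a (r / 2) w -> w != a -> cdiff q w (cderiv q w).
  move=> [h1 h2] wa; have [|b Hb] := qd w _ wa.
    by split; rewrite (le_trans h1, le_trans h2)// ler_pdivrMr// ler_pMr// ler1n.
  by have [_ ->] := cdiff_derivable Hb.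
have wbox w : box a (r / 2) w -> box a r w.
  by move=> [h1 h2]; split; rewrite (le_trans h1, le_trans h2)// ler_pdivrMr// ler_pMr// ler1n.
have far w z : box a (r / 2) w -> ~ open_box a r z -> r / 2 <= cabs (z - w).
  move=> [h1 h2] nz; rewrite leNgt; apply/negP => h; apply: nz.
  have E : z - a = (z - w) + (w - a) by ring.
  split; rewrite E raddfD /= (le_lt_trans (ler_normD _ _))// [ltRHS]splitr ltr_leD//.
    exact: le_lt_trans (ler_Re_cabs _) h.
  exact: le_lt_trans (ler_Im_cabs _) h.
have Yc w z : box a (r / 2) w -> w != a -> box a r z -> ccontinuous (Y w) z.
  move=> wb wa zb; have [->|zw] := eqVneq z w.
    move=> e e0; have [d d0 Hd] := wdiff w wb wa e e0.
    exists d => // x xd; rewrite /Y eqxx; case: eqVneq => [_|xw].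
      by rewrite subrr cabs0 ltW.
    have := Hd _ xd; rewrite [w + _]addrC subrK => h.
    have xw0 : 0 < cabs (x - w) by rewrite cabs_gt0 subr_eq0.
    rewrite -(ler_pM2r xw0) -cabsM mulrBl mulfVK//.
    by rewrite subr_eq0.
  have zw0 : z - w != 0 by rewrite subr_eq0.
  apply: (@ccontinuous_near _ (fun x => (q x - q w) * (x - w)^-1) _ _ (cabs (z - w))).
  - by rewrite cabs_gt0.
  - by move=> x xd; rewrite /Y; case: eqVneq xd => // ->; rewrite cabsC ltxx.
  - apply: ccontinuousM.
      move=> e e0; have [d d0 Hd] := qcb z zb e e0; exists d => // x /Hd.
      by rewrite (_ : q x - q w - (q z - q w) = q x - q z)//; ring.
    apply: cdifferentiable_continuous; apply: cdifferentiableV => //.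
    by apply: cdifferentiableB; [exact: cdifferentiable_id|exact: cdifferentiable_cst].
have Yd w x : x != w -> cdifferentiable q x -> cdifferentiable (Y w) x.
  move=> xw qx.
  apply: (@cdifferentiable_near _ (fun x => (q x - q w) / (x - w)) _ _ (cabs (x - w))).
  - by rewrite cabs_gt0 subr_eq0.
  - by move=> y yx; rewrite /Y; case: eqVneq yx => // ->; rewrite cabsC ltxx.
  - apply: cdifferentiable_div; first by rewrite subr_eq0.
      by apply: cdifferentiableB => //; exact: cdifferentiable_cst.
    by apply: cdifferentiableB; [exact: cdifferentiable_id|exact: cdifferentiable_cst].
have Yreg w p : box a (r / 2) w -> w != a -> open_box a r p -> regular_at (Y w) p.
  move=> wb wa po; split.
    by apply: Yc => //; case: po => h1 h2; split; exact: ltW.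
  have [_ [d d0 Hd]] := regq p po.
  have [wp|pw] := eqVneq w p.
    by exists d => // x xp xd; apply: Yd; rewrite ?wp//; exact: Hd.
  exists (Num.min d (cabs (w - p))); first by rewrite lt_min d0 cabs_gt0 subr_eq0.
  move=> x xp; rewrite lt_min => /andP[xd xw].
  by apply: Yd; [apply: contraTneq xw => ->; rewrite ltxx|exact: Hd].
have Ybd w z : box a (r / 2) w -> w != a -> box a r z -> cabs (Y w z) <= 4 * B / r.
  move=> wb wa; apply: max_principle => // [p|p|p pb npo]; [exact: Yreg|exact: Yc|].
  have pw := far _ _ wb npo.
  have pw0 : 0 < cabs (p - w) by exact: lt_le_trans pw.
  rewrite /Y ifF; last by apply/negbTE; rewrite -subr_eq0 -cabs_gt0.
  rewrite cabsM cabsV ler_pdivrMr//.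
  apply: (@le_trans _ _ (B + B)).
    by rewrite (le_trans (cabsB_le _ _))// lerD ?HB//; exact: wbox.
  rewrite (_ : B + B = 4 * B / r * (r / 2)); last by field; rewrite gt_eqF.
  by rewrite ler_wpM2l// divr_ge0 ?mulr_ge0// ltW.
pose L := 4 * B / r.
have L0 : 0 <= L by rewrite divr_ge0 ?mulr_ge0// ltW.
have qlip w z : box a (r / 2) w -> w != a -> box a r z -> cabs (q z - q w) <= L * cabs (z - w).
  move=> wb wa zb; have [->|zw] := eqVneq z w; first by rewrite !subrr cabs0 mulr0.
  have := Ybd w z wb wa zb; rewrite /Y (negbTE zw) cabsM cabsV ler_pdivrMr//.
  by rewrite cabs_gt0 subr_eq0.
(* On the boundary [Y w - Y w'] splits into a term of size [2 B |w - w'| / (r / 2) ^ 2] and one of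
   size [L |w - w'| / (r / 2)]. *)
pose C := 8 * B / r ^+ 2 + 2 * L / r.
have C0 : 0 <= C.
  by have r0' := ltW r0; rewrite /C addr_ge0 ?divr_ge0 ?mulr_ge0 ?invr_ge0 ?exprn_ge0 ?ler0n.
pose E w := (q w - q a) / (w - a).
have Elip w w' : box a (r / 2) w -> w != a -> box a (r / 2) w' -> w' != a ->
    cabs (E w - E w') <= C * cabs (w - w').
  move=> wb wa wb' wa'.
  (* The divided difference is symmetric: the nodes [w], [w'] now appear as parameters, and the
     point [a] as the variable to which the maximum principle applies. *)
  have -> : E w - E w' = Y w a - Y w' a.
    rewrite /Y ![a == _]eq_sym (negbTE wa) (negbTE wa') /E.
    by rewrite -[q a - q w]opprB -[a - w]opprB -[q a - q w']opprB -[a - w']opprB !invrN !mulrNN.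
  suff : forall z, box a r z -> cabs (Y w z + (- Y w' z)) <= C * cabs (w - w').
    by apply; apply: box_center; exact: ltW.
  apply: (max_principle r0) => [p po|p pb|p pb npo].
  - have [c1 [d1 d10 H1]] := Yreg w p wb wa po.
    have [c2 [d2 d20 H2]] := Yreg w' p wb' wa' po.
    split; first by apply: ccontinuousD => //; exact: ccontinuousN.
    exists (Num.min d1 d2); first by rewrite lt_min d10.
    move=> x xp; rewrite lt_min => /andP[x1 x2].
    by apply: cdifferentiableB; [exact: H1|exact: H2].
  - by apply: ccontinuousD; [exact: Yc|apply: ccontinuousN; exact: Yc].
  - have pw := far _ _ wb npo; have pw' := far _ _ wb' npo.
    have pw0 : 0 < cabs (p - w) by exact: lt_le_trans pw.
    have pw0' : 0 < cabs (p - w') by exact: lt_le_trans pw'.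
    have [pwn pwn'] : p - w != 0 /\ p - w' != 0 by rewrite -!cabs_gt0.
    have -> : Y w p + - Y w' p = (q p - q w) * (w - w') / ((p - w) * (p - w')) -
        (q w - q w') / (p - w').
      rewrite /Y !ifF; [|by apply/negbTE; rewrite -subr_eq0..].
      by field; rewrite pwn pwn'.
    rewrite (le_trans (cabsB_le _ _))// /C [leRHS]mulrDl lerD//.
      rewrite !cabsM cabsV cabsM ler_pdivrMr ?mulr_gt0//.
      apply: (@le_trans _ _ (2 * B * cabs (w - w'))).
        rewrite ler_wpM2r ?cabs_ge0// mulr_natl mulr2n.
        by rewrite (le_trans (cabsB_le _ _))// lerD ?HB//; exact: wbox.
      rewrite (_ : 2 * B * _ = 8 * B / r ^+ 2 * cabs (w - w') * (r / 2 * (r / 2))); last first.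
        by field; rewrite gt_eqF.
      rewrite ler_wpM2l ?mulr_ge0 ?cabs_ge0 ?invr_ge0 ?exprn_ge0 ?(ltW r0)//.
      by rewrite ler_pM// ltW.
    rewrite cabsM cabsV ler_pdivrMr// (le_trans (qlip w' w wb' wa' (wbox _ wb)))//.
    rewrite (_ : L * _ = 2 * L / r * cabs (w - w') * (r / 2)); last by field; rewrite gt_eqF.
    by rewrite ler_wpM2l// !mulr_ge0 ?cabs_ge0 ?invr_ge0// ltW.
have ptE (t : R) : 0 < t <= r / 2 -> box a (r / 2) (a + t%:C) /\ a + t%:C != a.
  move=> /andP[t0 tr]; split.
    by apply: cabs_box; rewrite addrAC subrr add0r cabs_real gtr0_norm.
  by rewrite -subr_eq0 addrAC subrr add0r -cabs_eq0 cabs_real normr_eq0 gt_eqF.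
have Et (s t : R) : 0 < s <= r / 2 -> 0 < t <= r / 2 ->
    cabs (E (a + s%:C) - E (a + t%:C)) <= C * `|s - t|.
  move=> /ptE[s1 s2] /ptE[t1 t2]; rewrite (le_trans (Elip _ _ s1 s2 t1 t2))//.
  by rewrite opprD addrACA subrr add0r -rmorphB cabs_real.
have [x Hx] : exists x, forall t, 0 < t <= r / 2 -> `|complex.Re (E (a + t%:C)) - x| <= C * t.
  apply: lipschitz_limit0 => // s t hs ht; rewrite (le_trans _ (Et _ _ hs ht))//.
  by rewrite -raddfB ler_Re_cabs.
have [y Hy] : exists y, forall t, 0 < t <= r / 2 -> `|complex.Im (E (a + t%:C)) - y| <= C * t.
  apply: lipschitz_limit0 => // s t hs ht; rewrite (le_trans _ (Et _ _ hs ht))//.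
  by rewrite -raddfB ler_Im_cabs.
exists (x +i* y) => e e0.
(* [2 C] is the cost of passing from [a + h] to [a + |h|], and [C] each that of the real and
   imaginary limits along the ray. *)
have C1 : 0 < 4 * C + 1 by rewrite ltr_wpDl// mulr_ge0.
exists (Num.min (r / 2) (e / (4 * C + 1))); first by rewrite lt_min r20 divr_gt0.
move=> h; rewrite lt_min => /andP[h1 h2].
have [->|h0] := eqVneq h 0; first by rewrite addr0 subrr mulr0 subr0 cabs0 mulr0.
have ch0 : 0 < cabs h by rewrite cabs_gt0.
have hr : 0 < cabs h <= r / 2 by rewrite ch0 ltW.
have hb : box a (r / 2) (a + h) by apply: cabs_box; rewrite addrAC subrr add0r ltW.
have ha : a + h != a by rewrite -subr_eq0 addrAC subrr add0r.
have [tb ta] := ptE _ hr.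
have -> : q (a + h) - q a - (x +i* y) * h = (E (a + h) - (x +i* y)) * h.
  by rewrite mulrBl /E (_ : a + h - a = h) ?mulfVK// addrAC subrr add0r.
rewrite cabsM ler_pM2r//.
rewrite (le_trans (cabs_triangle (E (a + (cabs h)%:C)) _ _))//.
have e1 : cabs (E (a + h) - E (a + (cabs h)%:C)) <= C * (2 * cabs h).
  rewrite (le_trans (Elip _ _ hb ha tb ta))// ler_wpM2l//.
  rewrite opprD addrACA subrr add0r (le_trans (cabsB_le _ _))//.
  by rewrite cabs_real (gtr0_norm ch0) mulr_natl mulr2n.
have e2 : cabs (E (a + (cabs h)%:C) - (x +i* y)) <= C * cabs h + C * cabs h.
  rewrite (le_trans (cabs_le_ReIm _))// !raddfB /= lerD//; [exact: Hx|exact: Hy].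
have e3 : (4 * C + 1) * cabs h < e by rewrite mulrC -ltr_pdivlMr.
have := lerD e1 e2; move=> /le_trans; apply; rewrite (le_trans _ (ltW e3))//.
rewrite (_ : C * (2 * cabs h) + (C * cabs h + C * cabs h) = 4 * C * cabs h); last by ring.
by rewrite ler_wpM2r ?cabs_ge0// lerDl.
Qed.

End MaximumPrinciple.

(** * Sub-mean value inequality *)

Section PlaneMeasure.
Variable R : realType.
Local Notation leb := (@lebesgue_measure R).
Local Notation plane := (measurableTypeR R * measurableTypeR R)%type.

(** An open set is the union of the half-open grid cells of mesh [1 / (n + 1)] that it contains, a
    countable family of rectangles. *)
Lemma open_measurable_plane (U : set (R * R)) : open U -> measurable (U : set plane).
Proof.
move=> oU.
pose cell (q : nat * int * int) : set plane :=
  `[q.1.2%:~R / q.1.1.+1%:R, (q.1.2 + 1)%:~R / q.1.1.+1%:R[ `*`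
  `[q.2%:~R / q.1.1.+1%:R, (q.2 + 1)%:~R / q.1.1.+1%:R[.
have -> : U = \bigcup_(q in [set q | cell q `<=` U]) cell q.
  apply/seteqP; split => [[x y] Uxy|x [q /= qU]]; last exact: qU.
  have /nbhs_ballP[e /= e0 He] : nbhs (x, y) U by move: oU; rewrite openE => /(_ _ Uxy).
  have [n Hn] : exists n, e^-1 < n.+1%:R.
    by exists (Num.bound e^-1); rewrite (lt_trans (archi_boundP _)) ?ltr_nat// invr_ge0 ltW.
  have n0 : 0 < n.+1%:R :> R by [].
  have ne : n.+1%:R^-1 < e by rewrite -[e]invrK ltf_pV2 ?posrE ?invr_gt0.
  have fl (t : R) : (Num.floor (t * n.+1%:R))%:~R / n.+1%:R <= t /\
      t < (Num.floor (t * n.+1%:R) + 1)%:~R / n.+1%:R.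
    by rewrite ler_pdivrMr// ltr_pdivlMr// floor_le lt_succ_floor.
  have cl0 (a b u v : R) : u < e -> v <= a -> a < v + u -> v <= b -> b < v + u -> `|a - b| < e.
    by rewrite ltr_norml => *; apply/andP; split; lra.
  have cl (a b : R) (i : int) : i%:~R / n.+1%:R <= a -> a < (i + 1)%:~R / n.+1%:R ->
      i%:~R / n.+1%:R <= b -> b < (i + 1)%:~R / n.+1%:R -> `|a - b| < e.
    by rewrite intrD mulrDl mul1r; exact: cl0.
  exists (n, Num.floor (x * n.+1%:R), Num.floor (y * n.+1%:R)) => /=; last first.
    by split; rewrite /= in_itv /=; apply/andP; exact: fl.
  move=> [a b] [/=]; rewrite !in_itv /= => /andP[a1 a2] /andP[b1 b2].
  have [x1 x2] := fl x; have [y1 y2] := fl y.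
  apply: He; split; rewrite /ball /=; [exact: cl x1 x2 a1 a2|exact: cl y1 y2 b1 b2].
rewrite bigcup_mkcond; apply: countable_bigcupT_measurable; [exact: countableP|move=> q].
case: ifP => _; last exact: measurable0.
by apply: measurableX; exact: measurable_itv.
Qed.

Lemma continuous_measurable_plane (f : R * R -> R) : continuous f ->
  measurable_fun [set: plane] f.
Proof.
move=> /continuousP cf; apply: (measurability _ (measurable_realfun.RGenOpens.measurableE R)).
move=> _ [_ [a [b ->] <-]]; rewrite setTI; apply: open_measurable_plane.
exact/cf/interval_open.
Qed.

Lemma pair_continuous (T U V : topologicalType) (f : T -> U) (g : T -> V) (x : T) :
  {for x, continuous f} -> {for x, continuous g} -> {for x, continuous (fun y => (f y, g y))}.
Proof. by move=> fc gc; apply: cvg_pair. Qed.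

Lemma tonelli_rect (f : plane -> \bar R) (A B : set R) :
  measurable (A : set (measurableTypeR R)) -> measurable (B : set (measurableTypeR R)) ->
  measurable_fun [set: plane] f -> (forall p, 0 <= f p)%E ->
  [/\ (\int[leb2]_(p in (A `*` B : set plane)) f p =
       \int[leb]_(x in A) \int[leb]_(y in B) f (x, y))%E,
      (\int[leb2]_(p in (A `*` B : set plane)) f p =
       \int[leb]_(y in B) \int[leb]_(x in A) f (x, y))%E,
      measurable_fun [set: measurableTypeR R] (fun x => (\int[leb]_(y in B) f (x, y))%E) &
      measurable_fun [set: measurableTypeR R] (fun y => (\int[leb]_(x in A) f (x, y))%E)].
Proof.
move=> mA mB mf f0.
have mAB : measurable (A `*` B : set plane) by exact: measurableX.
pose F := f \_ (A `*` B).
have mF : measurable_fun [set: plane] F.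
  by apply/(measurable_restrictT _ _).1 => //; exact: measurable_funTS.
have F0 p : (0 <= F p)%E by rewrite /F patchE; case: ifP.
have mf1 (C : set R) : measurable (C : set (measurableTypeR R)) ->
    measurable_fun [set: plane] (f \_ (setT `*` C)).
  move=> mC; apply/(measurable_restrictT _ _).1; first exact: measurableX.
  exact: measurable_funTS.
have mf2 (C : set R) : measurable (C : set (measurableTypeR R)) ->
    measurable_fun [set: plane] (f \_ (C `*` setT)).
  move=> mC; apply/(measurable_restrictT _ _).1; first exact: measurableX.
  exact: measurable_funTS.
split.
- rewrite integral_mkcond fubini_tonelli1// [RHS]integral_mkcond.
  apply: eq_integral => x _; rewrite /fubini_F patchE; case: ifPn => xA.
    rewrite [RHS]integral_mkcond; apply: eq_integral => y _.
    by rewrite !patchE in_setX xA.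
  rewrite (eq_integral (fun=> 0%E)) ?integral0// => y _.
  by rewrite patchE in_setX (negbTE xA).
- rewrite integral_mkcond fubini_tonelli2// [RHS]integral_mkcond.
  apply: eq_integral => y _; rewrite /fubini_G patchE; case: ifPn => yB.
    rewrite [RHS]integral_mkcond; apply: eq_integral => x _.
    by rewrite !patchE in_setX yB andbT.
  rewrite (eq_integral (fun=> 0%E)) ?integral0// => x _.
  by rewrite patchE in_setX (negbTE yB) andbF.
- have := @measurable_fun_fubini_tonelli_F _ _ _ _ R leb _ (mf1 B mB) _.
  rewrite /fubini_F.
  have -> : (fun x => \int[leb]_y (f \_ (setT `*` B)) (x, y))%E = (fun x => \int[leb]_(y in B) f (x, y))%E.
    apply/funext => x; rewrite [RHS]integral_mkcond; apply: eq_integral => y _.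
    by rewrite !patchE in_setX in_setT.
  by apply=> p; rewrite patchE; case: ifP.
- have := @measurable_fun_fubini_tonelli_G _ _ _ _ R leb _ (mf2 A mA) _.
  rewrite /fubini_G.
  have -> : (fun y => \int[leb]_x (f \_ (A `*` setT)) (x, y))%E = (fun y => \int[leb]_(x in A) f (x, y))%E.
    apply/funext => y; rewrite [RHS]integral_mkcond; apply: eq_integral => x _.
    by rewrite !patchE in_setX in_setT andbT.
  by apply=> p; rewrite patchE; case: ifP.
Qed.

Lemma integral_affine (h : R -> R) (c t a b : R) : continuous h -> 0 < t -> a < b ->
  (\int[leb]_(x in `[(c + t * a)%R, (c + t * b)%R]) (h x)%:E =
   t%:E * \int[leb]_(x in `[a, b]) (h (c + t * x)%R)%:E)%E /\
  (\int[leb]_(x in `[(c - t * b)%R, (c - t * a)%R]) (h x)%:E =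
   t%:E * \int[leb]_(x in `[a, b]) (h (c - t * x)%R)%:E)%E.
Proof.
move=> hc t0 ab.
(* The margin 1 puts both image intervals inside the open interval on which the indefinite integral
   [H] is differentiable. *)
pose lo := Num.min (c + t * a) (c - t * b) - 1.
pose hi := Num.max (c + t * b) (c - t * a) + 1.
have loa : lo < c + t * a by rewrite ltrBlDr gt_min ltrDl ltr01.
have lob : lo < c - t * b by rewrite ltrBlDr gt_min ltrDl ltr01 orbT.
have hia : c + t * b < hi by rewrite -ltrBlDr lt_max ltrBlDr ltrDl ltr01.
have hib : c - t * a < hi.
  apply: (@le_lt_trans _ _ (Num.max (c + t * b) (c - t * a))); last by rewrite ltrDl.
  by rewrite le_max lexx orbT.
have tab : t * a < t * b by rewrite ltr_pM2l.
pose H x := (\int[leb]_(y in `[lo, x]) h y)%R.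
have hi' : lebesgue_measure.-integrable `[lo, hi] (EFin \o h).
  by apply: integrable_segment => x _; exact: hc.
have dH x : lo < x < hi -> is_derive x 1 H (h x).
  move=> /andP[x1 x2]; have [|Fd Fx] := continuous_FTC1 x2 hi' _ (hc x).
    by first [exact: x1|exact: ltW x1].
  by split; [exact: Fd|rewrite -derive1E; exact: Fx].
have E1 u v : lo < u -> u < v -> v < hi ->
    (\int[leb]_(x in `[u, v]) (h x)%:E = (H v)%:E - (H u)%:E)%E.
  move=> lu uv vh; apply: continuous_FTC2 => //.
  - exact: continuous_subspaceT.
  - split.
    + move=> x; rewrite in_itv /= => /andP[x1 x2].
      by have [] := dH x; rewrite ?(lt_trans lu x1) ?(lt_trans x2 vh).
    + apply: cvg_at_right_filter; apply: differentiable_continuous; apply/derivable1_diffP.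
      by have [] := dH u; rewrite ?lu ?(lt_trans uv vh).
    + apply: cvg_at_left_filter; apply: differentiable_continuous; apply/derivable1_diffP.
      by have [] := dH v; rewrite ?vh ?(lt_trans lu uv).
  - move=> x; rewrite in_itv /= => /andP[x1 x2]; rewrite derive1E.
    by have [] := dH x; rewrite ?(lt_trans lu x1) ?(lt_trans x2 vh).
have E2 (s : R) : s != 0 -> (forall x, a <= x <= b -> lo < c + s * x < hi) ->
    (\int[leb]_(x in `[a, b]) (h (c + s * x)%R)%:E =
      (s^-1 * H (c + s * b))%:E - (s^-1 * H (c + s * a))%:E)%E.
  move=> s0 Hs.
  have dG x : a <= x <= b -> is_derive x 1 (fun x => s^-1 * H (c + s * x)) (h (c + s * x)).
    move=> /Hs/dH dHx.
    have dl : is_derive x 1 (fun x => c + s * x) s.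
      by apply: is_derive_eq; rewrite /GRing.scale /=; ring.
    have := is_deriveM (is_derive_cst s^-1 x 1) (@is_derive1_comp R H (fun x => c + s * x) x _ _ dHx dl).
    move=> hd; apply: (is_derive_eq hd).
    by rewrite /GRing.scale /= mulr0 addr0 mulrCA mulVf// mulr1.
  apply: (@continuous_FTC2 _ _ (fun x => s^-1 * H (c + s * x))) => //.
  - apply: continuous_subspaceT => x; apply: continuous_comp; last exact: hc.
    by apply: differentiable_continuous; exact/derivable1_diffP.
  - have cG x : a <= x <= b -> {for x, continuous (fun x => s^-1 * H (c + s * x))}.
      move=> /dG[dGx _]; apply: differentiable_continuous; exact/derivable1_diffP.
    split.
    + by move=> x; rewrite in_itv /= => /andP[x1 x2]; have [] := dG x; rewrite ?ltW.
    + by apply: cvg_at_right_filter; apply: cG; rewrite lexx ltW.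
    + by apply: cvg_at_left_filter; apply: cG; rewrite lexx ltW.
  - move=> x; rewrite in_itv /= => /andP[x1 x2]; rewrite derive1E.
    by have [] := dG x; rewrite ?ltW.
split.
  rewrite E1//; last by rewrite ltrD2l.
  rewrite (E2 t) ?gt_eqF//; last first.
    move=> x /andP[x1 x2]; rewrite (lt_le_trans loa) ?lerD2l ?ler_pM2l//=.
    by rewrite (le_lt_trans _ hia)// lerD2l ler_pM2l.
  by rewrite -!EFinB -EFinM; congr EFin; field; rewrite gt_eqF.
rewrite E1//; last by rewrite ltrD2l ltrN2.
have -> : (fun x => (h (c - t * x)%R)%:E) = (fun x => (h (c + (- t) * x)%R)%:E).
  by apply/funext => x; rewrite mulNr.
rewrite (E2 (- t)) ?oppr_eq0 ?gt_eqF//; last first.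
  move=> x /andP[x1 x2]; rewrite mulNr (lt_le_trans lob) ?lerD2l ?lerN2 ?ler_pM2l//=.
  by rewrite (le_lt_trans _ hib)// lerD2l lerN2 ler_pM2l.
by rewrite -!EFinB -EFinM; congr EFin; rewrite !mulNr; field; rewrite gt_eqF.
Qed.


Lemma integral_cst_itv (a b c : R) : a < b ->
  (\int[leb]_(x in `[a, b]) c%:E = (c * (b - a))%:E)%E.
Proof.
move=> ab.
have dF (t : R) : is_derive t 1 (fun t => c * t) c.
  by apply: is_derive_eq; rewrite /GRing.scale /=; ring.
have cF : continuous (fun t : R => c * t).
  by move=> t; apply: differentiable_continuous; exact/derivable1_diffP.
rewrite (@continuous_FTC2 _ (fun=> c) (fun t => c * t)) -?EFinB ?mulrBr//.
- by apply: continuous_subspaceT => x; exact: cvg_cst.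
- split; first by move=> t _; exact: ex_derive.
    exact/cvg_at_right_filter/cF.
  exact/cvg_at_left_filter/cF.
- by move=> t _; rewrite derive1E; exact: derive_val.
Qed.

Lemma integral_shift (h : R -> R) (c r : R) : continuous h -> 0 < r ->
  (\int[leb]_(x in `[r, (2 * r)%R]) (h (c + x)%R)%:E =
    \int[leb]_(x in `[(c + r)%R, (c + 2 * r)%R]) (h x)%:E)%E /\
  (\int[leb]_(x in `[r, (2 * r)%R]) (h (c - x)%R)%:E =
    \int[leb]_(x in `[(c - 2 * r)%R, (c - r)%R]) (h x)%:E)%E.
Proof.
move=> hc r0; have r2 : r < 2 * r by rewrite ltr_pMl// ltr1n.
have [] := @integral_affine h c 1 r (2 * r) hc ltr01 r2; rewrite !mul1r !mul1e => -> ->.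
by split; apply: eq_integral => x _; rewrite mul1r.
Qed.

(** As [s] runs over [[r, 2 r]], one side of the square of half-side [s] sweeps out a strip, here
    lengthened to all of [Y]; [sg] chooses between opposite sides. *)
Lemma integral_strip (G : R * R -> R) (c r : R) (sg : bool) (Y : set R) :
  measurable (Y : set (measurableTypeR R)) -> continuous G -> (forall p, 0 <= G p) -> 0 < r ->
  (\int[leb]_(s in `[r, (2 * r)%R])
     \int[leb]_(y in Y) (G ((c + (if sg then s else - s))%R, y))%:E <=
   \int[leb2]_(p in (`[(c - 2 * r)%R, (c + 2 * r)%R] `*` Y : set plane)) (G p)%:E)%E /\
  measurable_fun [set: measurableTypeR R]
    (fun s => \int[leb]_(y in Y) (G ((c + (if sg then s else - s))%R, y))%:E)%E.
Proof.
move=> mY Gc G0 r0.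
pose f (p : plane) := (G ((c + (if sg then p.1 else - p.1))%R, p.2))%:E.
have mf : measurable_fun [set: plane] f.
  apply/measurable_EFinP; apply: (@continuous_measurable_plane
    (fun p => G (c + (if sg then p.1 else - p.1), p.2))) => p.
  apply: continuous_comp; last exact: Gc.
  apply: pair_continuous; last exact: cvg_snd.
  apply: cvgD; first exact: cvg_cst.
  by case: (sg); [exact: cvg_fst|apply: cvgN; exact: cvg_fst].
have f0 p : (0 <= f p)%E by rewrite lee_fin.
have mG : measurable_fun [set: plane] (fun p : plane => (G p)%:E).
  by apply/measurable_EFinP; exact: continuous_measurable_plane.
have G0' (p : plane) : (0 <= (G p)%:E)%E by rewrite lee_fin.
have mI (a b : R) : measurable (`[a, b] : set (measurableTypeR R)) by exact: measurable_itv.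
have [T1 T2 T3 _] := tonelli_rect (mI r (2 * r)) mY mf f0.
split; last exact: T3.
rewrite -[leLHS]T1 T2.
have Gy y : continuous (fun x => G (x, y)).
  move=> x; apply: (@continuous_comp _ _ _ (fun x => (x, y)) G); last exact: Gc.
  by apply: pair_continuous => //; exact: cvg_cst.
pose J : set R := if sg then [set` `[c + r, c + 2 * r]] else [set` `[c - 2 * r, c - r]].
have mJ : measurable (J : set (measurableTypeR R)).
  by rewrite /J; case: (sg); exact: measurable_itv.
have -> : (\int[leb]_(y in Y) \int[leb]_(x in `[r, (2 * r)%R]) f (x, y) =
   \int[leb]_(y in Y) \int[leb]_(x in J) (G (x, y))%:E)%E.
  apply: eq_integral => y _; have [h1 h2] := integral_shift c (Gy y) r0.
  by rewrite /f /J /=; case: (sg).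
have [_ <- _ _] := tonelli_rect mJ mY mG G0'.
apply: ge0_subset_integral => //.
- exact: measurableX.
- exact: measurableX.
- exact: measurable_funTS.
- move=> [x y] [/= xJ yY]; split => //=; move: xJ; rewrite /J.
  case: (sg); rewrite /= !in_itv /= => /andP[h1 h2]; apply/andP.
    by split => //; clear -h1 r0; lra.
  by split => //; clear -h2 r0; lra.
Qed.

Lemma abs_ReIm_expi (w : R[i]) j :
  (`|complex.Re ('i ^+ j * w)| = `|complex.Re w| /\
    `|complex.Im ('i ^+ j * w)| = `|complex.Im w|) \/
  (`|complex.Re ('i ^+ j * w)| = `|complex.Im w| /\
    `|complex.Im ('i ^+ j * w)| = `|complex.Re w|).
Proof.
elim: j w => [|j IH] w; first by left; rewrite expr0 mul1r.
rewrite exprSr -mulrA; have := IH ('i * w); case: w => a b /=.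
rewrite !mul0r !mul1r sub0r add0r normrN.
by move=> [[-> ->]|[-> ->]]; [right|left].
Qed.

(** [cauchy_square] is averaged over the half-sides [s] in [[r, 2 r]]. Each of the four strips costs
    at most the full integral, and [92 / 15 > 4]. The majorant [G] is used only off the inner
    square, so [k] may be a quotient without direct control near [z]. *)
Lemma submean_square (k : R[i] -> R[i]) (z : R[i]) (r : R) (G : R * R -> R) : 0 < r ->
  (forall w, box z (2 * r) w -> w != z -> cdifferentiable k w) -> ccontinuous k z ->
  continuous G -> (forall p, 0 <= G p) ->
  (forall p, box z (2 * r) (toC p) -> ~ open_box z r (toC p) -> cabs (k (toC p)) <= G p) ->
  ((r ^+ 2 * cabs (k z))%:E <= \int[leb2]_(p in (square z (2 * r) : set plane)) (G p)%:E)%E.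
Proof.
move=> r0 kd kc Gc G0 kG.
set c0 := cabs (k z).
pose x0 := complex.Re z; pose y0 := complex.Im z.
pose X : set R := [set` `[x0 - 2 * r, x0 + 2 * r]].
pose Y : set R := [set` `[y0 - 2 * r, y0 + 2 * r]].
have mI (a b : R) : measurable (`[a, b] : set (measurableTypeR R)) by exact: measurable_itv.
(* Exchanging the coordinates lets the horizontal sides use the lemma for the vertical ones. *)
pose G' (p : R * R) := G (p.2, p.1).
have Gc' : continuous G'.
  by move=> p; apply: continuous_comp; [apply: pair_continuous; [exact: cvg_snd|exact: cvg_fst]|exact: Gc].
have G0' p : 0 <= G' p by exact: G0.
have mG : measurable_fun [set: plane] (fun p : plane => (G p)%:E).
  by apply/measurable_EFinP; exact: continuous_measurable_plane.
have mG' : measurable_fun [set: plane] (fun p : plane => (G' p)%:E).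
  by apply/measurable_EFinP; exact: (@continuous_measurable_plane G').
have swap : (\int[leb2]_(p in (Y `*` X : set plane)) (G' p)%:E =
             \int[leb2]_(p in (X `*` Y : set plane)) (G p)%:E)%E.
  have [-> _ _ _] := @tonelli_rect (fun p => (G' p)%:E) Y X (mI _ _) (mI _ _) mG' (fun p => G0' p).
  by have [_ -> _ _] := @tonelli_rect (fun p => (G p)%:E) X Y (mI _ _) (mI _ _) mG (fun p => G0 p).
have [S1 M1] := @integral_strip G x0 r true Y (mI _ _) Gc G0 r0.
have [S2 M2] := @integral_strip G' y0 r true X (mI _ _) Gc' G0' r0.
have [S3 M3] := @integral_strip G x0 r false Y (mI _ _) Gc G0 r0.
have [S4 M4] := @integral_strip G' y0 r false X (mI _ _) Gc' G0' r0.
rewrite swap in S2 S4.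
rewrite -[in leRHS]/(X `*` Y).
set I := (\int[leb2]_(p in _) _)%E in S1 S2 S3 S4 *.
rewrite /= in S1 S2 S3 S4 M1 M2 M3 M4.
pose phi1 s := (\int[leb]_(y in Y) (G ((x0 + s)%R, y))%:E)%E.
pose phi2 s := (\int[leb]_(y in X) (G' ((y0 + s)%R, y))%:E)%E.
pose phi3 s := (\int[leb]_(y in Y) (G ((x0 - s)%R, y))%:E)%E.
pose phi4 s := (\int[leb]_(y in X) (G' ((y0 - s)%R, y))%:E)%E.
have cG2 (g : R * R -> R) (x : R) : continuous g -> continuous (fun y => g (x, y)).
  move=> gc y; apply: (@continuous_comp _ _ _ (fun y => (x, y)) g); last exact: gc.
  by apply: pair_continuous => //; exact: cvg_cst.
have side (g : R * R -> R) (x c s : R) (sg : bool) (u : R -> R[i]) :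
    continuous g -> (forall p, 0 <= g p) -> r <= s <= 2 * r ->
    (forall t, -1 <= t <= 1 -> {for t, continuous (fun t => cabs (k (u t)))}) ->
    (forall t, -1 <= t <= 1 -> cabs (k (u t)) <= g (x, c + (if sg then s * t else - (s * t)))) ->
    ((r * \int[leb]_(t in `[-1, 1]) cabs (k (u t)))%:E <=
     \int[leb]_(y in `[(c - 2 * r)%R, (c + 2 * r)%R]) (g (x, y))%:E)%E.
  move=> gc g0 /andP[rs s2] uc ug.
  have s0 : 0 < s by exact: lt_le_trans rs.
  have hc := cG2 g x gc.
  have [A1 A2] := @integral_affine (fun y => g (x, y)) c s (-1) 1 hc s0 ltac:(lra).
  apply: (@le_trans _ _ (\int[leb]_(y in `[(c - s)%R, (c + s)%R]) (g (x, y))%:E)%E); last first.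
    apply: ge0_subset_integral => //.
    - by apply/measurable_EFinP; apply: measurable_funTS; exact: continuous_measurable_fun.
    - by move=> y _; rewrite lee_fin.
    - by apply: subset_itv; rewrite bnd_simp; clear -s2 s0; lra.
  have E : (\int[leb]_(y in `[(c - s)%R, (c + s)%R]) (g (x, y))%:E =
      s%:E * \int[leb]_(t in `[(-1)%R, 1%R]) (g (x, (c + (if sg then s * t else - (s * t)))%R))%:E)%E.
    by case: (sg); [move: A1|move: A2]; rewrite !mulrN1 !mulr1 ?opprK.
  have cu : continuous (fun t => g (x, c + (if sg then s * t else - (s * t)))).
    move=> t; apply: (@continuous_comp _ _ _ (fun t => c + (if sg then s * t else - (s * t))) (fun y => g (x, y))).
      apply: cvgD; first exact: cvg_cst.
      by case: (sg); [|apply: cvgN]; apply: cvgM => //; exact: cvg_cst.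
    exact: hc.
  have iu := @integrable_segment R (fun t => g (x, c + (if sg then s * t else - (s * t)))) (-1) 1
    (fun t _ => cu t).
  rewrite E -[X in (_ <= _ * X)%E]fineK; last exact: integrable_fin_num.
  rewrite -EFinM lee_fin ler_pM ?(ltW r0)//.
    by apply: Rintegral_ge0 => t _; exact: cabs_ge0.
  apply: le_Rintegral => //; first exact: integrable_segment.
have key s : r <= s <= 2 * r ->
    ((r * (c0 * (92 / 15)))%:E <= phi1 s + phi2 s + phi3 s + phi4 s)%E.
  move=> rs; have /andP[rs1 rs2] := rs.
  have s0 : 0 < s by exact: lt_le_trans rs1.
  have inb (w : R[i]) : box z s w -> box z (2 * r) w.
    by move=> [h1 h2]; split; exact: le_trans rs2.
  have kds w : w != z -> `|complex.Re (w - z)| <= s -> `|complex.Im (w - z)| <= s -> cdifferentiable k w.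
    by move=> wz h1 h2; apply: kd => //; exact: inb.
  pose u j t := z + 'i ^+ j * (s +i* (s * t)) : R[i].
  have uE t : [/\ u 0%N t = toC (x0 + s, y0 + s * t), u 1%N t = toC (x0 - s * t, y0 + s),
      u 2%N t = toC (x0 - s, y0 - s * t) & u 3%N t = toC (x0 + s * t, y0 - s)].
    rewrite /u /toC /x0 /y0; case: (z) => a b /=.
    by split; rewrite ?expr0 ?expr1 ?sqr_i ?exprS ?expr0 ?mulr1;
      apply/eqP; rewrite eq_complex /=; apply/andP; split; apply/eqP; ring.
  have ub j t : (j < 4)%N -> -1 <= t <= 1 -> box z s (u j t) /\ ~ open_box z r (u j t).
    move=> j4 t1; have st : `|s * t| <= s.
      by rewrite normrM (gtr0_norm s0) ler_piMr ?(ltW s0)// ler_norml.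
    have nr : ~ s < r by apply/negP; rewrite -leNgt.
    rewrite /box /open_box /= /u (_ : z + _ - z = 'i ^+ j * (s +i* (s * t))); last by ring.
    have se : `|s| = s by exact: gtr0_norm.
    have [[-> ->]|[-> ->]] := abs_ReIm_expi (s +i* (s * t)) j; rewrite /= se.
      by split=> // -[].
    by split=> // -[].
  have uz j t : (j < 4)%N -> -1 <= t <= 1 -> cdifferentiable k (u j t).
    move=> j4 t1; have [b nb] := ub j t j4 t1; apply: kd; first exact: inb.
    by apply/eqP => E; apply: nb; rewrite E; split; rewrite subrr normr0.
  have uc j t : (j < 4)%N -> -1 <= t <= 1 -> {for t, continuous (fun t => cabs (k (u j t)))}.
    move=> j4 t1; apply: (@ccontinuous_side R (fun w => k (z + 'i ^+ j * w)) s t).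
    by apply: ccontinuous_dilation; apply: cdifferentiable_continuous; exact: uz.
  have uG j t p : (j < 4)%N -> -1 <= t <= 1 -> u j t = toC p -> cabs (k (u j t)) <= G p.
    by move=> j4 t1 E; have [b nb] := ub j t j4 t1; rewrite E; apply: kG; rewrite -E//; exact: inb.
  have B1 := @side G (x0 + s) y0 s true (u 0%N) Gc G0 rs (fun t => uc 0%N t isT).
  have B2 := @side G' (y0 + s) x0 s false (u 1%N) Gc' G0' rs (fun t => uc 1%N t isT).
  have B3 := @side G (x0 - s) y0 s false (u 2%N) Gc G0 rs (fun t => uc 2%N t isT).
  have B4 := @side G' (y0 - s) x0 s true (u 3%N) Gc' G0' rs (fun t => uc 3%N t isT).
  have {}B1 := B1 (fun t t1 => uG 0%N t _ isT t1 (let: And4 e _ _ _ := uE t in e)).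
  have {}B2 := B2 (fun t t1 => uG 1%N t _ isT t1 (let: And4 _ e _ _ := uE t in e)).
  have {}B3 := B3 (fun t t1 => uG 2%N t _ isT t1 (let: And4 _ _ e _ := uE t in e)).
  have {}B4 := B4 (fun t t1 => uG 3%N t _ isT t1 (let: And4 _ _ _ e := uE t in e)).
  apply: le_trans (leeD (leeD (leeD B1 B2) B3) B4).
  rewrite -!EFinD lee_fin -!mulrDr ler_pM2l//.
  by have := cauchy_square s0 kds kc; rewrite !big_ord_recr big_ord0 /= add0r.
have phi0 : [/\ forall s, (0 <= phi1 s)%E, forall s, (0 <= phi2 s)%E,
    forall s, (0 <= phi3 s)%E & forall s, (0 <= phi4 s)%E].
  by split => s; apply: integral_ge0 => y _; rewrite lee_fin.
have [p1 p2 p3 p4] := phi0.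
have mphi : measurable_fun [set: measurableTypeR R]
  (fun s => phi1 s + phi2 s + phi3 s + phi4 s)%E by do 3 apply: emeasurable_funD => //.
have mT (f : R -> \bar R) : measurable_fun [set: measurableTypeR R] f ->
    measurable_fun (`[r, (2 * r)%R] : set (measurableTypeR R)) f by exact: measurable_funTS.
have J1 : (\int[leb]_(s in `[r, (2 * r)%R]) (r * (c0 * (92 / 15)))%:E <=
    \int[leb]_(s in `[r, (2 * r)%R]) (phi1 s + phi2 s + phi3 s + phi4 s))%E.
  apply: ge0_le_integral => //.
  - by move=> s _; rewrite lee_fin mulr_ge0 ?(ltW r0)// mulr_ge0 ?cabs_ge0.
  - exact: mT.
have J2 : (\int[leb]_(s in `[r, (2 * r)%R]) (phi1 s + phi2 s + phi3 s + phi4 s) <= I + I + I + I)%E.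
  have p12 s : (0 <= phi1 s + phi2 s)%E by exact: adde_ge0.
  have p123 s : (0 <= phi1 s + phi2 s + phi3 s)%E by exact: adde_ge0.
  have m12 := emeasurable_funD M1 M2.
  have m123 := emeasurable_funD m12 M3.
  have -> : (\int[leb]_(s in `[r, (2 * r)%R]) (phi1 s + phi2 s + phi3 s + phi4 s) =
      \int[leb]_(s in `[r, (2 * r)%R]) (phi1 s + phi2 s + phi3 s) +
      \int[leb]_(s in `[r, (2 * r)%R]) phi4 s)%E.
    by apply: ge0_integralD => //; exact: mT.
  have -> : (\int[leb]_(s in `[r, (2 * r)%R]) (phi1 s + phi2 s + phi3 s) =
      \int[leb]_(s in `[r, (2 * r)%R]) (phi1 s + phi2 s) +
      \int[leb]_(s in `[r, (2 * r)%R]) phi3 s)%E.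
    by apply: ge0_integralD => //; exact: mT.
  have -> : (\int[leb]_(s in `[r, (2 * r)%R]) (phi1 s + phi2 s) =
      \int[leb]_(s in `[r, (2 * r)%R]) phi1 s +
      \int[leb]_(s in `[r, (2 * r)%R]) phi2 s)%E.
    by apply: ge0_integralD => //; exact: mT.
  exact: (leeD (leeD (leeD S1 S2) S3) S4).
have J3 : (\int[leb]_(s in `[r, (2 * r)%R]) (r * (c0 * (92 / 15)))%:E = (r * (c0 * (92 / 15)) * r)%:E)%E.
  by rewrite integral_cst_itv ?ltr_pMl ?ltr1n//; congr (_%:E); ring.
have := le_trans J1 J2; rewrite J3.
have I0 : (0 <= I)%E by apply: integral_ge0 => p _; rewrite lee_fin.
case: (I) I0 => [i|_ _|//]; last exact: leey.
rewrite -!EFinD !lee_fin => i0 H.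
have c00 : 0 <= c0 by exact: cabs_ge0.
have rc : 0 <= r ^+ 2 * c0 by rewrite mulr_ge0 ?sqr_ge0.
rewrite (_ : r * (c0 * (92 / 15)) * r = (r ^+ 2 * c0) * (92 / 15)) in H; last by ring.
by move: (r ^+ 2 * c0) rc H => q q0 H; clear -q0 H; lra.
Qed.

End PlaneMeasure.

(** * Unordered sums *)

Section UnorderedSums.
Variable R : realType.
Implicit Types (S : set R[i]) (a b : R[i] -> R[i]) (x y : R[i] -> R) (s A B : seq R[i]).

Definition finite_part S s := uniq s /\ forall l, l \in s -> S l.

(** Summability with an explicit real bound, over duplicate-free lists; [sum_leP] and [esum_ltyP]
    connect it with [\esum]. *)
Definition sum_le S x (C : R) := forall s, finite_part S s -> \sum_(l <- s) x l <= C.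

Lemma sum_le_ge0 S x C : sum_le S x C -> 0 <= C.
Proof. by move=> /(_ [::]); rewrite big_nil; apply; split. Qed.

Lemma sum_leP S x C : (\esum_(l in S) (x l)%:E <= C%:E)%E <-> sum_le S x C.
Proof.
split=> [H s [us sS]|H].
  rewrite -lee_fin; apply: le_trans H.
  apply: ereal_sup_ubound; exists [set` s].
    by split; [exact: finite_seq|move=> l /=; exact: sS].
  by rewrite -fsbig_seq// sumEFin.
apply: ge_ereal_sup => _ [X [fX XS] <-].
rewrite fsbig_finite//= sumEFin lee_fin; apply: H; split; first exact: fset_uniq.
by move=> l; rewrite in_fset_set// => /set_mem/XS.
Qed.

Lemma esum_ltyP S x : (\esum_(l in S) (x l)%:E < +oo)%E <-> exists C, sum_le S x C.
Proof.
split=> [H|[C /sum_leP H]]; last by rewrite (le_lt_trans H)// ltry.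
have h0 : (0 <= \esum_(l in S) (x l)%:E)%E.
  by apply: ereal_sup_ubound; exists set0; [exact: fsets_set0|rewrite fsbig_set0].
exists (fine (\esum_(l in S) (x l)%:E)); apply/sum_leP; rewrite fineK//.
by rewrite fin_numE -ltey H andbT gt_eqF// (lt_le_trans _ h0)// ltNyr.
Qed.

Lemma finite_partS S S' s : S `<=` S' -> finite_part S s -> finite_part S' s.
Proof. by move=> SS' [us sS]; split=> // l /sS/SS'. Qed.

Lemma sum_leS S S' x C : S `<=` S' -> sum_le S' x C -> sum_le S x C.
Proof. by move=> SS' H s hs; apply: H; exact: finite_partS hs. Qed.

Lemma le_sum_le S x y C : (forall l, S l -> x l <= y l) -> sum_le S y C -> sum_le S x C.
Proof.
move=> xy H s hs; apply: le_trans (H s hs).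
by rewrite big_seq [leRHS]big_seq; apply: ler_sum => l ls; apply: xy; apply hs.2.
Qed.

Lemma sum_leD S x y C D : sum_le S x C -> sum_le S y D ->
  sum_le S (fun l => x l + y l) (C + D).
Proof. by move=> H1 H2 s hs; rewrite big_split lerD ?H1 ?H2. Qed.

Lemma sum_leZ S x C (k : R) : 0 <= k -> sum_le S x C -> sum_le S (fun l => k * x l) (k * C).
Proof. by move=> k0 H s hs; rewrite -mulr_sumr ler_wpM2l// H. Qed.

Lemma ler_sum_subset s A x : uniq s -> uniq A -> {subset A <= s} ->
  (forall l, l \in s -> 0 <= x l) -> \sum_(l <- A) x l <= \sum_(l <- s) x l.
Proof.
move=> us uA As x0; rewrite [leRHS](bigID (mem A))/=.
have -> : \sum_(l <- A) x l = \sum_(l <- s | l \in A) x l.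
  rewrite -[RHS]big_filter; apply: perm_big; apply: uniq_perm => //.
    by rewrite filter_uniq.
  by move=> l; rewrite mem_filter andbC; case: (boolP (l \in A)) => [/As ->|]; rewrite ?andbF.
by rewrite lerDl big_seq_cond; apply: sumr_ge0 => l /andP[/x0].
Qed.

Lemma sum_term S x C l : sum_le S x C -> S l -> x l <= C.
Proof.
move=> H Sl; have := H [:: l]; rewrite big_seq1; apply; split=> // l'.
by rewrite inE => /eqP ->.
Qed.

(** Convergence along finite subsets in terms of lists and real [e]. The value of [csum] is that of
    a limit operator and is meaningful only once [cvsum_csum] applies. *)
Definition cvsum S a (t : R[i]) := forall e : R, 0 < e -> exists2 A, finite_part S A &
  forall B, finite_part S B -> {subset A <= B} -> cabs (t - \sum_(l <- B) a l) <= e.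

Lemma nonneg_sum_limit S x C : (forall l, S l -> 0 <= x l) -> sum_le S x C ->
  exists T, sum_le S x T /\ forall e : R, 0 < e -> exists2 A, finite_part S A &
    T - e <= \sum_(l <- A) x l.
Proof.
move=> x0 H; pose V := [set \sum_(l <- s) x l | s in finite_part S].
have V0 : V !=set0 by exists (\sum_(l <- [::]) x l), [::].
have Vub : has_ubound V by exists C => _ [s hs <-]; exact: H.
exists (sup V); split=> [s hs|e e0]; first by apply: ub_le_sup => //; exists s.
have [_ [s hs <-] h] := sup_adherent e0 (conj V0 Vub).
by exists s => //; exact: ltW.
Qed.

Lemma sum_le_tail S x C : (forall l, S l -> 0 <= x l) -> sum_le S x C ->
  forall e : R, 0 < e -> exists2 A, finite_part S A & sum_le (S `\` [set` A]) x e.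
Proof.
move=> x0 /(nonneg_sum_limit x0)[T [HT hT]] e /hT[A hA HA]; exists A => // s [us sS].
have : \sum_(l <- A ++ s) x l <= T.
  apply: HT; split.
    rewrite cat_uniq hA.1 us andbT /=; apply/hasPn => l /sS[_ /= /negP].
    by [].
  by move=> l; rewrite mem_cat => /orP[/hA.2|/sS[]].
by rewrite big_cat /= => h; clear -h HA; lra.
Qed.

Lemma real_cvsum S x C : (forall l, S l -> 0 <= x l) -> sum_le S x C ->
  exists T, forall e : R, 0 < e -> exists2 A, finite_part S A &
    forall B, finite_part S B -> {subset A <= B} -> `|T - \sum_(l <- B) x l| <= e.
Proof.
move=> x0 /(nonneg_sum_limit x0)[T [HT hT]]; exists T => e /hT[A hA HA].
exists A => // B hB AB; have h1 := HT _ hB.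
have h2 : \sum_(l <- A) x l <= \sum_(l <- B) x l.
  by apply: ler_sum_subset => //; [exact: hB.1|exact: hA.1|move=> l /hB.2; exact: x0].
by rewrite ger0_norm ?subr_ge0//; clear -h1 h2 HA; lra.
Qed.

Lemma finite_partU S A B : finite_part S A -> finite_part S B ->
  [/\ finite_part S (undup (A ++ B)), {subset A <= undup (A ++ B)} &
      {subset B <= undup (A ++ B)}].
Proof.
move=> hA hB; split.
- split; first exact: undup_uniq.
  by move=> l; rewrite mem_undup mem_cat => /orP[/hA.2|/hB.2].
- by move=> l lA; rewrite mem_undup mem_cat lA.
- by move=> l lB; rewrite mem_undup mem_cat lB orbT.
Qed.

Lemma cvsumD S a b t u : cvsum S a t -> cvsum S b u ->
  cvsum S (fun l => a l + b l) (t + u).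
Proof.
move=> H1 H2 e e0; have e20 : 0 < e / 2 by rewrite divr_gt0.
have [A hA HA] := H1 _ e20; have [B hB HB] := H2 _ e20.
have [hU AU BU] := finite_partU hA hB; exists (undup (A ++ B)) => // D hD UD.
rewrite big_split /= opprD addrACA [e]splitr (le_trans (cabsD _ _))// lerD//.
  by apply: HA => // l /AU/UD.
by apply: HB => // l /BU/UD.
Qed.

Lemma cvsumZ S a t (k : R[i]) : cvsum S a t -> cvsum S (fun l => k * a l) (k * t).
Proof.
move=> H e e0; have k0 : 0 < cabs k + 1 by rewrite ltr_wpDl// cabs_ge0.
have [A hA HA] := H _ (divr_gt0 e0 k0); exists A => // B hB AB.
rewrite -mulr_sumr -mulrBr cabsM (le_trans (ler_pM (cabs_ge0 _) (cabs_ge0 _) (lexx _) (HA B hB AB)))//.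
by rewrite mulrA ler_pdivrMr// mulrC ler_wpM2l ?(ltW e0)// lerDl.
Qed.

Lemma cvsum_ext S a b t : (forall l, S l -> a l = b l) -> cvsum S a t -> cvsum S b t.
Proof.
move=> ab H e /H[A hA HA]; exists A => // B hB AB.
rewrite (_ : \sum_(l <- B) b l = \sum_(l <- B) a l) ?HA//.
by rewrite big_seq [RHS]big_seq; apply: eq_bigr => l /hB.2/ab.
Qed.

(** Absolute convergence: the family splits into the positive and negative parts of its real and
    imaginary parts, each a bounded nonnegative family. *)
Lemma cvsum_exists S a C : sum_le S (fun l => cabs (a l)) C -> exists t, cvsum S a t.
Proof.
move=> H.
have part (p : R[i] -> R) : (forall l, 0 <= p l <= cabs (a l)) -> exists t, cvsum S (fun l => (p l)%:C) t.
  move=> pa; have p0 l : S l -> 0 <= p l by move=> _; have /andP[] := pa l.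
  have [|T HT] := @real_cvsum S p C p0.
    by apply: le_sum_le H => l _; have /andP[] := pa l.
  exists T%:C => e /HT[A hA HA]; exists A => // B hB AB.
  by rewrite -rmorph_sum -rmorphB cabs_real HA.
have mx (u : R) (l : R[i]) : `|u| <= cabs (a l) -> 0 <= Num.max u 0 <= cabs (a l).
  by move=> h; rewrite le_max lexx orbT ge_max cabs_ge0 andbT (le_trans (ler_norm _)).
have [t1 H1] := part (fun l => Num.max (complex.Re (a l)) 0) (fun l => mx _ l (ler_Re_cabs _)).
have [t2 H2] := part (fun l => Num.max (- complex.Re (a l)) 0)
  (fun l => mx (- complex.Re (a l)) l (eq_ind_r (fun z => z <= _) (ler_Re_cabs _) (normrN _))).
have [t3 H3] := part (fun l => Num.max (complex.Im (a l)) 0) (fun l => mx _ l (ler_Im_cabs _)).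
have [t4 H4] := part (fun l => Num.max (- complex.Im (a l)) 0)
  (fun l => mx (- complex.Im (a l)) l (eq_ind_r (fun z => z <= _) (ler_Im_cabs _) (normrN _))).
have mxE (u : R) : Num.max u 0 - Num.max (- u) 0 = u.
  by case: (leP 0 u) => h; rewrite ?(max_l h) ?(max_r (ltW h)); case: (leP 0 (- u)) => h';
    rewrite ?(max_l h') ?(max_r (ltW h')); clear -h h'; lra.
have H12 := cvsumD H1 (cvsumZ (-1) H2); have H34 := cvsumD H3 (cvsumZ (-1) H4).
have := cvsumD H12 (cvsumZ 'i H34); set t := (t in cvsum _ _ t) => Ht.
exists t; apply: cvsum_ext Ht => l _; rewrite !mulN1r -!rmorphB !mxE.
by case: (a l) => u v; apply/eqP; rewrite eq_complex /= !mul0r !mul1r !subr0 !addr0 !add0r !eqxx.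
Qed.

Lemma cvsum_le S a t C : sum_le S (fun l => cabs (a l)) C -> cvsum S a t -> cabs t <= C.
Proof.
move=> H Ht; apply/ler_addgt0Pr => e /Ht[A hA /(_ A hA)] h.
rewrite -[t](subrK (\sum_(l <- A) a l)) addrC (le_trans (cabsD _ _))// lerD//; last exact: h.
by rewrite (le_trans (cabs_sum _ _ _))//; exact: H.
Qed.

Lemma cvsum_setD1 S a t l : S l -> cvsum S a t -> cvsum (S `\ l) a (t - a l).
Proof.
move=> Sl H e /H[A hA HA]; exists (rem l A).
  split; first by rewrite rem_uniq// hA.1.
  move=> l'; rewrite mem_rem_uniq ?hA.1// !inE => /andP[/eqP ll' /hA.2].
  by move=> Sl'; split.
move=> B hB AB; have lB : l \notin B by apply/negP => /hB.2[_ /=].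
have := HA (l :: B); rewrite big_cons opprD addrA; apply.
  split; first by rewrite /= lB hB.1.
  by move=> l'; rewrite inE => /predU1P[->//|/hB.2[]].
move=> l' l'A; rewrite inE; case: eqVneq => //= ll'; apply: AB.
by rewrite mem_rem_uniq ?hA.1// !inE ll'.
Qed.

Lemma cvsum_csum S a t : cvsum S a t -> csum S a = t.
Proof.
move=> H; rewrite /csum /summability.sum; apply: (@cvg_lim R[i]^o); first exact: norm_hausdorff.
  exact: summability.totally_filter.
have FF : Filter (@summability.totally S) by apply: (@filter_filter _ _ (@summability.totally_filter S)).
apply/cvgrPdist_le => e e0.
have eE : e = (cabs e)%:C by rewrite -normcE gtr0_norm.
have ce0 : 0 < cabs e by rewrite cabs_gt0 gt_eqF.
have [A hA HA] := H _ ce0.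
exists [fset x in pmap insub A]%fset => // B /= AB.
rewrite normcE eE lecR /summability.partial_sum.
have -> : \sum_(i : B) (a (val (val i)) : R[i]^o) = \sum_(l <- map val (enum_fset B)) a l.
  by rewrite big_map -(big_seq_fsetE _ B xpredT (fun i => a (val i))).
apply: HA.
  split; first by rewrite map_inj_uniq ?fset_uniq//; exact: val_inj.
  by move=> _ /mapP[x _ ->]; exact: set_mem (valP x).
move=> l lA; apply/mapP.
have Sl : l \in S by apply/mem_set; exact: hA.2.
exists (Sub l Sl); last by rewrite SubK.
apply: (fsubsetP AB); rewrite in_fset/= mem_pmap.
by apply/mapP; exists l => //; rewrite insubT.
Qed.

Lemma csumP S a C : sum_le S (fun l => cabs (a l)) C -> cvsum S a (csum S a).
Proof. by move=> /cvsum_exists[t Ht]; rewrite (cvsum_csum Ht). Qed.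

End UnorderedSums.

(** * The metric frame of a multiplier *)

(* The metric properties of a multiplier on which the argument rests: [d] is the
   distance to the zero set [L] in the metric [rho^-1 |dz|]. *)
Record multiplier_frame (R : realType) (phi rho d : R[i] -> R) (g : R[i] -> R[i])
    (L : set R[i]) (delta M K Cg : R) : Prop := MultiplierFrame {
  frame_rho_gt0 : forall z, 0 < rho z;
  frame_rho_lip : forall z w, rho z <= rho w + cabs (z - w);
  frame_delta : 0 < delta <= 1;
  frame_sep : forall l l', L l -> L l' -> l <> l' ->
    delta * rho l <= cabs (l - l') /\ delta * rho l' <= cabs (l - l');
  frame_M : 1 <= M;
  frame_d : forall z, 0 <= d z <= M;
  frame_near : forall z l, L l -> cabs (z - l) <= rho l / 2 -> d z * rho l <= 2 * cabs (z - l);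
  frame_K : 1 <= K;
  frame_cover : forall z, exists l, [/\ L l, cabs (z - l) <= K * rho z & cabs (z - l) <= K * rho l];
  frame_far : forall z (m : R), 0 <= m <= 1 -> (forall l, L l -> m * rho l <= cabs (z - l)) ->
    m / 8 <= d z;
  frame_phi : forall z, ccontinuous (fun w => (phi w)%:C) z;
  frame_g : forall z, cdifferentiable g z;
  frame_Cg : 1 <= Cg;
  frame_lower : forall z, expR (phi z) * d z <= Cg * cabs (g z);
  frame_upper : forall z, cabs (g z) <= Cg * expR (phi z) * d z;
  frame_zeros : forall z, L z <-> g z = 0 }.

Section QuotientByZero.
Variable R : realType.
Implicit Types (z w l : R[i]) (F : R[i] -> R[i]).

Definition zquot F l z := if z == l then cderiv F l else F z / (z - l).

Lemma cdifferentiableP F z : cdifferentiable F z -> cdiff F z (cderiv F z).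
Proof. by move=> [a Ha]; have [_ ->] := cdiff_derivable Ha. Qed.

Lemma ccontinuous_zquot F l :
  cdifferentiable F l -> F l = 0 -> ccontinuous (zquot F l) l.
Proof.
move=> Fd Fl e e0; have [d d0 Hd] := cdifferentiableP Fd e0.
exists d => // x xd; rewrite /zquot eqxx; case: eqVneq => [_|xl].
  by rewrite subrr cabs0 ltW.
have := Hd _ xd; rewrite [l + _]addrC subrK Fl subr0 => h.
have xl0 : 0 < cabs (x - l) by rewrite cabs_gt0 subr_eq0.
rewrite -(ler_pM2r xl0) -cabsM mulrBl mulfVK//.
by rewrite subr_eq0.
Qed.

(** Away from [l] this is an ordinary quotient; at [l] the singularity is removable. *)
Lemma zquot_differentiable F l : (forall z, cdifferentiable F z) -> F l = 0 ->
  forall z, cdifferentiable (zquot F l) z.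
Proof.
move=> Fd Fl z.
have dn w : w != l -> cdifferentiable (zquot F l) w.
  move=> wl; apply: (@cdifferentiable_near _ (fun z => F z / (z - l)) _ _ (cabs (w - l))).
  - by rewrite cabs_gt0 subr_eq0.
  - by move=> x xw; rewrite /zquot; case: eqVneq xw => // ->; rewrite cabsC ltxx.
  - apply: cdifferentiable_div => //; first by rewrite subr_eq0.
    by apply: cdifferentiableB; [exact: cdifferentiable_id|exact: cdifferentiable_cst].
have [->|zl] := eqVneq z l; last exact: dn.
apply: (@removable _ _ _ 1) => // [w _|]; first exact: dn.
exact: ccontinuous_zquot.
Qed.

End QuotientByZero.

(** * Size of [g] near its zeros, and partial fraction series *)

Section Frame.
Variables (R : realType) (phi rho d : R[i] -> R) (g : R[i] -> R[i]) (L : set R[i]).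
Variables (delta M K Cg : R).
Hypothesis FR : multiplier_frame phi rho d g L delta M K Cg.
Implicit Types (z w l : R[i]) (S : set R[i]).

Let rho_gt0 := frame_rho_gt0 FR.
Let rho_lip := frame_rho_lip FR.
Let delta_gt0 : 0 < delta. Proof. by case/andP: (frame_delta FR). Qed.
Let delta_le1 : delta <= 1. Proof. by case/andP: (frame_delta FR). Qed.
Let M_gt0 : 0 < M. Proof. exact: lt_le_trans (frame_M FR). Qed.
Let Cg_gt0 : 0 < Cg. Proof. exact: lt_le_trans (frame_Cg FR). Qed.
Let gd l := cderiv g l.
Let gz l : L l -> g l = 0. Proof. by move/(frame_zeros FR). Qed.

(** [frame_near] without restriction on [z]: at distance over [rho l / 2] the bound [d z <= M] is
    enough. *)
Lemma frame_near_le z l : L l -> d z * rho l <= 2 * M * cabs (z - l).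
Proof.
move=> Ll; have [h|h] := leP (cabs (z - l)) (rho l / 2).
  rewrite (le_trans (frame_near FR Ll h))// ler_wpM2r ?cabs_ge0//.
  by rewrite ler_peMr// (frame_M FR).
have /andP[d0 dM] := frame_d FR z.
rewrite (@le_trans _ _ (M * rho l))// ?ler_wpM2r ?(ltW (rho_gt0 l))//.
rewrite -mulrA mulrCA ler_wpM2l ?(ltW M_gt0)//.
by rewrite ltr_pdivrMr// in h; rewrite mulrC ltW.
Qed.

Lemma frame_other z l l' : L l -> L l' -> l <> l' -> cabs (z - l) <= delta / 4 * rho l ->
  [/\ 3 / 4 * cabs (l - l') <= cabs (z - l'), cabs (z - l) <= cabs (l - l') / 4 &
      delta / 2 * rho l' <= cabs (z - l')].
Proof.
move=> Ll Ll' ll' h; have [h1 h2] := frame_sep FR Ll Ll' ll'.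
have h3 : cabs (l - l') <= cabs (z - l) + cabs (z - l').
  by rewrite (le_trans (cabs_triangle z _ _))// cabsC.
have r0 := mulr_gt0 delta_gt0 (rho_gt0 l').
have E1 : delta / 4 * rho l = delta * rho l / 4 by ring.
have E2 : delta / 2 * rho l' = delta * rho l' / 2 by ring.
rewrite E1 in h; rewrite E2.
move: (delta * rho l) (delta * rho l') h h1 h2 h3 r0 => u v h h1 h2 h3 r0.
by split; lra.
Qed.

(** [frame_far] is used with [m = |z - l| / rho l]; all other lattice points are farther away
    relative to their radii, by [frame_other]. *)
Lemma frame_d_lower z l : L l -> cabs (z - l) <= delta / 4 * rho l ->
  cabs (z - l) <= 8 * rho l * d z.
Proof.
move=> Ll h; pose m := cabs (z - l) / rho l.
have mE : m * rho l = cabs (z - l) by rewrite /m mulfVK// gt_eqF.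
have m4 : m <= delta / 4 by rewrite /m ler_pdivrMr.
have m0 : 0 <= m by rewrite divr_ge0 ?cabs_ge0// ltW.
have := @frame_far _ _ _ _ _ _ _ _ _ _ FR z m.
have -> : 0 <= m <= 1 by rewrite m0; have := delta_le1; have := m4; clearbody m; lra.
move=> /(_ isT) H; have {}H : m / 8 <= d z.
  apply: H => l' Ll'; have [<-|ll'] := eqVneq l l'; first by rewrite mE.
  have [_ _ h1] := frame_other Ll Ll' (elimN eqP ll') h.
  rewrite (le_trans _ h1)// ler_wpM2r ?(ltW (rho_gt0 _))// (le_trans m4)//.
  by rewrite ler_wpM2l ?(ltW delta_gt0)// lef_pV2 ?posrE// ler_nat.
rewrite -mE mulrC [8 * _]mulrC -mulrA ler_pM2l//.
by rewrite ler_pdivrMr// in H; rewrite mulrC.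
Qed.

Lemma frame_notin z l : L l -> z != l -> cabs (z - l) < delta * rho l -> ~ L z.
Proof.
move=> Ll zl h Lz; have [_] := frame_sep FR Lz Ll (elimN eqP zl).
by rewrite leNgt h.
Qed.

Lemma frame_d_gt0 z : ~ L z -> 0 < d z.
Proof.
move=> nL; have /andP[d0 _] := frame_d FR z.
rewrite lt_neqAle d0 andbT eq_sym; apply/eqP => dz; apply: nL; apply/(frame_zeros FR).
apply/eqP; rewrite -cabs_eq0 eq_le cabs_ge0 andbT.
by rewrite (le_trans (frame_upper FR z))// dz mulr0.
Qed.

(** 8 comes from [frame_d_lower], [expR 1] from an oscillation of [phi] by at most 1 near the zero,
    [Cg] from the multiplier bounds. *)
Let C2 := 8 * expR 1 * Cg.
Let C2_gt0 : 0 < C2. Proof. by rewrite !mulr_gt0 ?expR_gt0. Qed.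

Lemma frame_near_point l : exists2 r : R, 0 < r & forall h, 0 < cabs h < r ->
  [/\ cabs h <= delta / 4 * rho l, expR (phi l) <= expR 1 * expR (phi (l + h)) &
      expR (phi (l + h)) <= expR 1 * expR (phi l)].
Proof.
have [r r0 Hr] := frame_phi FR l ltr01.
exists (Num.min r (delta / 4 * rho l)) => [|h].
  by rewrite lt_min r0 mulr_gt0// divr_gt0.
rewrite lt_min => /and3P[h0 h1 h2].
have := Hr (l + h); rewrite addrAC subrr add0r -rmorphB cabs_real => /(_ h1).
rewrite ler_norml => /andP[a b].
by split; [exact: ltW|rewrite -expRD ler_expR; lra..].
Qed.

(** The two multiplier bounds for [|g (l + h)| / |h|], as [h] tends to [0]. *)
Lemma deriv_bounds l : L l ->
  expR (phi l) <= C2 * (rho l * cabs (gd l)) /\ rho l * cabs (gd l) <= C2 * expR (phi l).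
Proof.
move=> Ll; have [r r0 Hr] := frame_near_point l.
have gdl := cdifferentiableP (frame_g FR l).
have e1 : 0 < expR 1 :> R by exact: expR_gt0.
have [rl0 pl0] := (rho_gt0 l, @expR_gt0 R (phi l)).
have pt (e : R) : 0 < e -> exists h, [/\ 0 < cabs h, cabs h < r &
    `|cabs (g (l + h)) - cabs (gd l) * cabs h| <= e * cabs h].
  move=> e0; have [q q0 Hq] := gdl e e0; pose t := Num.min r q / 2.
  have t0 : 0 < t by rewrite divr_gt0// lt_min r0.
  have /andP[tr tq] : (t < r) && (t < q).
    rewrite -lt_min /t ltr_pdivrMr// ltr_pMr ?lt_min ?r0//; exact: ltr1n.
  exists t%:C; rewrite cabs_real (gtr0_norm t0); split => //.
  have := Hq t%:C; rewrite cabs_real (gtr0_norm t0) => /(_ tq).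
  rewrite (gz Ll) subr0; apply: le_trans.
  have tE : cabs (gd l) * t = cabs (gd l * t%:C) by rewrite cabsM cabs_real gtr0_norm.
  rewrite tE ler_norml cabsB_ge andbT lerNl opprB.
  by rewrite cabsC cabsB_ge.
split.
  apply/ler_addgt0Pr => e e0.
  have e'0 : 0 < e / (C2 * rho l) by rewrite divr_gt0// mulr_gt0.
  have [h [h0 hr Hh]] := pt _ e'0.
  have [h1 h2 h3] := Hr h ltac:(by rewrite h0 hr).
  have lE : l + h - l = h by rewrite addrAC subrr add0r.
  have := @frame_d_lower (l + h) l Ll; rewrite lE => /(_ h1) Hd.
  have Hlo := frame_lower FR (l + h).
  have A1 : cabs (g (l + h)) <= (cabs (gd l) + e / (C2 * rho l)) * cabs h.
    by move: Hh; rewrite ler_norml => /andP[_]; rewrite lerBlDl mulrDl.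
  have A2 : expR (phi (l + h)) * cabs h <= 8 * rho l * Cg * cabs (g (l + h)).
    rewrite (le_trans (ler_wpM2l _ Hd)) ?expR_ge0//.
    rewrite mulrCA -[leRHS]mulrA ler_wpM2l//.
    by rewrite mulr_ge0// ltW.
  have A3 : expR (phi (l + h)) <= 8 * rho l * Cg * (cabs (gd l) + e / (C2 * rho l)).
    rewrite -(ler_pM2r h0) (le_trans A2)// -[leRHS]mulrA; apply: ler_wpM2l => //.
    by rewrite !mulr_ge0// ltW.
  rewrite (le_trans h2)// (le_trans (ler_wpM2l (ltW e1) A3))//.
  rewrite le_eqVlt; apply/orP; left; apply/eqP; rewrite /C2; field.
  by rewrite !gt_eqF.
apply/ler_addgt0Pr => e e0.
have e'0 : 0 < e / rho l by rewrite divr_gt0.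
have [h [h0 hr Hh]] := pt _ e'0.
have [h1 h2 h3] := Hr h ltac:(by rewrite h0 hr).
have lE : l + h - l = h by rewrite addrAC subrr add0r.
have := @frame_near _ _ _ _ _ _ _ _ _ _ FR (l + h) l Ll; rewrite lE => Hd.
have {}Hd := Hd ltac:(by rewrite (le_trans h1)// [leRHS]mulrC ler_wpM2r ?(ltW rl0)//; have := delta_le1; lra).
have Hup := frame_upper FR (l + h).
have A1 : cabs (gd l) * cabs h <= cabs (g (l + h)) + e / rho l * cabs h.
  by move: Hh; rewrite ler_norml => /andP[+ _]; rewrite lerNl opprB lerBlDl addrC.
have A2 : rho l * cabs (g (l + h)) <= Cg * (expR 1 * expR (phi l)) * (2 * cabs h).
  rewrite (le_trans (ler_wpM2l (ltW rl0) Hup))// mulrCA [rho l * _]mulrC.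
  rewrite ler_pM ?mulr_ge0 ?expR_ge0 ?(ltW Cg_gt0) ?(ltW rl0)//.
    by case/andP: (frame_d FR (l + h)).
  by rewrite ler_wpM2l// ltW.
rewrite -(ler_pM2r h0) -mulrA (le_trans (ler_wpM2l (ltW rl0) A1))// mulrDr mulrDl.
apply: lerD; last by rewrite mulrA [rho l * _]mulrC mulfVK// gt_eqF.
rewrite (le_trans A2)// (_ : _ * (2 * cabs h) = (2 * expR 1 * Cg) * expR (phi l) * cabs h); last by ring.
rewrite ler_wpM2r ?(ltW h0)// ler_wpM2r ?(ltW pl0)// /C2 ler_wpM2r ?(ltW Cg_gt0)//.
by rewrite ler_wpM2r ?(ltW e1)// ler_nat.
Qed.

Lemma deriv_neq0 l : L l -> gd l != 0.
Proof.
move=> /deriv_bounds[h _]; rewrite -cabs_gt0 lt_neqAle cabs_ge0 andbT eq_sym.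
by apply: contraTneq h => ->; rewrite !mulr0 -ltNge expR_gt0.
Qed.

Section Series.
Variables (c : R[i] -> R[i]) (A : R).
Let b l := c l / gd l.
(** Comparable to [|c l| e^(- phi l)] by [coef_equiv], so [sum_le L aa A] is the first condition of
    the theorem in a form free of [phi]. *)
Let aa l := cabs (b l) / rho l.

Lemma coef_equiv l : L l ->
  cabs (c l) * expR (- phi l) <= C2 * aa l /\ aa l <= C2 * (cabs (c l) * expR (- phi l)).
Proof.
move=> Ll; have [h1 h2] := deriv_bounds Ll; have g0 := deriv_neq0 Ll.
have [rl0 pl0] := (rho_gt0 l, @expR_gt0 R (phi l)).
have g0' : 0 < cabs (gd l) by rewrite cabs_gt0.
have cE : cabs (c l) = aa l * (rho l * cabs (gd l)).
  by rewrite /aa mulrA mulfVK ?gt_eqF// -cabsM /b mulfVK.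
have aa0 : 0 <= aa l by rewrite divr_ge0 ?cabs_ge0// ltW.
move: (aa l) aa0 cE => al aa0 cE.
rewrite expRN cE; split.
  rewrite ler_pdivrMr// [C2 * _]mulrC -mulrA.
  by apply: ler_wpM2l.
rewrite mulrCA mulrA ler_pdivlMr// -mulrA; apply: ler_wpM2l => //.
by rewrite mulrC.
Qed.

(** The index set is a parameter: the full lattice, or the lattice without the point at which the
    series is expanded. *)
Definition pseries S z := csum S (fun l => b l / (z - l)).

Section At.
Variables (S : set R[i]) (z0 : R[i]) (m : R).
Hypotheses (SA : sum_le S aa A) (m0 : 0 < m).
Hypothesis zS : forall l, S l -> m * rho l <= cabs (z0 - l).

(** A distance from [z0] to [S] free of [l]: [rho z0 <= rho l + |z0 - l| <= (1 + 1 / m) |z0 -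
    l|]. *)
Let kap := rho z0 / (1 + m^-1).
Let kap0 : 0 < kap.
Proof. by rewrite divr_gt0// addr_gt0// invr_gt0. Qed.

Let zS0 l : S l -> 0 < cabs (z0 - l).
Proof. by move/zS; apply: lt_le_trans; rewrite mulr_gt0. Qed.

Let zkap l : S l -> kap <= cabs (z0 - l).
Proof.
move=> Sl; rewrite /kap ler_pdivrMr ?addr_gt0 ?invr_gt0//.
rewrite (le_trans (rho_lip z0 l))// mulrDr mulr1 addrC lerD2l.
by rewrite ler_pdivlMr// mulrC; exact: zS.
Qed.

Lemma pseries_term l : S l -> cabs (b l / (z0 - l)) <= m^-1 * aa l.
Proof.
move=> Sl; rewrite cabsM cabsV ler_pdivrMr ?zS0//.
rewrite /aa mulrC mulrA mulrA ler_pdivlMr ?rho_gt0//.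
rewrite [leRHS]mulrC; apply: ler_wpM2l; first exact: cabs_ge0.
by rewrite ler_pdivlMr// mulrC; exact: zS.
Qed.

Lemma pseries_summable : sum_le S (fun l => cabs (b l / (z0 - l))) (m^-1 * A).
Proof.
apply: (@le_sum_le _ _ _ (fun l => m^-1 * aa l)) => [l|]; first exact: pseries_term.
by apply: sum_leZ => //; rewrite invr_ge0 ltW.
Qed.

Lemma pseries2_summable :
  sum_le S (fun l => cabs (b l / (z0 - l) ^+ 2)) (kap^-1 * (m^-1 * A)).
Proof.
apply: (@le_sum_le _ _ _ (fun l => kap^-1 * cabs (b l / (z0 - l)))) => [l Sl|]; last first.
  by apply: sum_leZ; [rewrite invr_ge0 ltW|exact: pseries_summable].
rewrite (_ : b l / _ = b l / (z0 - l) * (z0 - l)^-1); last by rewrite expr2 invfM mulrA.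
rewrite cabsM [leRHS]mulrC ler_wpM2l ?cabs_ge0// cabsV.
by rewrite lef_pV2 ?posrE ?zS0// zkap.
Qed.

(** Termwise, with [w = z0 - l]: [1 / (w + h) - 1 / w + h / w ^ 2 = h ^ 2 / (w ^ 2 (w + h))]. Since
    [|w| >= kap] and [|w + h| >= |w| / 2], the remainders sum to at most [Q |h| ^ 2]. *)
Lemma pseries_cdiff :
  cdiff (pseries S) z0 (- csum S (fun l => b l / (z0 - l) ^+ 2)).
Proof.
have A0 : 0 <= A := sum_le_ge0 SA.
pose Q := 2 / kap ^+ 2 * (m^-1 * A).
have Q0 : 0 <= Q.
  by rewrite mulr_ge0 ?mulr_ge0 ?invr_ge0 ?exprn_ge0 ?(ltW kap0) ?(ltW m0).
move=> e e0; exists (Num.min (kap / 2) (e / (Q + 1))) => [|h].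
  have Q1 : 0 < Q + 1 by rewrite ltr_wpDl.
  by rewrite lt_min; apply/andP; split; apply: divr_gt0.
rewrite lt_min => /andP[h1 h2].
have far l : S l -> cabs (z0 - l) / 2 <= cabs (z0 + h - l).
  move=> Sl; have := zkap Sl; have := cabsB_ge (z0 - l) (- h).
  rewrite opprK cabsN (_ : z0 - l + h = z0 + h - l); last by ring.
  by lra.
have S1 := csumP pseries_summable.
have S2 := csumP pseries2_summable.
have S3 : cvsum S (fun l => b l / (z0 + h - l)) (pseries S (z0 + h)).
  apply: (@csumP _ _ _ (2 * (m^-1 * A))).
  apply: (@le_sum_le _ _ _ (fun l => 2 * cabs (b l / (z0 - l)))); last first.
    by apply: sum_leZ => //; exact: pseries_summable.
  move=> l Sl; have := far l Sl; have z0l := zS0 Sl => hf.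
  have hf0 : 0 < cabs (z0 + h - l) by rewrite (lt_le_trans _ hf)// divr_gt0.
  rewrite ![cabs (b l / _)]cabsM !cabsV mulrCA; apply: ler_wpM2l; first exact: cabs_ge0.
  by rewrite -[2 / _]invrK lef_pV2 ?posrE ?invr_gt0 ?divr_gt0// invf_div.
have := cvsumD (cvsumD S3 (cvsumZ (-1) S1)) (cvsumZ h S2).
set t := (t in cvsum _ _ t) => St.
rewrite (_ : _ - _ = t); last by rewrite /t /pseries; ring.
have Qh : cabs t <= cabs h ^+ 2 * Q.
  apply: cvsum_le St.
  apply: (@le_sum_le _ _ _ (fun l => cabs h ^+ 2 * (2 / kap ^+ 2 * cabs (b l / (z0 - l))))); last first.
    apply: sum_leZ; first by rewrite exprn_ge0 ?cabs_ge0.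
    apply: sum_leZ; last exact: pseries_summable.
    by rewrite divr_ge0// exprn_ge0// ltW.
  move=> l Sl; have z0l := zS0 Sl; have hf := far l Sl; have hk := zkap Sl.
  have hf0 : 0 < cabs (z0 + h - l) by rewrite (lt_le_trans _ hf)// divr_gt0.
  have n1 : z0 - l != 0 by rewrite -cabs_gt0.
  have n2 : z0 + h - l != 0 by rewrite -cabs_gt0.
  rewrite (_ : _ + _ = h ^+ 2 * (b l / (z0 - l) * ((z0 - l)^-1 / (z0 + h - l)))); last first.
    by field; rewrite n1 n2.
  rewrite cabsM cabsX ler_wpM2l ?exprn_ge0 ?cabs_ge0//.
  rewrite cabsM mulrC ler_wpM2r ?cabs_ge0// cabsM !cabsV -invfM.
  rewrite -[2 / _]invrK lef_pV2 ?posrE; last 2 first.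
  - exact: mulr_gt0.
  - by rewrite invr_gt0 divr_gt0//; exact: exprn_gt0.
  rewrite invf_div (@le_trans _ _ (cabs (z0 - l) * (cabs (z0 - l) / 2)))//.
    by rewrite mulrA ler_wpM2r// -expr2 lerXn2r ?nnegrE ?cabs_ge0// ltW.
  by rewrite ler_wpM2l ?cabs_ge0.
rewrite (le_trans Qh)// expr2 -mulrA mulrC ler_wpM2r ?cabs_ge0//.
rewrite ltr_pdivlMr ?ltr_wpDl// in h2; rewrite (le_trans _ (ltW h2))// ler_wpM2l ?cabs_ge0//.
by rewrite lerDl.
Qed.

End At.

End Series.
End Frame.

(** * Integrals of nonnegative continuous functions over squares *)

Section PlaneIntegrals.
Variable R : realType.
Implicit Types (z w : R[i]) (r : R) (G : R * R -> R).
Local Notation plane := (measurableTypeR R * measurableTypeR R)%type.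
Definition sqint G z r : \bar R := (\int[leb2]_(p in (square z r : set plane)) (G p)%:E)%E.

Lemma square_measurable z r : measurable (square z r : set plane).
Proof. by apply: measurableX; exact: measurable_itv. Qed.
Hint Resolve square_measurable : core.

Lemma square_integral_cst z r (k : R) : 0 < r -> 0 <= k ->
  (\int[leb2]_(p in (square z r : set plane)) k%:E = (k * (2 * r) ^+ 2)%:E)%E.
Proof.
move=> r0 k0; have mI (a b : R) : measurable (`[a, b] : set (measurableTypeR R)) by exact: measurable_itv.
have [|p|+ _ _ _] := @tonelli_rect R (fun=> k%:E)
    [set` `[complex.Re z - r, complex.Re z + r]] [set` `[complex.Im z - r, complex.Im z + r]] (mI _ _) (mI _ _).
- exact: measurable_cst.
- by rewrite lee_fin.
rewrite /square => ->.
have lt (x : R) : x - r < x + r by rewrite ltrD2l gt0_cp.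
rewrite (eq_integral (fun=> (k * (2 * r))%:E)) => [|x _]; last first.
  by rewrite integral_cst_itv// opprD addrACA subrr add0r opprK -mulr2n mulr_natl.
rewrite integral_cst_itv// opprD addrACA subrr add0r opprK -[r + r]mulr2n -[r *+ 2]mulr_natl.
by congr (_ %:E); ring.
Qed.

Section NonnegativeContinuous.
Variable G : R * R -> R.
Hypotheses (Gc : continuous G) (G0 : forall p, 0 <= G p).

Let mG (D : set plane) : measurable D -> measurable_fun D (fun p : plane => (G p)%:E).
Proof.
by move=> mD; apply: measurable_funTS; apply/measurable_EFinP; exact: continuous_measurable_plane.
Qed.

Let G0' (p : plane) : (0 <= (G p)%:E)%E. Proof. by rewrite lee_fin. Qed.

Lemma plane_integral_ge0 (D : set plane) : (0 <= \int[leb2]_(p in D) (G p)%:E)%E.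
Proof. by apply: integral_ge0 => p _; exact: G0'. Qed.

Lemma plane_integral_subset (B D : set plane) : measurable B -> measurable D -> B `<=` D ->
  (\int[leb2]_(p in B) (G p)%:E <= \int[leb2]_(p in D) (G p)%:E)%E.
Proof. by move=> mB mD BD; apply: ge0_subset_integral => //; exact: mG. Qed.

Lemma plane_integral_setD (B D : set plane) : measurable B -> measurable D -> B `<=` D ->
  (\int[leb2]_(p in D) (G p)%:E =
   \int[leb2]_(p in B) (G p)%:E + \int[leb2]_(p in D `\` B) (G p)%:E)%E.
Proof.
move=> mB mD BD; rewrite -{1}(setDUK BD) ge0_integral_setU//.
- exact: measurableD.
- by rewrite setDUK//; exact: mG.
- by apply/disj_setPRL => x [].
Qed.

Lemma disjoint_squares_le (s : seq R[i]) (rr : R[i] -> R) (D : set plane) :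
  measurable D -> uniq s -> (forall l, l \in s -> (square l (rr l) : set plane) `<=` D) ->
  (forall l l', l \in s -> l' \in s -> l <> l' -> forall p, square l (rr l) p -> ~ square l' (rr l') p) ->
  (\sum_(l <- s) sqint G l (rr l) <= \int[leb2]_(p in D) (G p)%:E)%E.
Proof.
elim: s D => [|l s IH] D mD; first by rewrite big_nil => *; exact: plane_integral_ge0.
move=> /= /andP[ls us] sD dis; rewrite big_cons.
rewrite (@plane_integral_setD (square l (rr l)) D)//; last first.
  by apply: sD; rewrite inE eqxx.
apply: leeD => //; apply: IH => //; first exact: measurableD.
- move=> l' l's p pl'; split; first by apply: sD pl'; rewrite inE l's orbT.
  have l'l : l' <> l by move=> E; rewrite -E l's in ls.
  by apply: dis pl'; rewrite ?inE ?eqxx ?l's ?orbT.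
- by move=> l1 l2 h1 h2; apply: dis; rewrite inE ?h1 ?h2 orbT.
Qed.

Lemma exhaust_squares : \bigcup_n (square 0 n%:R : set plane) = setT.
Proof.
rewrite -subTset => -[x y] _.
have [n Hn] : exists n : nat, `|x| + `|y| <= n%:R.
  by exists (Num.trunc (`|x| + `|y|)).+1; rewrite ltW// truncnS_gt.
exists n => //; apply/squareE; rewrite /toC /box /=; split.
  by rewrite subr0 (le_trans _ Hn)// lerDl.
by rewrite subr0 (le_trans _ Hn)// lerDr.
Qed.

Lemma nondecreasing_squares : nondecreasing_seq (fun n => square 0 n%:R : set plane).
Proof.
move=> m n mn; rewrite subsetEset => p /squareE[h1 h2]; apply/squareE.
by split; [move: h1|move: h2] => /le_trans; apply; rewrite ler_nat.
Qed.

Lemma cvg_squares : (fun n : nat => sqint G (0 : R[i])%R n%:R) @ \oo --> (\int[leb2]_p (G p)%:E)%E.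
Proof.
rewrite -exhaust_squares; apply: ge0_nondecreasing_set_cvg_integral => //.
- exact: nondecreasing_squares.
- by move=> n; exact: mG.
Qed.

Lemma plane_integral_le (C : \bar R) : (forall n, (sqint G (0 : R[i])%R (n%:R)%R <= C)%E) ->
  (\int[leb2]_p (G p)%:E <= C)%E.
Proof.
move=> H; rewrite -(cvg_lim _ cvg_squares)//.
by apply: lime_le; [apply/cvg_ex; eexists; exact: cvg_squares|exact: nearW].
Qed.

Section Finite.
Hypothesis Gfin : (\int[leb2]_p (G p)%:E < +oo)%E.

Lemma plane_integral_tail (e : R) : 0 < e -> exists n : nat, forall D : set plane, measurable D ->
  (forall p, D p -> ~ square 0 n%:R p) -> (\int[leb2]_(p in D) (G p)%:E <= e%:E)%E.
Proof.
move=> e0; set I := (\int[leb2]_p (G p)%:E)%E.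
have If : I \is a fin_num by rewrite ge0_fin_numE//; exact: plane_integral_ge0.
have [n Hn] : exists n : nat, (I - e%:E < sqint G (0 : R[i])%R (n%:R)%R)%E.
  apply/not_existsP => H; have : (I <= I - e%:E)%E.
    by apply: plane_integral_le => n; rewrite leNgt; exact/negP/H.
  by apply/negP; rewrite -ltNge lteBlDr// lteDl.
exists n => D mD disj.
have sqf : sqint G 0 n%:R \is a fin_num.
  rewrite ge0_fin_numE; last exact: plane_integral_ge0.
  by apply: le_lt_trans Gfin; apply: plane_integral_subset.
have h : (\int[leb2]_(p in D) (G p)%:E <= I - sqint G 0%R n%:R)%E.
  rewrite leeBrDl// -leeBrDr; last first.
    rewrite ge0_fin_numE; last exact: plane_integral_ge0.
    by apply: le_lt_trans Gfin; apply: plane_integral_subset.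
  rewrite leeBrDr; last first.
    rewrite ge0_fin_numE; last exact: plane_integral_ge0.
    by apply: le_lt_trans Gfin; apply: plane_integral_subset.
  rewrite -ge0_integral_setU//.
  - apply: plane_integral_subset => //; exact: measurableU.
  - by apply: mG; apply: measurableU.
  - by apply/disj_setPRL => p Dp; exact: disj.
rewrite (le_trans h)// leeBlDr// addeC -leeBlDr//.
exact: ltW.
Qed.

End Finite.

(** At each step the part of [D] served by one square is removed. The squares may overlap, and the
    bound at a point has to hold for only one of the squares that contain it. *)
Lemma plane_integral_cover (s : seq R[i]) (rr k : R[i] -> R) (D : set plane) :
  measurable D -> (forall l, 0 < rr l) -> (forall l, 0 <= k l) ->
  (forall p, D p -> exists l, [/\ l \in s, square l (rr l) p & G p <= k l]) ->
  (\int[leb2]_(p in D) (G p)%:E <= (\sum_(l <- s) k l * (2 * rr l) ^+ 2)%:E)%E.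
Proof.
move=> + r0 k0; elim: s D => [|l s IH] D mD H.
  rewrite big_nil (_ : D = set0) ?integral_set0// -subset0 => p /H[l []].
  by rewrite in_nil.
rewrite big_cons; pose B := D `&` (square l (rr l) `&` [set p | G p <= k l]) : set plane.
have mk : measurable ([set p | G p <= k l] : set plane).
  rewrite (_ : [set p | _] = ~` [set p | k l < G p]); last first.
    by apply/seteqP; split => p /=; rewrite leNgt => /negP.
  apply: measurableC; apply: open_measurable_plane.
  rewrite (_ : [set p | _] = G @^-1` [set` `]k l, +oo[]).
    by apply: open_comp => [p _|]; [exact: Gc|exact: interval_open].
  by apply/seteqP; split => p /=; rewrite in_itv/= andbT.
have mB : measurable B by apply: measurableI => //; exact: measurableI.
rewrite (@plane_integral_setD B D)//; last by move=> p [].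
rewrite EFinD; apply: leeD.
  rewrite -(square_integral_cst l (r0 l) (k0 l)).
  apply: (@le_trans _ _ (\int[leb2]_(p in B) (k l)%:E)%E).
    apply: ge0_le_integral => //.
    - exact: mG.
    - by move=> p [_ [_ /=]]; rewrite lee_fin.
  apply: ge0_subset_integral => //; first by move=> p _; rewrite lee_fin.
  by move=> p [_ []].
apply: IH; first exact: measurableD.
move=> p [Dp nB]; have [l' [l's sp Gp]] := H p Dp.
exists l'; split => //; move: l's; rewrite inE => /predU1P[E|//].
by case: nB; subst l'.
Qed.

End NonnegativeContinuous.

(** A finite part of maximal size exhausts the set. *)
Lemma bounded_size_finite (S : set R[i]) (N : nat) :
  (forall s, finite_part S s -> (size s <= N)%N) ->
  exists2 A, finite_part S A & forall l, S l -> l \in A.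
Proof.
move=> H; pose P n := `[< exists2 s, finite_part S s & size s = n >].
have exP : exists n, P n by exists 0%N; apply/asboolP; exists [::].
have ubP n : P n -> (n <= N)%N by move=> /asboolP[s /H + <-].
case: (ex_maxnP exP ubP) => n /asboolP[A hA sA] maxn; exists A => // l Sl.
apply/negP => /negP lA; have : P n.+1.
  apply/asboolP; exists (l :: A); last by rewrite /= sA.
  split; first by rewrite /= lA hA.1.
  by move=> l'; rewrite inE => /predU1P[->//|/hA.2].
by move=> /maxn; rewrite ltnn.
Qed.

End PlaneIntegrals.

(** * The Lagrange series *)

Lemma real_ccontinuous (R : realType) (u : R[i] -> R) :
  (forall z, ccontinuous (fun w => (u w)%:C) z) -> continuous (fun p : R * R => u (toC p)).
Proof.
move=> uc x; apply/cvgrPdist_le => /= e e0.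
have [d d0 Hd] := uc (toC x) e e0.
have := @toC_continuous R (fun w => w - toC x) x.
have wc : ccontinuous (fun w => w - toC x) (toC x).
  by apply: cdifferentiable_continuous; apply: cdifferentiableB; [exact: cdifferentiable_id|exact: cdifferentiable_cst].
move=> /(_ wc)/cvgrPdist_lt/(_ _ d0); apply: filterS => y /=.
rewrite subrr cabs0 sub0r normrN ger0_norm ?cabs_ge0// => /Hd.
by rewrite -rmorphB cabs_real distrC.
Qed.

Section Lagrange.
Variables (R : realType) (phi rho d : R[i] -> R) (g : R[i] -> R[i]) (L : set R[i]).
Variables (delta M K Cg : R).
Hypothesis FR : multiplier_frame phi rho d g L delta M K Cg.
Implicit Types (z w l : R[i]) (S : set R[i]).

Let rho_gt0 := frame_rho_gt0 FR.
Let rho_lip := frame_rho_lip FR.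
Let delta_gt0 : 0 < delta. Proof. by case/andP: (frame_delta FR). Qed.
Let delta_le1 : delta <= 1. Proof. by case/andP: (frame_delta FR). Qed.
Let M_gt0 : 0 < M. Proof. exact: lt_le_trans (frame_M FR). Qed.
Let Cg_gt0 : 0 < Cg. Proof. exact: lt_le_trans (frame_Cg FR). Qed.

Section Coefficients.
Variables (c : R[i] -> R[i]) (A : R).
Let b l := c l / cderiv g l.
Let aa l := cabs (b l) / rho l.
Hypothesis LA : sum_le L aa A.

(** At a zero of [g] the product is [0], whereas its limit there is [c z]; [lagrange_near] confirms
    this value. *)
Definition lagrange z := if g z == 0 then c z else g z * pseries g c L z.

Let offm z (nL : ~ L z) : 0 < d z / (2 * M).
Proof. by rewrite divr_gt0 ?mulr_gt0// (frame_d_gt0 FR). Qed.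

Let offL z l : L l -> d z / (2 * M) * rho l <= cabs (z - l).
Proof.
move=> Ll; rewrite mulrAC ler_pdivrMr ?mulr_gt0// mulrC.
by rewrite mulrC [leRHS]mulrC; exact: (frame_near_le FR).
Qed.

Lemma pseries_split z l : L l -> ~ L z ->
  pseries g c L z = b l / (z - l) + pseries g c (L `\ l) z.
Proof.
move=> Ll nL.
have H := csumP (pseries_summable FR LA (offm nL) (@offL z)).
by rewrite addrC /pseries (cvsum_csum (cvsum_setD1 Ll H)) subrK.
Qed.

Lemma sum_le_setD1 l : sum_le (L `\ l) aa A.
Proof. by apply: sum_leS LA => x []. Qed.

Lemma pseries_setD1_cdiff z l : L l -> cabs (z - l) <= delta / 4 * rho l ->
  cdiff (pseries g c (L `\ l)) z (- csum (L `\ l) (fun l' => b l' / (z - l') ^+ 2)).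
Proof.
move=> Ll h; apply: (@pseries_cdiff _ _ _ _ _ _ _ _ _ _ FR c A _ z (delta / 2)).
- exact: sum_le_setD1.
- by rewrite divr_gt0.
- by move=> l' [Ll' /= /eqP]; rewrite eq_sym => /eqP ll'; have [] := frame_other FR Ll Ll' ll' h.
Qed.

(** With the pole at [l] split off, both summands are differentiable near [l], the first through
    [zquot]. *)
Lemma lagrange_near l w : L l -> cabs (w - l) < delta / 4 * rho l ->
  lagrange w = b l * zquot g l w + g w * pseries g c (L `\ l) w.
Proof.
move=> Ll h; have gl : g l = 0 by apply/(frame_zeros FR).
rewrite /lagrange; have [->|wl] := eqVneq w l.
  by rewrite gl eqxx mul0r addr0 /zquot eqxx mulfVK// (deriv_neq0 FR).
have nL : ~ L w.
  apply: (frame_notin FR Ll wl); apply: (lt_le_trans h).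
  by rewrite ler_wpM2r ?(ltW (rho_gt0 l))// ler_pdivrMr// ler_peMr ?(ltW delta_gt0)// ler1n.
case: eqVneq => [/(frame_zeros FR)//|gw].
rewrite (pseries_split Ll nL) mulrDr; congr (_ + _).
by rewrite /zquot (negbTE wl) mulrCA.
Qed.

Lemma lagrange_differentiable z : cdifferentiable lagrange z.
Proof.
have d4 : 0 < delta / 4 by rewrite divr_gt0.
have [Lz|nL] := pselect (L z).
  apply: (@cdifferentiable_near _ (fun w => b z * zquot g z w + g w * pseries g c (L `\ z) w) _ _ (delta / 4 * rho z)).
  - exact: mulr_gt0.
  - by move=> w h; rewrite -lagrange_near.
  - apply: cdifferentiableD.
      apply: cdifferentiableM; first exact: cdifferentiable_cst.
      by apply: zquot_differentiable; [exact: (frame_g FR)|exact/(frame_zeros FR)].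
    apply: cdifferentiableM; first exact: (frame_g FR).
    eexists; apply: pseries_setD1_cdiff => //.
    by rewrite subrr cabs0 mulr_ge0 ?ltW.
have gz0 : 0 < cabs (g z) / 2.
  by rewrite divr_gt0// cabs_gt0; apply/eqP => /(frame_zeros FR).
have [r r0 Hr] := ccontinuous_cabs (cdifferentiable_continuous (frame_g FR z)) gz0.
apply: (@cdifferentiable_near _ (fun w => g w * pseries g c L w) _ _ r) => //.
  move=> w /Hr; rewrite /lagrange; case: eqVneq => // ->.
  rewrite cabs0 sub0r normrN ger0_norm ?cabs_ge0// => h; exfalso; move: h gz0.
  by move: (cabs (g z)) => x; lra.
apply: cdifferentiableM; first exact: (frame_g FR).
by eexists; exact: (pseries_cdiff FR LA (offm nL) (@offL z)).
Qed.

Lemma lagrange_interp l : L l -> lagrange l = c l.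
Proof. by move=> /(frame_zeros FR) gl; rewrite /lagrange gl eqxx. Qed.

Lemma lagrange_off z : ~ L z -> lagrange z = g z * pseries g c L z.
Proof. by rewrite /lagrange; case: eqVneq => // /(frame_zeros FR). Qed.

End Coefficients.
End Lagrange.

(** * Necessity *)

Ltac nneg := repeat first [assumption | (apply: ltW; assumption) | exact: cabs_ge0
  | exact: expR_ge0 | exact: ler0n | exact: ler01
  | lazymatch goal with
    | |- is_true (0 <= _ + _) => apply: addr_ge0
    | |- is_true (0 <= _ * _) => apply: mulr_ge0
    | |- is_true (0 <= _ ^+ _) => apply: exprn_ge0
    | |- is_true (0 <= _^-1) => rewrite invr_ge0
    end].

Section Necessity.
Variables (R : realType) (phi rho d : R[i] -> R) (g : R[i] -> R[i]) (L : set R[i]).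
Variables (delta M K Cg : R).
Hypothesis FR : multiplier_frame phi rho d g L delta M K Cg.
Implicit Types (z w l : R[i]) (S : set R[i]).

Let rho_gt0 := frame_rho_gt0 FR.
Let rho_lip := frame_rho_lip FR.
Let delta_gt0 : 0 < delta. Proof. by case/andP: (frame_delta FR). Qed.
Let delta_le1 : delta <= 1. Proof. by case/andP: (frame_delta FR). Qed.
Let M_gt0 : 0 < M. Proof. exact: lt_le_trans (frame_M FR). Qed.
Let Cg_gt0 : 0 < Cg. Proof. exact: lt_le_trans (frame_Cg FR). Qed.
(** [m * rho l] is the half-side of the squares around lattice points. They reach up to
    [2 m rho l = delta / 4 * rho l], the range of [frame_other], which makes them disjoint. Stating
    the value as an equation keeps [m] opaque. *)
Variable m : R.
Hypothesis mE : m = delta / 8.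
Let m_gt0 : 0 < m. Proof. by rewrite mE divr_gt0. Qed.
Let m_le : m <= 1 / 8. Proof. by rewrite mE ler_pM2r ?invr_gt0. Qed.
Let m2 : 2 * m = delta / 4. Proof. by rewrite mE; field. Qed.

Definition fock_density (f : R[i] -> R[i]) (p : R * R) : R :=
  cabs (f (toC p)) * expR (- phi (toC p)) / rho (toC p) ^+ 2.

Lemma rho_ccontinuous z : ccontinuous (fun w => (rho w)%:C) z.
Proof.
move=> e e0; exists e => // w wz; rewrite -rmorphB cabs_real ler_norml.
have := rho_lip w z; have := rho_lip z w; rewrite cabsC.
by move: (ltW wz) => h h1 h2; apply/andP; split; lra.
Qed.

Lemma fock_density_ge0 f p : 0 <= fock_density f p.
Proof. by rewrite divr_ge0 ?mulr_ge0 ?expR_ge0 ?cabs_ge0 ?exprn_ge0 ?ltW. Qed.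

Lemma fock_density_continuous f : (forall z, cdifferentiable f z) -> continuous (fock_density f).
Proof.
move=> fd p; apply: cvgM; first apply: cvgM.
- by apply: toC_continuous; exact: cdifferentiable_continuous.
- apply: (@continuous_comp _ _ _ (fun p : R * R => - phi (toC p)) (@expR R)); last exact: continuous_expR.
  by apply: cvgN; exact: (real_ccontinuous (frame_phi FR)).
- apply: cvgV; first by rewrite expf_neq0// gt_eqF.
  by apply: cvgM; exact: (real_ccontinuous rho_ccontinuous).
Qed.

Lemma fock_densityE f w : cabs (f w) * expR (- phi w) = rho w ^+ 2 * fock_density f (complex.Re w, complex.Im w).
Proof.
rewrite /fock_density /toC /= (_ : complex.Re w +i* complex.Im w = w); last by case: w.
by rewrite [RHS]mulrC mulfVK// expf_neq0// gt_eqF.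
Qed.

Lemma toC_split p : (complex.Re (toC p), complex.Im (toC p)) = p :> R * R.
Proof. by case: p. Qed.

(** The lower multiplier bound trades [1 / |g|] for [e^(- phi)] as long as [d] stays above [u]. *)
Lemma quotient_bound f w (u : R) : 0 < u -> u <= d w ->
  cabs (f w / g w) <= Cg / u * (rho w ^+ 2 * fock_density f (complex.Re w, complex.Im w)).
Proof.
move=> u0 ud; rewrite -fock_densityE expRN cabsM cabsV.
have := frame_lower FR w => H.
have pw0 : 0 < expR (phi w) by exact: expR_gt0.
have H2 : expR (phi w) * u <= Cg * cabs (g w) by rewrite (le_trans _ H)// ler_wpM2l// ltW.
have g0 : 0 < cabs (g w).
  by rewrite -(pmulr_rgt0 _ Cg_gt0) (lt_le_trans _ H2)// mulr_gt0.
rewrite mulrCA; apply: ler_wpM2l; first exact: cabs_ge0.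
rewrite -[leRHS]invrK lef_pV2 ?posrE//; last by rewrite invr_gt0 !mulr_gt0 ?invr_gt0.
rewrite invfM invf_div invrK mulrAC ler_pdivrMr// mulrC.
by rewrite [leRHS]mulrC.
Qed.

Lemma lattice_box w l : L l -> box l (m * rho l) w ->
  [/\ cabs (w - l) <= delta / 4 * rho l, rho w <= 2 * rho l & rho l <= 2 * rho w].
Proof.
move=> Ll /box_cabs h; have rl0 := rho_gt0 l; have h4 : cabs (w - l) <= delta / 4 * rho l.
  by rewrite -m2 -mulrA.
split => //; have := rho_lip w l; have := rho_lip l w; rewrite [cabs (l - w)]cabsC.
  have : delta / 4 * rho l <= 1 / 4 * rho l by rewrite ler_wpM2r ?(ltW rl0)// ler_pM2r ?invr_gt0.
  by move: h4; move: (delta / 4 * rho l) (cabs (w - l)) => u v; lra.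
have : delta / 4 * rho l <= 1 / 4 * rho l by rewrite ler_wpM2r ?(ltW rl0)// ler_pM2r ?invr_gt0.
by move: h4; move: (delta / 4 * rho l) (cabs (w - l)) => u v; lra.
Qed.

Lemma lattice_annulus f w l : L l -> box l (m * rho l) w -> ~ open_box l (m * rho l / 2) w ->
  cabs (f w / g w) <= 64 * Cg / m * rho l ^+ 2 * fock_density f (complex.Re w, complex.Im w) /\
  m * rho l / 2 <= cabs (w - l).
Proof.
move=> Ll bw nw; have [h1 h2 _] := lattice_box Ll bw.
have rl0 := rho_gt0 l.
have h3 : m * rho l / 2 <= cabs (w - l).
  rewrite leNgt; apply/negP => h; apply: nw.
  by split; rewrite (le_lt_trans _ h)// ?ler_Re_cabs ?ler_Im_cabs.
split => //.
have m16 : 0 < m / 16 by rewrite divr_gt0.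
(* From [m rho l / 2 <= |w - l| <= 8 rho l * d w]. Together with [rho w <= 2 rho l] this makes the
   constant [16 * 4 = 64]. *)
have hd : m / 16 <= d w.
  have := frame_d_lower FR Ll h1 => h4.
  have h5 := le_trans h3 h4.
  rewrite -(ler_pM2l (_ : 0 < 8 * rho l)) ?mulr_gt0//; apply: le_trans h5.
  by rewrite le_eqVlt; apply/orP; left; apply/eqP; field.
rewrite (le_trans (quotient_bound f m16 hd))//.
have -> : 64 * Cg / m * rho l ^+ 2 = Cg / (m / 16) * (2 * rho l) ^+ 2 by field; rewrite gt_eqF.
rewrite -[leRHS]mulrA; apply: ler_wpM2l.
  by rewrite divr_ge0// ltW.
apply: ler_wpM2r; first exact: fock_density_ge0.
by rewrite lerXn2r// nnegrE ?mulr_ge0 ?(ltW (rho_gt0 _)).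
Qed.

Section Entire.
Variables f c : R[i] -> R[i].
Hypothesis fd : forall z, cdifferentiable f z.
Hypothesis ffin : (\int[leb2]_p (fock_density f p)%:E < +oo)%E.
Let W := fock_density f.
Let Wc := fock_density_continuous fd.
Let W0 := fock_density_ge0 f.

Definition fock_mass z r := fine (sqint W z r).

Lemma fock_massE z r : (fock_mass z r)%:E = sqint W z r.
Proof.
rewrite /fock_mass fineK// ge0_fin_numE.
  apply: le_lt_trans ffin; apply: plane_integral_subset => //.
  exact: square_measurable.
exact: plane_integral_ge0.
Qed.

Lemma lattice_squares_disjoint l l' : L l -> L l' -> l <> l' ->
  forall p, square l (m * rho l) p -> ~ square l' (m * rho l') p.
Proof.
move=> Ll Ll' ll' p /squareE b1 /squareE b2.
have [h1 _ _] := lattice_box Ll b1; have [h2 _ _] := lattice_box Ll' b2.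
have [_ _] := frame_other FR Ll Ll' ll' h1; apply/negP; rewrite -ltNge (le_lt_trans h2)//.
by rewrite ltr_pM2r// ltr_pM2l// ltf_pV2 ?posrE// ltr_nat.
Qed.

Lemma fock_mass_sum : sum_le L (fun l => fock_mass l (m * rho l)) (fine (\int[leb2]_p (W p)%:E)%E).
Proof.
move=> s [us sL]; rewrite -lee_fin fineK; last first.
  by rewrite ge0_fin_numE//; exact: plane_integral_ge0.
rewrite -sumEFin (eq_bigr (fun l => sqint W l (m * rho l))) => [|l _]; last exact: fock_massE.
apply: (@disjoint_squares_le _ W Wc W0 s (fun l => m * rho l)) => //.
by move=> l l' /sL Ll /sL Ll' ll'; exact: lattice_squares_disjoint.
Qed.

(** The constant [e] integrates to [e (2 r) ^ 2], and dividing by [(r / 2) ^ 2] gives [16 e]. *)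
Lemma submean_fock (k : R[i] -> R[i]) z (r a e : R) : 0 < r -> 0 <= a -> 0 <= e ->
  (forall w, box z r w -> w != z -> cdifferentiable k w) -> ccontinuous k z ->
  (forall w, box z r w -> ~ open_box z (r / 2) w ->
     cabs (k w) <= a * W (complex.Re w, complex.Im w) + e) ->
  cabs (k z) <= 4 * a / r ^+ 2 * fock_mass z r + 16 * e.
Proof.
move=> r0 a0 e0 kd kc kb; have r2 : 0 < r / 2 by rewrite divr_gt0.
have E2 : 2 * (r / 2) = r by field.
have Gc : continuous (fun p => a * W p + e).
  move=> p; apply: cvgD; last exact: cvg_cst.
  by apply: cvgM; [exact: cvg_cst|exact: Wc].
have G0 p : 0 <= a * W p + e by rewrite addr_ge0// mulr_ge0//; exact: W0.
have := @submean_square R k z (r / 2) (fun p => a * W p + e) r2.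
rewrite E2 => /(_ kd kc Gc G0) H.
have {}H := H (fun p bp nbp => eq_ind _ (fun q => cabs (k (toC p)) <= a * W q + e) (kb _ bp nbp) _ (toC_split p)).
have {H} : (r / 2) ^+ 2 * cabs (k z) <= a * fock_mass z r + e * (2 * r) ^+ 2.
  rewrite -lee_fin (le_trans H)// EFinD EFinM fock_massE -(square_integral_cst z r0 e0).
  have mW D : measurable D -> measurable_fun D (fun p : measurableTypeR R * measurableTypeR R => (W p)%:E).
    by move=> mD; apply: measurable_funTS; apply/measurable_EFinP; exact: continuous_measurable_plane.
  rewrite /sqint -ge0_integralZl_EFin//; last first.
  - by apply: mW; exact: square_measurable.
  - by move=> p _; rewrite lee_fin.
  - exact: square_measurable.
  rewrite -ge0_integralD//.
  - exact: square_measurable.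
  - by move=> p _; rewrite mule_ge0// lee_fin.
  - by apply: emeasurable_funM; [exact: measurable_cst|apply: mW; exact: square_measurable].
have -> : 4 * a / r ^+ 2 * fock_mass z r + 16 * e =
  (a * fock_mass z r + e * (2 * r) ^+ 2) / (r / 2) ^+ 2 by field; rewrite gt_eqF.
by rewrite ler_pdivlMr ?exprn_gt0// mulrC.
Qed.

Hypothesis fc : forall l, L l -> f l = c l.
Let b l := c l / cderiv g l.
Let aa l := cabs (b l) / rho l.

(** The sub-mean value inequality for [f / zquot g l], that is [f (z - l) / g], whose value at [l]
    is [c l / g'(l) = b l]. On the annulus the factor [|w - l| <= 2 m rho l] doubles the constant
    64. *)
Lemma coef_le l : L l -> aa l <= 512 * Cg / m ^+ 2 * fock_mass l (m * rho l).
Proof.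
move=> Ll; have rl0 := rho_gt0 l; have gl : g l = 0 by apply/(frame_zeros FR).
have zq z := zquot_differentiable (frame_g FR) gl z.
have r0 : 0 < m * rho l by rewrite mulr_gt0.
have zn w : box l (m * rho l) w -> zquot g l w != 0.
  move=> bw; rewrite /zquot; case: (eqVneq w l) => [_|wl]; first exact: (deriv_neq0 FR Ll).
  have [h1 _ _] := lattice_box Ll bw.
  have nL : ~ L w.
    apply: (frame_notin FR Ll wl); apply: (le_lt_trans h1).
    by rewrite ltr_pM2r// ltr_pdivrMr// ltr_pMr// ltr1n.
  rewrite mulf_neq0 ?invr_eq0 ?subr_eq0//.
  by apply/eqP => /(frame_zeros FR).
have kd w : box l (m * rho l) w -> cdifferentiable (fun w => f w / zquot g l w) w.
  by move=> bw; apply: cdifferentiable_div => //; exact: zn.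
have bl := box_center l (ltW r0).
have := @submean_fock (fun w => f w / zquot g l w) l (m * rho l) (128 * Cg * rho l ^+ 3) 0 r0.
have a0 : 0 <= 128 * Cg * rho l ^+ 3 by nneg.
move=> /(_ a0 (lexx 0) (fun w bw _ => kd w bw) (cdifferentiable_continuous (kd l bl))) H.
have {}H : cabs (b l) <= 4 * (128 * Cg * rho l ^+ 3) / (m * rho l) ^+ 2 * fock_mass l (m * rho l).
  have zl : zquot g l l = cderiv g l by rewrite /zquot eqxx.
  move: H; rewrite mulr0 addr0 zl (fc Ll); apply => w bw nw; rewrite addr0.
  have [h1 h2] := lattice_annulus f Ll bw nw; have [h3 _ _] := lattice_box Ll bw.
  have wl : w != l.
    by apply/eqP => wl; move: h2; rewrite wl subrr cabs0 leNgt divr_gt0.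
  rewrite /zquot (negbTE wl) invf_div mulrA -mulrAC cabsM mulrC.
  have -> : 128 * Cg * rho l ^+ 3 = (2 * m * rho l) * (64 * Cg / m * rho l ^+ 2) by field; rewrite gt_eqF.
  by rewrite -[leRHS]mulrA ler_pM ?cabs_ge0// m2.
rewrite /aa ler_pdivrMr// (le_trans H)// le_eqVlt; apply/orP; left; apply/eqP; field.
by rewrite !gt_eqF.
Qed.

Let A := 512 * Cg / m ^+ 2 * fine (\int[leb2]_p (W p)%:E)%E.

Lemma coef_summable : sum_le L aa A.
Proof.
have c0 : 0 <= 512 * Cg / m ^+ 2 by nneg.
exact: (le_sum_le coef_le (sum_leZ c0 fock_mass_sum)).
Qed.

(** Supplied later by [lagrange_representation], which itself rests on [coef_summable]. *)
Hypothesis frep : forall w, ~ L w -> f w = g w * pseries g c L w.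
(** Up to sign the inner sum of the second condition. [S2] is that of the third, and minus the
    derivative at [l'] of the series without [l']. *)
Let S1 l' := pseries g c (L `\ l') l'.
Let S2 l' := csum (L `\ l') (fun l => b l / (l' - l) ^+ 2).
Let C1 := 256 * Cg / m ^+ 3.

Let C1_ge0 : 0 <= C1. Proof. by rewrite /C1; nneg. Qed.
Let m32 : 0 <= 32 / m. Proof. by nneg. Qed.

Section AtPoint.
Variable l' : R[i].
Hypothesis Ll' : L l'.
Let rl0 := rho_gt0 l'.
Let r := m * rho l'.
Let r0 : 0 < r. Proof. exact: mulr_gt0. Qed.
Let k := pseries g c (L `\ l').

(** Off the lattice [k = f / g - b l' / (w - l')], and on the annulus [|w - l'| >= m rho l' / 2]. *)
Lemma pseries_setD1_annulus w : box l' r w -> ~ open_box l' (r / 2) w ->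
  cabs (k w) <= 64 * Cg / m * rho l' ^+ 2 * W (complex.Re w, complex.Im w) + 2 * aa l' / m.
Proof.
move=> bw nw; have [h1 h2] := lattice_annulus f Ll' bw nw; have [h3 _ _] := lattice_box Ll' bw.
have r20 : 0 < m * rho l' / 2 by rewrite divr_gt0.
have wl : w != l' by apply/eqP => wl; move: h2; rewrite wl subrr cabs0 leNgt r20.
have nL : ~ L w.
  apply: (frame_notin FR Ll' wl); apply: (le_lt_trans h3).
  by rewrite ltr_pM2r// ltr_pdivrMr// ltr_pMr// ltr1n.
have gw : g w != 0 by apply/eqP => /(frame_zeros FR).
have -> : k w = f w / g w - b l' / (w - l').
  rewrite (frep nL) (pseries_split FR coef_summable Ll' nL) mulrAC mulfV// mul1r.
  by rewrite addrC addrA addNr add0r.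
rewrite (le_trans (cabsB_le _ _))// lerD// cabsM cabsV ler_pdivrMr; last exact: lt_le_trans h2.
have -> : cabs (b l') = 2 * aa l' / m * (m * rho l' / 2) by rewrite /aa; field; rewrite !gt_eqF.
have aa0 : 0 <= aa l' by rewrite /aa; nneg.
by apply: ler_wpM2l => //; nneg.
Qed.

Let kd w : box l' r w -> cdiff k w (- csum (L `\ l') (fun l => b l / (w - l) ^+ 2)).
Proof.
by move=> bw; have [h _ _] := lattice_box Ll' bw; apply: (pseries_setD1_cdiff FR coef_summable Ll' h).
Qed.

Let bl := box_center l' (ltW r0).
Let aa0 : 0 <= aa l'. Proof. by rewrite divr_ge0 ?cabs_ge0 ?ltW. Qed.

Lemma first_sum_le : cabs (S1 l') <= C1 * fock_mass l' r + 32 / m * aa l'.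
Proof.
have a0 : 0 <= 64 * Cg / m * rho l' ^+ 2 by nneg.
have e0 : 0 <= 2 * aa l' / m by nneg.
have := @submean_fock k l' r _ _ r0 a0 e0 (fun w bw _ => ex_intro _ _ (kd bw)).
move=> /(_ (cdiff_continuous (kd bl)) pseries_setD1_annulus) H.
rewrite (le_trans H)// le_eqVlt; apply/orP; left; apply/eqP; rewrite /C1 /r; field.
by rewrite !gt_eqF.
Qed.

(** The divided difference of [k] at [l'] takes the value [- S2 l'] there. In [34 = 2 + 32] the 2
    comes from the bound of [k] on the annulus and the 32 from the subtracted value [S1 l'],
    estimated by [first_sum_le]. *)
Lemma second_sum_le :
  rho l' * cabs (S2 l') <= 34 / m * (C1 * fock_mass l' r + 32 / m * aa l').
Proof.
set B := C1 * _ + _; have kl := first_sum_le.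
pose k2 := zquot (fun w => k w - k l') l'.
have dk w : box l' r w -> cdifferentiable (fun w => k w - k l') w.
  by move=> bw; apply: cdifferentiableB; [exists (- csum (L `\ l') (fun l => b l / (w - l) ^+ 2)); exact: kd|exact: cdifferentiable_cst].
have k20 : k l' - k l' = 0 by rewrite subrr.
have k2l : k2 l' = - S2 l'.
  rewrite /k2 /zquot eqxx; have [_] := cdiff_derivable (kd bl) => <-.
  apply: (cdiff_uniq (cdifferentiableP (dk _ bl))).
  move=> e e0; have [q q0 Hq] := cdifferentiableP (ex_intro _ _ (kd bl)) e0.
  by exists q => // h /Hq; rewrite subrr subr0.
have a0 : 0 <= 128 * Cg / m ^+ 2 * rho l' by nneg.
have e0 : 0 <= (2 * aa l' / m + cabs (S1 l')) * (2 / r).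
  by nneg.
have := @submean_fock k2 l' r _ _ r0 a0 e0.
have kd2 w : box l' r w -> w != l' -> cdifferentiable k2 w.
  move=> bw wl; apply: (@cdifferentiable_near _ (fun w => (k w - k l') / (w - l')) _ _ (cabs (w - l'))).
  - by rewrite cabs_gt0 subr_eq0.
  - by move=> x xw; rewrite /k2 /zquot; case: eqVneq xw => // ->; rewrite cabsC ltxx.
  - apply: cdifferentiable_div; first by rewrite subr_eq0.
      exact: dk.
    by apply: cdifferentiableB; [exact: cdifferentiable_id|exact: cdifferentiable_cst].
move=> /(_ kd2 (ccontinuous_zquot (dk _ bl) k20)) H.
have {}H : cabs (S2 l') <= 4 * (128 * Cg / m ^+ 2 * rho l') / r ^+ 2 * fock_mass l' r + 16 * ((2 * aa l' / m + cabs (S1 l')) * (2 / r)).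
  move: H; rewrite k2l cabsN; apply => w bw nw.
  have [_ h2] := lattice_annulus f Ll' bw nw.
  have r20 : 0 < m * rho l' / 2 by rewrite divr_gt0.
  have wl : w != l' by apply/eqP => wl; move: h2; rewrite wl subrr cabs0 leNgt r20.
  rewrite /k2 /zquot (negbTE wl) cabsM cabsV ler_pdivrMr; last exact: lt_le_trans h2.
  have h3 : cabs (k w - k l') <= 64 * Cg / m * rho l' ^+ 2 * W (complex.Re w, complex.Im w) + 2 * aa l' / m + cabs (S1 l').
    by rewrite (le_trans (cabsB_le _ _))// lerD// pseries_setD1_annulus.
  rewrite (le_trans h3)//; set X := leLHS.
  have -> : 128 * Cg / m ^+ 2 * rho l' * W (complex.Re w, complex.Im w) +
    (2 * aa l' / m + cabs (S1 l')) * (2 / r) = X / (m * rho l' / 2).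
    by rewrite /X /r; field; rewrite !gt_eqF.
  rewrite mulrAC -[leLHS]mulr1 -mulrA; apply: ler_wpM2l.
    by have W0w := W0 (complex.Re w, complex.Im w); rewrite /X; nneg.
  by rewrite ler_pdivlMr// mul1r.
have H1 : rho l' * cabs (S2 l') <= rho l' * (4 * (128 * Cg / m ^+ 2 * rho l') / r ^+ 2 * fock_mass l' r + 16 * ((2 * aa l' / m + B) * (2 / r))).
  rewrite ler_wpM2l ?(ltW rl0)// (le_trans H)// lerD2l ler_wpM2l// ler_wpM2r ?lerD2l//.
  by rewrite divr_ge0 ?ltW.
rewrite (le_trans H1)// le_eqVlt; apply/orP; left; apply/eqP; rewrite /B /C1 /r; field.
by rewrite !gt_eqF.
Qed.

End AtPoint.

Lemma first_sums : exists C, sum_le L (fun l' => cabs (S1 l')) C.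
Proof.
eexists; apply: (le_sum_le first_sum_le).
exact: (sum_leD (sum_leZ C1_ge0 fock_mass_sum) (sum_leZ m32 coef_summable)).
Qed.

Lemma second_sums : exists C, sum_le L (fun l' => rho l' * cabs (S2 l')) C.
Proof.
have m34 : 0 <= 34 / m by nneg.
eexists; apply: (le_sum_le second_sum_le); apply: (sum_leZ m34).
exact: (sum_leD (sum_leZ C1_ge0 fock_mass_sum) (sum_leZ m32 coef_summable)).
Qed.

End Entire.
End Necessity.

(** * The second sum as a value of the Lagrange series *)

Lemma sum_le_finite_tail (R : realType) (S : set R[i]) (x : R[i] -> R) A C :
  uniq A -> (forall l, 0 <= x l) -> sum_le (S `\` [set` A]) x C ->
  sum_le S x (\sum_(l <- A) x l + C).
Proof.
move=> uA x0 H s [us sS]; rewrite (bigID (mem A))/=; apply: lerD.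
  rewrite -big_filter; apply: ler_sum_subset => //; first by rewrite filter_uniq.
  by move=> l; rewrite mem_filter => /andP[].
rewrite -big_filter; apply: H; split; first by rewrite filter_uniq.
by move=> l; rewrite mem_filter => /andP[/negP lA /sS Sl]; split.
Qed.

Section LinearArithmetic.
Variable R : realType.
Implicit Types x y z t u v w : R.

(** This lemma and the next three isolate linear inequalities between moduli and radii, so that
    [lra] meets only variables. *)
Lemma linear_half x y z t u v : u <= y / 4 -> t <= z -> z <= u + v -> y <= t + x -> x <= 1 / 8 * z ->
  0 < t -> t / 2 <= v.
Proof. by move=> *; lra. Qed.

Lemma linear_escape n r0 x u v y t : 4 * n + r0 + 1 <= x -> u <= 2 * t -> v <= 2 * n ->
  y <= r0 + x -> t <= 1 / 64 * y -> 0 <= n -> 0 < r0 -> ~ (x - v <= u).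
Proof. by move=> *; lra. Qed.

Lemma linear_near0 T r0 x : 4 * (T + r0) <= x -> 0 <= T -> 0 < r0 -> T <= x.
Proof. by move=> *; lra. Qed.

Lemma linear_near T r0 x rz rl mrl u v w y : 4 * (T + r0) <= x -> 0 <= T -> u < mrl -> 0 < r0 ->
  0 < rl -> v <= 2 * mrl -> rl <= rz + u -> rz <= r0 + x -> mrl <= 1 / 8 * rl ->
  w <= u + v -> x - y <= w -> T <= y.
Proof. by move=> *; lra. Qed.

End LinearArithmetic.

Section Uniqueness.
Variables (R : realType) (phi rho d : R[i] -> R) (g : R[i] -> R[i]) (L : set R[i]).
Variables (delta M K Cg : R).
Hypothesis FR : multiplier_frame phi rho d g L delta M K Cg.
Implicit Types (z w l : R[i]) (S : set R[i]).

Let rho_gt0 := frame_rho_gt0 FR.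
Let rho_lip := frame_rho_lip FR.
Let delta_gt0 : 0 < delta. Proof. by case/andP: (frame_delta FR). Qed.
Let delta_le1 : delta <= 1. Proof. by case/andP: (frame_delta FR). Qed.
Let Cg_gt0 : 0 < Cg. Proof. exact: lt_le_trans (frame_Cg FR). Qed.
Variable m : R.
Hypothesis mE : m = delta / 8.
Let m_gt0 : 0 < m. Proof. by rewrite mE divr_gt0. Qed.
Let m_le : m <= 1 / 8. Proof. by rewrite mE ler_pM2r ?invr_gt0. Qed.
Let m64 : m / 8 <= 1 / 64. Proof. by move: m_le; lra. Qed.
Let m2 : 2 * m = delta / 4. Proof. by rewrite mE; field. Qed.

Variables f c : R[i] -> R[i].
Hypothesis fd : forall z, cdifferentiable f z.
Hypothesis ffin : (\int[leb2]_p (fock_density phi rho f p)%:E < +oo)%E.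
Hypothesis fc : forall l, L l -> f l = c l.
Let b l := c l / cderiv g l.
Let aa l := cabs (b l) / rho l.
Let LA := coef_summable FR mE fd ffin fc.
Let W0 := fock_density_ge0 FR f.

Definition far z := forall l, L l -> m * rho l <= cabs (z - l).

Lemma far_notin z : far z -> ~ L z.
Proof. by move=> fz /fz; rewrite subrr cabs0 leNgt mulr_gt0. Qed.

(** A finite part carries all but [m * e / 2] of the sum of [aa]. The tail is at most [e / 2]
    uniformly on [far] points, and the finite part decays like [1 / |z|]. *)
Lemma pseries_vanish (e : R) : 0 < e -> exists T : R, forall z, far z -> T <= cabs z ->
  cabs (pseries g c L z) <= e.
Proof.
move=> e0; have me : 0 < m * (e / 2) by rewrite mulr_gt0// divr_gt0.
have aa0 l : L l -> 0 <= aa l by move=> _; rewrite divr_ge0 ?cabs_ge0// ltW.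
have [A hA HA] := sum_le_tail aa0 LA me.
pose B := \sum_(l <- A) cabs (b l); pose N := \sum_(l <- A) cabs l.
have B0 : 0 <= B by apply: sumr_ge0 => l _; exact: cabs_ge0.
pose D := 2 * B / e + 1.
have D0 : 0 < D by rewrite ltr_wpDl// divr_ge0 ?mulr_ge0// ltW.
exists (N + D) => z fz zT.
apply: (@cvsum_le _ L (fun l => b l / (z - l))); last exact: (csumP (pseries_summable FR LA m_gt0 fz)).
have : sum_le (L `\` [set` A]) (fun l => cabs (b l / (z - l))) (m^-1 * (m * (e / 2))).
  apply: (@le_sum_le _ _ _ (fun l => m^-1 * aa l)); last by apply: sum_leZ => //; rewrite invr_ge0 ltW.
  by move=> l [Ll _]; exact: (@pseries_term _ _ _ _ _ _ _ _ _ _ FR c L z m m_gt0 fz).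
rewrite mulKf ?gt_eqF// => /(sum_le_finite_tail hA.1 (fun l => cabs_ge0 (b l / (z - l)))) H.
move=> s hs; rewrite (le_trans (H s hs))// [leRHS]splitr lerD2r.
apply: (@le_trans _ _ (\sum_(l <- A) cabs (b l) * D^-1)); last first.
  rewrite -mulr_suml -/B ler_pdivrMr// /D mulrDr mulr1.
  have -> : e / 2 * (2 * B / e) = B by field; rewrite gt_eqF.
  by rewrite lerDl divr_ge0// ltW.
rewrite big_seq [leRHS]big_seq; apply: ler_sum => l lA.
rewrite cabsM cabsV; apply: ler_wpM2l; first exact: cabs_ge0.
have h : D <= cabs (z - l).
  have h1 : cabs l <= N.
    by rewrite /N (big_rem l)//= lerDl; apply: sumr_ge0 => l' _; exact: cabs_ge0.
  have := cabsB_ge z l; move: zT h1; rewrite -/N.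
  by lra.
by rewrite lef_pV2 ?posrE//; exact: lt_le_trans h.
Qed.

(** The square of half-side [m / 8 * rho z] keeps half of the margin to the lattice, so [f / g] has
    no singularity in it. The constant is [4 * 64 * 8 ^ 2 = 128 ^ 2]. *)
Lemma far_quotient z : far z ->
  cabs (f z / g z) <= 128 ^+ 2 * Cg / m ^+ 3 * fock_mass phi rho f z (m / 8 * rho z).
Proof.
move=> fz; have rz := rho_gt0 z.
have r0 : 0 < m / 8 * rho z by rewrite mulr_gt0// divr_gt0.
have half w l : box z (m / 8 * rho z) w -> L l -> m / 2 * rho l <= cabs (w - l).
  move=> /box_cabs bw Ll; have := fz l Ll; have := rho_lip z l.
  have := cabs_triangle w z l; rewrite (cabsC z w).
  have E1 : 2 * (m / 8 * rho z) = m * rho z / 4 by field.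
  have E2 : m / 2 * rho l = m * rho l / 2 by field.
  rewrite E2; rewrite E1 in bw; move: bw => bw h1 h2 h3.
  have h4 : m * rho z <= m * rho l + m * cabs (z - l) by rewrite -mulrDr ler_wpM2l// ltW.
  have h5 : m * cabs (z - l) <= 1 / 8 * cabs (z - l) by rewrite ler_wpM2r ?cabs_ge0.
  have h6 : 0 < m * rho l by exact: mulr_gt0.
  exact: linear_half bw h3 h1 h4 h5 h6.
have dl w : box z (m / 8 * rho z) w -> m / 16 <= d w.
  move=> bw; have := @frame_far _ _ _ _ _ _ _ _ _ _ FR w (m / 2).
  have -> : 0 <= m / 2 <= 1 by have := m_gt0; have := m_le; move=> ? ?; apply/andP; split; lra.
  by move=> /(_ isT (fun l Ll => half w l bw Ll)); lra.
have rw w : box z (m / 8 * rho z) w -> rho w <= 2 * rho z.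
  move=> /box_cabs bw; have := rho_lip w z.
  have h5 : m * rho z <= 1 / 8 * rho z by rewrite ler_wpM2r// ltW.
  have E1 : 2 * (m / 8 * rho z) = m * rho z / 4 by field.
  by rewrite E1 in bw; move: bw h5 rz; move: (m * rho z) (rho z) (rho w) (cabs (w - z)) => ????; lra.
have kd w : box z (m / 8 * rho z) w -> cdifferentiable (fun w => f w / g w) w.
  move=> bw; apply: cdifferentiable_div => //; last exact: (frame_g FR).
  apply/eqP => /(frame_zeros FR) Lw; have := half w w bw Lw.
  by rewrite subrr cabs0 leNgt mulr_gt0// divr_gt0.
have a0 : 0 <= 64 * Cg / m * rho z ^+ 2 by nneg.
have := @submean_fock _ _ _ _ _ _ _ _ _ _ FR f fd ffin (fun w => f w / g w) z _ _ 0 r0 a0 (lexx 0).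
move=> /(_ (fun w bw _ => kd w bw)) H.
have m16 : 0 < m / 16 by rewrite divr_gt0.
have H1 := cdifferentiable_continuous (kd z (box_center z (ltW r0))).
rewrite (le_trans (H H1 _))//.
  move=> w bw _; rewrite addr0 (le_trans (quotient_bound FR f m16 (dl w bw)))//.
  have -> : 64 * Cg / m * rho z ^+ 2 = Cg / (m / 16) * (2 * rho z) ^+ 2 by field; rewrite gt_eqF.
  rewrite -[leRHS]mulrA; apply: ler_wpM2l; first by rewrite divr_ge0// ltW.
  apply: ler_wpM2r; first exact: W0.
  by rewrite lerXn2r// ?nnegrE ?mulr_ge0 ?(ltW (rho_gt0 _))//; exact: rw.
rewrite mulr0 addr0 le_eqVlt; apply/orP; left; apply/eqP; field.
by rewrite !gt_eqF.
Qed.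

(** [rho] grows at most like [|z|], with slope 1, and [m / 8 <= 1 / 64]; so the small square around
    [z] leaves any fixed square, and the tail of the norm bounds its mass. *)
Lemma quotient_vanish (e : R) : 0 < e -> exists T : R, forall z, far z -> T <= cabs z ->
  cabs (f z / g z) <= e.
Proof.
move=> e0; pose C := 128 ^+ 2 * Cg / m ^+ 3.
have C0 : 0 < C by rewrite divr_gt0 ?mulr_gt0 ?exprn_gt0.
have [n Hn] := plane_integral_tail (fock_density_continuous FR fd) W0 ffin (divr_gt0 e0 C0).
exists (4 * n%:R + rho 0 + 1) => z fz zT; rewrite (le_trans (far_quotient fz))//.
rewrite -/C mulrC -ler_pdivlMr// -lee_fin (fock_massE FR fd ffin).
have ms := @square_measurable R z (m / 8 * rho z).
apply: (Hn _ ms) => p /squareE/box_cabs h1 /squareE/box_cabs; rewrite subr0 => h2.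
have h3 := rho_lip z 0; rewrite subr0 in h3.
have h4 : m / 8 * rho z <= 1 / 64 * rho z.
  by rewrite ler_wpM2r ?(ltW (rho_gt0 z)).
have := cabsB_ge z (toC p); rewrite cabsC.
have n0 : 0 <= n%:R :> R by exact: ler0n.
have r00 := rho_gt0 0.
move=> h5; exact: linear_escape zT h1 h2 h3 h4 n0 r00 h5.
Qed.

Let F z := f z - lagrange g L c z.
Let Fd z : cdifferentiable F z.
Proof. by apply: cdifferentiableB => //; exact: (lagrange_differentiable FR LA). Qed.
Let F0 l : L l -> F l = 0.
Proof. by move=> Ll; rewrite /F (lagrange_interp FR c Ll) (fc Ll) subrr. Qed.
(** At a zero of [g] both [F] and [g] vanish and the zero of [g] is simple, so the ratio of
    derivatives is the limit. *)
Let defect z := if g z == 0 then cderiv F z / cderiv g z else F z / g z.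

Lemma defect_near l w : L l -> cabs (w - l) < delta * rho l -> defect w = zquot F l w / zquot g l w.
Proof.
move=> Ll wl; rewrite /defect /zquot; have [->|nwl] := eqVneq w l.
  by rewrite (_ : g l == 0)//; apply/eqP/(frame_zeros FR).
have nL := frame_notin FR Ll nwl wl.
case: eqVneq => [/(frame_zeros FR)//|gw].
by field; rewrite gw subr_eq0 nwl.
Qed.

Lemma defect_far z : ~ L z -> defect z = f z / g z - pseries g c L z.
Proof.
move=> nL; rewrite /defect; case: eqVneq => [/(frame_zeros FR)//|gz].
by rewrite /F (lagrange_off FR c nL) mulrBl mulrAC mulfV// mul1r.
Qed.

Lemma defect_differentiable z : cdifferentiable defect z.
Proof.
have [Lz|nL] := pselect (L z).
  have gz : g z = 0 by apply/(frame_zeros FR).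
  apply: (@cdifferentiable_near _ (fun w => zquot F z w / zquot g z w) _ _ (delta * rho z)).
  - exact: mulr_gt0.
  - by move=> w wz; rewrite -defect_near.
  - apply: cdifferentiable_div.
    + by rewrite /zquot eqxx (deriv_neq0 FR).
    + by apply: zquot_differentiable => //; exact: F0.
    + by apply: zquot_differentiable => //; exact: (frame_g FR).
have gz0 : 0 < cabs (g z) / 2.
  by rewrite divr_gt0// cabs_gt0; apply/eqP => /(frame_zeros FR).
have [r r0 Hr] := ccontinuous_cabs (cdifferentiable_continuous (frame_g FR z)) gz0.
apply: (@cdifferentiable_near _ (fun w => F w / g w) _ _ r) => //.
  move=> w /Hr; rewrite /defect; case: eqVneq => // ->.
  rewrite cabs0 sub0r normrN ger0_norm ?cabs_ge0// => h; exfalso; move: h gz0.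
  by move: (cabs (g z)) => x; lra.
apply: cdifferentiable_div => //; last exact: (frame_g FR).
by apply/eqP => /(frame_zeros FR).
Qed.

(** Close to a lattice point neither estimate is available. The maximum principle moves the bound to
    the boundary of the square of half-side [m * rho l], which is [far] from the whole lattice and
    still near infinity. *)
Lemma defect_vanish (e : R) : 0 < e -> exists T : R, forall z, T <= cabs z -> cabs (defect z) <= e.
Proof.
move=> e0; have e20 : 0 < e / 2 by rewrite divr_gt0.
have [T1 h1] := pseries_vanish e20; have [T2 h2] := quotient_vanish e20.
have hf z : far z -> `|T1| + `|T2| <= cabs z -> cabs (defect z) <= e.
  move=> fz zT; rewrite (defect_far (far_notin fz)) [leRHS]splitr.
  rewrite (le_trans (cabsB_le _ _))// lerD//.
    by apply: h2 => //; apply: le_trans zT; rewrite (le_trans (ler_norm _))// lerDr.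
  by apply: h1 => //; apply: le_trans zT; rewrite (le_trans (ler_norm _))// lerDl.
exists (4 * (`|T1| + `|T2| + rho 0)) => z zT.
have T0 : 0 <= `|T1| + `|T2| by rewrite addr_ge0.
have r00 := rho_gt0 0.
have [fz|] := pselect (far z).
  by apply: hf => //; exact: linear_near0 zT T0 r00.
move=> /existsNP[l /not_implyP[Ll /negP]]; rewrite -ltNge => zl.
have rl := rho_gt0 l; have ml0 : 0 < m * rho l by rewrite mulr_gt0.
apply: (@max_principle _ defect l (m * rho l)) => //.
- by move=> p _; apply: (@differentiable_regular _ _ _ 1) => // w _; exact: defect_differentiable.
- by move=> p _; apply: cdifferentiable_continuous; exact: defect_differentiable.
- move=> w bw nbw; have [b1 _ _] := lattice_box FR mE Ll bw.
  have b2 : m * rho l <= cabs (w - l).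
    rewrite leNgt; apply/negP => h; apply: nbw.
    by split; rewrite (le_lt_trans _ h)// ?ler_Re_cabs ?ler_Im_cabs.
  apply: hf.
    move=> l' Ll'; have [<-//|ll'] := eqVneq l l'.
    have [_ _ h] := frame_other FR Ll Ll' (elimN eqP ll') b1.
    rewrite (le_trans _ h)// ler_wpM2r ?(ltW (rho_gt0 l'))//; move: m2 delta_gt0.
    by move: m delta => ??; lra.
  have b3 := box_cabs bw; have h3 := rho_lip l z; have h4 := rho_lip z 0.
  rewrite subr0 in h4; rewrite cabsC in h3.
  have h5 : m * rho l <= 1 / 8 * rho l by rewrite ler_wpM2r// ltW.
  have h6 := cabs_triangle l z w; rewrite (cabsC l w) in h6.
  have h7 := cabsB_ge z w.
  exact: linear_near zT T0 zl r00 rl b3 h3 h4 h5 h6 h7.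
- by apply: cabs_box; exact: ltW.
Qed.

(** Liouville's argument: the maximum principle on ever larger squares forces the entire function
    [defect], which vanishes at infinity, to be zero. *)
Lemma lagrange_representation w : ~ L w -> f w = g w * pseries g c L w.
Proof.
move=> nL; have gw : g w != 0 by apply/eqP => /(frame_zeros FR).
suff Hw : defect w = 0.
  by apply/eqP; rewrite -(inj_eq (mulIf (invr_neq0 gw))) [g w * _]mulrC mulfK// -subr_eq0 -defect_far// Hw.
apply/eqP; rewrite -cabs_eq0 eq_le cabs_ge0 andbT; apply/ler_addgt0Pr => e e0.
rewrite add0r; have [T HT] := defect_vanish e0.
pose r := `|T| + cabs w + 1.
have r0 : 0 < r by rewrite ltr_wpDl// addr_ge0// cabs_ge0.
apply: (@max_principle _ defect 0 r) => //.
- by move=> p _; apply: (@differentiable_regular _ _ _ 1) => // x _; exact: defect_differentiable.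
- by move=> p _; apply: cdifferentiable_continuous; exact: defect_differentiable.
- move=> p bp nbp; apply: HT.
  have b2 : r <= cabs (p - 0).
    rewrite leNgt; apply/negP => h; apply: nbp.
    by split; rewrite (le_lt_trans _ h)// ?ler_Re_cabs ?ler_Im_cabs.
  rewrite subr0 in b2; apply: le_trans b2.
  by rewrite (le_trans (ler_norm _))// /r -addrA lerDl addr_ge0// cabs_ge0.
- by apply: cabs_box; rewrite subr0 /r addrAC lerDr addr_ge0.
Qed.

End Uniqueness.

(** * Packing of a separated set *)

(** One finite list [U] approximates the totals of the finitely many columns of [s] up to [e / n]
    each, and over [U] and [s] the two finite sums commute. *)
Lemma sum_le_exchange (R : realType) (S : set R[i]) (y : R[i] -> R[i] -> R) (x : R[i] -> R) C :
  (forall l l', 0 <= y l l') -> (forall l, S l -> sum_le S (y l) (x l)) -> sum_le S x C ->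
  exists2 T : R[i] -> R, forall l', S l' -> sum_le S (fun l => y l l') (T l') & sum_le S T C.
Proof.
move=> y0 yx xC.
have col l' : S l' -> sum_le S (fun l => y l l') C.
  by move=> Sl'; apply: le_sum_le xC => l Sl; exact: (sum_term (yx l Sl)).
have [T HT] : {T : R[i] -> R & forall l', S l' -> sum_le S (fun l => y l l') (T l') /\
    forall e : R, 0 < e -> exists2 A, finite_part S A & T l' - e <= \sum_(l <- A) y l l'}.
  apply: (@choice _ _ (fun l' t => S l' -> sum_le S (fun l => y l l') t /\
    forall e : R, 0 < e -> exists2 A, finite_part S A & t - e <= \sum_(l <- A) y l l')) => l'.
  have [Sl'|nS] := pselect (S l'); last by exists 0.
  by have [t Ht] := nonneg_sum_limit (fun l _ => y0 l l') (col _ Sl'); exists t.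
exists T => [l' /HT[]//|s hs].
apply/ler_addgt0Pr => e e0; pose n := (size s)%:R + 1 : R.
have n0 : 0 < n by rewrite ltr_wpDl.
have [U [hU HU]] : exists U, finite_part S U /\
    forall l', l' \in s -> T l' - e / n <= \sum_(l <- U) y l l'.
  have := hs.2; elim: (s) => [_|l' s' IH sS].
    by exists [::]; split=> // ; split.
  have [|U [hU HU]] := IH; first by move=> l ls; apply: sS; rewrite inE ls orbT.
  have [A hA HA] := (HT l' (sS l' (mem_head _ _))).2 _ (divr_gt0 e0 n0).
  have [hUA UA AU] := finite_partU hU hA; exists (undup (U ++ A)); split=> // l.
  have mono B : finite_part S B -> {subset B <= undup (U ++ A)} ->
      \sum_(l0 <- B) y l0 l <= \sum_(l0 <- undup (U ++ A)) y l0 l.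
    by move=> hB BU; apply: ler_sum_subset => //; [exact: hUA.1|exact: hB.1].
  rewrite inE => /predU1P[->|/HU h].
    by apply: le_trans HA _; apply: ler_sum_subset => //; [exact: hUA.1|exact: hA.1].
  exact: le_trans h (mono _ hU UA).
have h1 : \sum_(l' <- s) T l' <= \sum_(l' <- s) (\sum_(l <- U) y l l' + e / n).
  by rewrite big_seq [leRHS]big_seq; apply: ler_sum => l' /HU; rewrite lerBlDr.
rewrite (le_trans h1)// big_split/= exchange_big /= lerD//.
  apply: le_trans (xC U hU); rewrite big_seq [leRHS]big_seq; apply: ler_sum => l lU.
  exact: (yx l (hU.2 l lU)) s hs.
rewrite big_const_seq count_predT iter_addr addr0 -mulr_natl mulrA ler_pdivrMr//.
by rewrite mulrC ler_wpM2l ?(ltW e0)// /n lerDl.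
Qed.

Section Packing.
Variables (R : realType) (phi rho d : R[i] -> R) (g : R[i] -> R[i]) (L : set R[i]).
Variables (delta M K Cg : R).
Hypothesis FR : multiplier_frame phi rho d g L delta M K Cg.
Implicit Types (z w l : R[i]) (S : set R[i]).

Let rho_gt0 := frame_rho_gt0 FR.
Let rho_lip := frame_rho_lip FR.
Let delta_gt0 : 0 < delta. Proof. by case/andP: (frame_delta FR). Qed.
Let delta_le1 : delta <= 1. Proof. by case/andP: (frame_delta FR). Qed.
Variable m : R.
Hypothesis mE : m = delta / 8.
Let m_gt0 : 0 < m. Proof. by rewrite mE divr_gt0. Qed.
Let m_le : m <= 1 / 8. Proof. by rewrite mE ler_pM2r ?invr_gt0. Qed.
Let m2 : 2 * m = delta / 4. Proof. by rewrite mE; field. Qed.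

(** The disjoint squares around the lattice points lie in one box, so their areas add up to at most
    its area. *)
Lemma packing s w (r : R) : 0 < r -> finite_part L s ->
  (forall l p, l \in s -> box l (m * rho l) p -> box w r p) ->
  \sum_(l <- s) rho l ^+ 2 <= r ^+ 2 / m ^+ 2.
Proof.
move=> r0 [us sL] sw.
have c1 : continuous (fun _ : R * R => 1 : R) by move=> p; exact: cvg_cst.
have := @disjoint_squares_le R (fun=> 1) c1 (fun=> ler01) s (fun l => m * rho l) (square w r)
  (square_measurable w r) us.
rewrite (square_integral_cst w r0 ler01).
rewrite (eq_bigr (fun l => ((2 * (m * rho l)) ^+ 2)%:E)); last first.
  by move=> l _; rewrite /sqint square_integral_cst ?mul1r ?mulr_gt0.
rewrite sumEFin lee_fin mul1r => H.
have {}H : \sum_(l <- s) (2 * (m * rho l)) ^+ 2 <= (2 * r) ^+ 2.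
  apply: H => [l ls p /squareE/(sw _ _ ls)/squareE//|l l' /sL Ll /sL Ll' ll'].
  exact: (lattice_squares_disjoint FR mE Ll Ll').
rewrite ler_pdivlMr ?exprn_gt0// mulr_suml -(ler_pM2l (_ : 0 < 4))//.
rewrite mulr_sumr (_ : 4 * r ^+ 2 = (2 * r) ^+ 2); last by ring.
by apply: le_trans H; apply: ler_sum => l _; rewrite le_eqVlt; apply/orP; left; apply/eqP; ring.
Qed.

(** [rho] has a positive minimum on a compact square, so [packing] bounds the number of lattice
    points there. *)
Lemma lattice_locally_finite (r : R) :
  exists2 A, finite_part L A & forall l, L l -> cabs l <= r -> l \in A.
Proof.
pose q := `|r| + 1; have q0 : 0 < q by rewrite ltr_wpDl.
have [c _ cmin] : exists2 c, c \in square (0 : R[i]) q & forall t, t \in square (0 : R[i]) q ->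
    rho (toC c) <= rho (toC t).
  apply: (@compact_EVT_min _ R (fun x : R * R => rho (toC x))) => //.
  - exists (0, 0); apply/squareE; rewrite /toC /=; exact: box_center (ltW q0).
  - exact: square_compact.
  - apply: continuous_in_subspaceT => x _; exact: (real_ccontinuous (rho_ccontinuous FR)).
pose e := rho (toC c); have e0 : 0 < e by exact: rho_gt0.
have lower l : cabs l <= r -> e <= rho l.
  move=> lr; have -> : l = toC (complex.Re l, complex.Im l) by case: l {lr}.
  apply: cmin; apply/mem_set/squareE; rewrite /toC /=.
  have -> : complex.Re l +i* complex.Im l = l by case: (l).
  apply: cabs_box; rewrite subr0 (le_trans lr)// (le_trans (ler_norm _))// lerDl//.
pose Q := q + (rho 0 + q).
have Q0 : 0 < Q by rewrite addr_gt0// addr_gt0.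
pose B := Q ^+ 2 / m ^+ 2 / e ^+ 2.
have [|A hA HA] := @bounded_size_finite R (L `&` [set l | cabs l <= r]) (Num.trunc B).+1.
  move=> s [us sS]; rewrite -(ler_nat R).
  have h : (size s)%:R * e ^+ 2 <= Q ^+ 2 / m ^+ 2.
    have sL : finite_part L s by split=> // l /sS[].
    apply: (@le_trans _ _ (\sum_(l <- s) rho l ^+ 2)); last first.
      apply: (@packing s 0 Q Q0 sL) => l p ls bp; have [Ll /= lr] := sS l ls.
      apply: cabs_box; rewrite subr0 (_ : p = (p - l) + l); last by rewrite subrK.
      rewrite (le_trans (cabsD _ _))// /Q addrC lerD//.
        by rewrite (le_trans lr)// (le_trans (ler_norm _))// lerDl.
      have [h1 _ _] := lattice_box FR mE Ll bp; have := rho_lip l 0; rewrite subr0 => h2.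
      rewrite (le_trans h1)// (@le_trans _ _ (rho l))//.
        by rewrite ler_piMl ?(ltW (rho_gt0 l))// ler_pdivrMr// mul1r (le_trans delta_le1)// ler1n.
      by rewrite (le_trans h2)// lerD2l (le_trans lr)// (le_trans (ler_norm _))// lerDl.
    have -> : (size s)%:R * e ^+ 2 = \sum_(l <- s) e ^+ 2.
      by rewrite big_const_seq count_predT iter_addr addr0 mulr_natl.
    rewrite big_seq [leRHS]big_seq; apply: ler_sum => l /sS[_ /= /lower h].
    by rewrite lerXn2r// nnegrE ?ltW.
  rewrite -ler_pdivlMr ?exprn_gt0// -/B in h.
  by rewrite (le_trans h)// ltW// truncnS_gt.
exists A; first by split; [exact: hA.1|move=> l /hA.2[]].
by move=> l Ll lr; apply: HA.
Qed.

(* Dyadic shells: at distance about [2 ^ n * a] from [l] the squares around the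
   points of [L] have total area of order [(2 ^ n * a) ^ 2]. *)
Lemma schur_sum l : L l ->
  sum_le (L `\ l) (fun l' => rho l' ^+ 2 / cabs (l - l') ^+ 3) (32 / (m ^+ 2 * delta) / rho l).
Proof.
move=> Ll s hs; pose a := delta * rho l; have a0 : 0 < a by rewrite mulr_gt0.
have sep l' : l' \in s -> [/\ L l', a <= cabs (l - l') & delta * rho l' <= cabs (l - l')].
  by move=> /hs.2[Ll' /= /eqP]; rewrite eq_sym => /eqP ll'; have [] := frame_sep FR Ll Ll' ll'.
pose B := 32 / (m ^+ 2 * a).
have BE : 32 / (m ^+ 2 * delta) / rho l = B.
  by rewrite /B /a; field; rewrite !gt_eqF.
(* The shell between [q = 2 ^ n * a] and [2 q] contributes at most [(4 q) ^ 2 / m ^ 2 / q ^ 3 = B /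
   2 * 2 ^ -n], so the bound telescopes. The radius [4 q] leaves room for the squares around points
   within [2 q]. *)
have shell n : \sum_(l' <- s | cabs (l - l') < 2 ^+ n * a) rho l' ^+ 2 / cabs (l - l') ^+ 3 <=
    B * (1 - 2 ^- n).
  elim: n => [|n IH].
    rewrite expr0 invr1 subrr mulr0 mul1r big_seq_cond big1// => l' /andP[/sep[_ h _]].
    by rewrite ltNge h.
  pose q := 2 ^+ n * a; have q0 : 0 < q by rewrite mulr_gt0// exprn_gt0.
  have qS : 2 ^+ n.+1 * a = 2 * q by rewrite /q exprS mulrA.
  rewrite qS (bigID (fun l' => cabs (l - l') < q))/=.
  have -> : B * (1 - 2 ^- n.+1) = B * (1 - 2 ^- n) + B / 2 * 2 ^- n.
    by rewrite exprS; field; rewrite ?gt_eqF ?exprn_gt0.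
  apply: lerD.
    apply: le_trans IH; rewrite le_eqVlt; apply/orP; left; apply/eqP; apply: eq_bigl => l'.
    case: (ltP (cabs (l - l')) q) => h; rewrite ?andbT ?andbF//.
    by rewrite (lt_trans h)// ltr_pMl// ltr1n.
  apply: (@le_trans _ _ (\sum_(l' <- s | cabs (l - l') < 2 * q) rho l' ^+ 2 / q ^+ 3)).
    rewrite [leRHS](bigID (fun l' => cabs (l - l') < q))/= -[leLHS]add0r.
    apply: lerD; first by apply: sumr_ge0 => l' _; rewrite divr_ge0 ?exprn_ge0 ?ltW.
    apply: ler_sum => l' /andP[_]; rewrite -leNgt => h.
    apply: ler_wpM2l; first by rewrite exprn_ge0 ?ltW.
    have c0 : 0 < cabs (l - l') by exact: lt_le_trans h.
    by rewrite lef_pV2 ?posrE; [apply: lerXn2r => //; rewrite nnegrE ltW|exact: exprn_gt0..].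
  rewrite -mulr_suml -big_filter.
  have q4 : 0 < 4 * q by rewrite mulr_gt0.
  have fs : finite_part L [seq l' <- s | cabs (l - l') < 2 * q].
    split; first by rewrite filter_uniq ?hs.1.
    by move=> l'; rewrite mem_filter => /andP[_ /sep[]].
  rewrite ler_pdivrMr ?exprn_gt0// (le_trans (@packing _ l (4 * q) q4 fs _))//.
    move=> l' p; rewrite mem_filter => /andP[h /sep[Ll' _ h']] bp.
    have [h1 _ _] := lattice_box FR mE Ll' bp; apply: cabs_box.
    have h2 := cabs_triangle l' p l; rewrite (cabsC l' l) in h2.
    have h3 : delta / 4 * rho l' <= cabs (l - l') / 4.
      by rewrite mulrAC ler_pM2r ?invr_gt0.
    by move: h h1 h2 h3; move: (delta / 4 * rho l') (cabs (l - l')) (cabs (p - l')) (cabs (p - l)) => *; lra.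
  rewrite /B /q; have t0 : 2 ^+ n != 0 :> R by rewrite gt_eqF ?exprn_gt0.
  rewrite le_eqVlt; apply/orP; left; apply/eqP; field.
  by rewrite t0 !gt_eqF.
have [N HN] : exists N : nat, forall l', l' \in s -> cabs (l - l') < 2 ^+ N * a.
  pose t := \sum_(l' <- s) cabs (l - l') / a.
  exists (Num.trunc t).+1 => l' l's; rewrite -ltr_pdivrMr//.
  have h : cabs (l - l') / a <= t.
    rewrite /t (big_rem l')//= lerDl; apply: sumr_ge0 => x _.
    by rewrite divr_ge0 ?cabs_ge0 ?ltW.
  rewrite (le_lt_trans h)// (lt_trans (truncnS_gt t))// -natrX ltr_nat.
  exact: ltn_expl.
rewrite BE (le_trans _ (le_trans (shell N) _))//.
  rewrite big_seq [leRHS]big_seq_cond le_eqVlt; apply/orP; left; apply/eqP.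
  by apply: eq_bigl => l'; case: (boolP (l' \in s)) => //= /HN ->.
rewrite ler_piMr//; first by rewrite /B divr_ge0// mulr_ge0 ?exprn_ge0 ?ltW.
Qed.

End Packing.

(** * Sufficiency *)

Section Sufficiency.
Variables (R : realType) (phi rho d : R[i] -> R) (g : R[i] -> R[i]) (L : set R[i]).
Variables (delta M K Cg : R).
Hypothesis FR : multiplier_frame phi rho d g L delta M K Cg.
Implicit Types (z w l : R[i]) (S : set R[i]).

Let rho_gt0 := frame_rho_gt0 FR.
Let rho_lip := frame_rho_lip FR.
Let delta_gt0 : 0 < delta. Proof. by case/andP: (frame_delta FR). Qed.
Let M_gt0 : 0 < M. Proof. exact: lt_le_trans (frame_M FR). Qed.
Let K_gt0 : 0 < K. Proof. exact: lt_le_trans (frame_K FR). Qed.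
Let Cg_gt0 : 0 < Cg. Proof. exact: lt_le_trans (frame_Cg FR). Qed.

Variables (c : R[i] -> R[i]) (A A1 A2 : R).
Let b l := c l / cderiv g l.
Let aa l := cabs (b l) / rho l.
Let S1 l' := pseries g c (L `\ l') l'.
Let S2 l' := csum (L `\ l') (fun l => b l / (l' - l) ^+ 2).
Hypotheses (LA : sum_le L aa A) (LA1 : sum_le L (fun l' => cabs (S1 l')) A1).
Hypothesis LA2 : sum_le L (fun l' => rho l' * cabs (S2 l')) A2.
Let aa_ge0 l : 0 <= aa l.
Proof. by rewrite divr_ge0 ?cabs_ge0 ?(ltW (rho_gt0 l)). Qed.

(** The second-order remainder caused in the cell of [l'] by the pole [l], up to constants. The
    diagonal is [0] because the pole [l'] is treated separately. *)
Let y l l' := if l == l' then 0 else rho l' ^+ 2 * cabs (b l) / cabs (l - l') ^+ 3.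
Let y_ge0 l l' : 0 <= y l l'.
Proof. by rewrite /y; case: eqP => // _; rewrite divr_ge0 ?mulr_ge0 ?exprn_ge0 ?cabs_ge0 ?(ltW (rho_gt0 l')). Qed.

(** Row sums are at most [C * aa l] by the Schur bound; the exchange of sums makes the column sums
    [T] summable. *)
Lemma remainder_sums : exists T : R[i] -> R,
  (forall l', L l' -> sum_le L (fun l => y l l') (T l')) /\ exists A3, sum_le L T A3.
Proof.
pose C := 32 / ((delta / 8) ^+ 2 * delta).
have C0 : 0 <= C by rewrite divr_ge0// mulr_ge0 ?exprn_ge0 ?divr_ge0 ?(ltW delta_gt0).
have yx l : L l -> sum_le L (y l) (C * aa l).
  move=> Ll s [us sL]; have rl0 := rho_gt0 l.
  have hs : finite_part (L `\ l) (rem l s).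
    split; first exact: rem_uniq.
    move=> l'; rewrite mem_rem_uniq// inE => /andP[/= /eqP ll' /sL Ll'].
    by split.
  have h := schur_sum FR erefl Ll hs.
  have -> : \sum_(l' <- s) y l l' = \sum_(l' <- rem l s) y l l'.
    have [ls|nls] := boolP (l \in s); last by rewrite rem_id.
    by rewrite (big_rem l)//= {1}/y eqxx add0r.
  have -> : \sum_(l' <- rem l s) y l l' = cabs (b l) * \sum_(l' <- rem l s) rho l' ^+ 2 / cabs (l - l') ^+ 3.
    rewrite mulr_sumr big_seq [RHS]big_seq; apply: eq_bigr => l' /hs.2[_ /= /eqP].
    by rewrite eq_sym /y => /negPf ->; rewrite [rho l' ^+ 2 * _]mulrC mulrA.
  by rewrite /aa mulrCA; apply: ler_wpM2l; [exact: cabs_ge0|exact: h].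
have [T h1 h2] := sum_le_exchange y_ge0 yx (sum_leZ C0 LA).
by exists T; split=> //; exists (C * A).
Qed.

Section Cell.
Variables (T : R[i] -> R) (z l' : R[i]).
Hypotheses (HT : sum_le L (fun l => y l l') (T l')) (Ll' : L l') (nL : ~ L z).
Hypotheses (zK : cabs (z - l') <= K * rho z) (zK' : cabs (z - l') <= K * rho l').
Let dz : 0 <= d z <= M. Proof. exact: (frame_d FR). Qed.

Let off : 0 < d z / (2 * M).
Proof. by rewrite divr_gt0 ?mulr_gt0// (frame_d_gt0 FR). Qed.

Let offL l : L l -> d z / (2 * M) * rho l <= cabs (z - l).
Proof.
by move=> Ll; rewrite mulrAC ler_pdivrMr ?mulr_gt0// [leRHS]mulrC; exact: (frame_near_le FR).
Qed.

(** If [|z - l| >= rho z / 2], then [|l - l'| <= 3 K |z - l|] and [d z <= M] suffices. Otherwise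
    [|l - l'|] is at most of order [rho l], and [d z * rho l <= 2 M |z - l|]: the smallness of [d z]
    near [l] makes up for the pole. *)
Lemma distance_ratio l : L l -> l <> l' -> d z * cabs (l - l') <= 8 * K * M * cabs (z - l).
Proof.
move=> Ll ll'; have /andP[d0 dM] := dz; have K1 := frame_K FR.
have z0 : 0 < cabs (z - l) by rewrite cabs_gt0 subr_eq0; apply/eqP => E; apply: nL; rewrite E.
have h1 := cabs_triangle z l l'; rewrite (cabsC l z) in h1.
have h2 := rho_lip z l; have rz := rho_gt0 z.
have [far|near] := leP (rho z / 2) (cabs (z - l)).
  have h3 : cabs (l - l') <= 3 * K * cabs (z - l).
    have : K * rho z <= K * (2 * cabs (z - l)).
      by apply: ler_wpM2l; [exact: ltW|rewrite mulrC -ler_pdivrMr].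
    have : cabs (z - l) <= K * cabs (z - l) by rewrite ler_peMl ?cabs_ge0.
    by move: (K * rho z) (K * cabs (z - l)) zK h1 (mulrCA K 2 (cabs (z - l))) (mulrA 3 K (cabs (z - l))) => u v ??-><-; lra.
  apply: (@le_trans _ _ (M * (3 * K * cabs (z - l)))); first by apply: ler_pM => //; exact: cabs_ge0.
  rewrite (_ : 8 * K * M * _ = M * (3 * K * cabs (z - l)) + M * (5 * K * cabs (z - l))); last by ring.
  by rewrite lerDl; nneg.
have rl : rho z <= 2 * rho l by lra.
have h3 : cabs (l - l') <= 3 * K * rho l.
  have : K * rho z <= K * (2 * rho l) by apply: ler_wpM2l => //; exact: ltW.
  have : rho l <= K * rho l by rewrite ler_peMl ?(ltW (rho_gt0 l)).
  have : cabs (z - l) <= rho l by lra.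
  by move: (K * rho z) (K * rho l) zK h1 (mulrCA K 2 (rho l)) (mulrA 3 K (rho l)) => u v ??-><-; lra.
apply: (@le_trans _ _ (d z * (3 * K * rho l))); first by apply: ler_wpM2l.
rewrite (_ : d z * _ = 3 * K * (d z * rho l)); last by ring.
apply: (@le_trans _ _ (3 * K * (2 * M * cabs (z - l)))).
  by apply: ler_wpM2l; [nneg|exact: (frame_near_le FR)].
rewrite (_ : 8 * K * M * _ = 3 * K * (2 * M * cabs (z - l)) + 2 * K * M * cabs (z - l)); last by ring.
by rewrite lerDl; nneg.
Qed.

Let h := z - l'.
Let a1 := pseries g c (L `\ l') z.

(* [1 / (w + h) = 1 / w - h / w ^ 2 + h ^ 2 / (w ^ 2 (w + h))] with [w = l' - l]. *)
Lemma expansion_bound :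
  d z * cabs (a1 - (S1 l' - h * S2 l')) <= 8 * K ^+ 3 * M * T l'.
Proof.
have /andP[d0 dM] := dz.
have LAl : sum_le (L `\ l') aa A by apply: sum_leS LA => l [].
have R1 : cvsum (L `\ l') (fun l => b l / (z - l)) a1.
  apply: (csumP (pseries_summable FR LAl off _)) => l [Ll _]; exact: offL.
have sep l : (L `\ l') l -> delta * rho l <= cabs (l' - l).
  by move=> [Ll /= /eqP]; rewrite eq_sym => /eqP ll'; have [] := frame_sep FR Ll' Ll ll'.
have R2 : cvsum (L `\ l') (fun l => b l / (l' - l)) (S1 l').
  exact: (csumP (pseries_summable FR LAl delta_gt0 sep)).
have R3 : cvsum (L `\ l') (fun l => b l / (l' - l) ^+ 2) (S2 l').
  exact: (csumP (pseries2_summable FR LAl delta_gt0 sep)).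
have := cvsumZ ((d z)%:C) (cvsumD R1 (cvsumD (cvsumZ (-1) R2) (cvsumZ h R3))).
set t := (t in cvsum _ _ t) => Rt.
have -> : d z * cabs (a1 - (S1 l' - h * S2 l')) = cabs t.
  rewrite /t cabsM cabs_real ger0_norm//; congr (_ * cabs _).
  by rewrite mulN1r opprD opprK addrA.
apply: cvsum_le Rt.
have : sum_le (L `\ l') (fun l => y l l') (T l') by apply: sum_leS HT => l [].
have C0 : 0 <= 8 * K ^+ 3 * M by nneg.
move=> /(sum_leZ C0); apply: le_sum_le => l [Ll /= ll'].
have n1 : z - l != 0 by rewrite subr_eq0; apply/eqP => E; apply: nL; rewrite E.
have n2 : l' - l != 0 by rewrite subr_eq0; apply/eqP => E; apply: ll'.
rewrite (_ : _ * _ = (d z)%:C * (h ^+ 2 * b l / ((z - l) * (l' - l) ^+ 2))); last first.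
  by rewrite /h; field; rewrite n1 n2.
rewrite (cabsM (d z)%:C) cabs_real (ger0_norm d0) (cabsM (h ^+ 2 * b l)) (cabsM (h ^+ 2)) cabsV (cabsM (z - l)) !cabsX.
rewrite /y (negbTE (introN eqP ll')) (cabsC l l').
have H := distance_ratio Ll ll'; rewrite (cabsC l l') in H.
have z0 : 0 < cabs (z - l) by rewrite cabs_gt0.
have l0 : 0 < cabs (l' - l) by rewrite cabs_gt0.
have h2 : cabs h ^+ 2 <= (K * rho l') ^+ 2.
  apply: lerXn2r; rewrite ?nnegrE ?cabs_ge0//.
  by rewrite mulr_ge0 ?(ltW K_gt0) ?(ltW (rho_gt0 l')).
have hh0 : 0 <= cabs h ^+ 2 by rewrite exprn_ge0 ?cabs_ge0.
move: (cabs (z - l)) (cabs (l' - l)) (cabs (b l)) (cabs_ge0 (b l)) (cabs h ^+ 2) z0 l0 H h2 hh0 => u v q q0 hh u0 v0 H h2 hh0.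
rewrite (_ : d z * _ = d z * v * (hh * q / (u * v ^+ 3))); last by field; rewrite !gt_eqF.
apply: (@le_trans _ _ (8 * K * M * u * ((K * rho l') ^+ 2 * q / (u * v ^+ 3)))).
  have iv : 0 <= (u * v ^+ 3)^-1 by rewrite invr_ge0 mulr_ge0 ?exprn_ge0 ?ltW.
  apply: ler_pM => //; first by rewrite mulr_ge0// ltW.
    by rewrite !mulr_ge0.
  by apply: ler_wpM2r => //; apply: ler_wpM2r.
rewrite le_eqVlt; apply/orP; left; apply/eqP; field.
by rewrite !gt_eqF.
Qed.

(** [|g| e^(- phi)] is at most [Cg * d z]. The pole [l'] uses [d z * rho l' <= 2 M |z - l'|], the
    two expansion terms use [d z <= M] and [|h| <= K rho l'], the remainder [expansion_bound]. *)
Lemma cell_bound : cabs (lagrange g L c z) * expR (- phi z) <=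
  Cg * (2 * M * aa l' + M * cabs (S1 l') + K * M * (rho l' * cabs (S2 l')) + 8 * K ^+ 3 * M * T l').
Proof.
have /andP[d0 dM] := dz.
have lz : z - l' != 0 by rewrite subr_eq0; apply/eqP => E; apply: nL; rewrite E.
rewrite (lagrange_off FR c nL) cabsM expRN ler_pdivrMr ?expR_gt0//.
rewrite mulrC.
set s := _ + _ + _ + _.
suff h1 : d z * cabs (pseries g c L z) <= s.
  apply: (@le_trans _ _ (cabs (pseries g c L z) * (Cg * expR (phi z) * d z))).
    by apply: ler_wpM2l; [exact: cabs_ge0|exact: (frame_upper FR)].
  rewrite (_ : _ * (_ * d z) = Cg * expR (phi z) * (d z * cabs (pseries g c L z))); last by ring.
  rewrite [leRHS]mulrAC; apply: ler_wpM2l => //.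
  by rewrite mulr_ge0 ?expR_ge0// ltW.
rewrite (pseries_split FR LA Ll' nL) -/a1.
have -> : b l' / (z - l') + a1 = b l' / (z - l') + S1 l' + - (h * S2 l') + (a1 - (S1 l' - h * S2 l')) by ring.
apply: (@le_trans _ _ (d z * (cabs (b l' / (z - l')) + cabs (S1 l') + cabs (h * S2 l') + cabs (a1 - (S1 l' - h * S2 l'))))).
  apply: ler_wpM2l => //; rewrite (le_trans (cabsD _ _))// lerD2r.
  rewrite (le_trans (cabsD _ _))// cabsN lerD2r.
  exact: cabsD.
rewrite !mulrDr; apply: lerD; last exact: expansion_bound.
apply: lerD; first apply: lerD.
- rewrite cabsM cabsV mulrA ler_pdivrMr ?cabs_gt0//.
  rewrite (_ : cabs (b l') = aa l' * rho l'); last by rewrite /aa mulfVK// gt_eqF.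
  rewrite (_ : d z * _ = aa l' * (d z * rho l')); last by ring.
  rewrite (_ : 2 * M * _ * _ = aa l' * (2 * M * cabs (z - l'))); last by ring.
  by apply: ler_wpM2l; [exact: aa_ge0|exact: (frame_near_le FR)].
- by apply: ler_wpM2r => //; exact: cabs_ge0.
- rewrite cabsM (_ : K * M * _ = M * (K * rho l') * cabs (S2 l')); last by ring.
  by rewrite mulrA; apply: ler_wpM2r; [exact: cabs_ge0|apply: ler_pM => //; exact: cabs_ge0].
Qed.

End Cell.

Lemma lagrange_fock : (\int[leb2]_p (fock_density phi rho (lagrange g L c) p)%:E < +oo)%E.
Proof.
have [T [HT [A3 LA3]]] := remainder_sums.
pose C2 := 8 * expR 1 * Cg.
have C20 : 0 < C2 by rewrite !mulr_gt0 ?expR_gt0.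
pose sig l := 2 * M * aa l + M * cabs (S1 l) + K * M * (rho l * cabs (S2 l)) + 8 * K ^+ 3 * M * T l.
have T0 l : L l -> 0 <= T l by move=> Ll; exact: (sum_le_ge0 (HT l Ll)).
have sig0 l : L l -> 0 <= sig l.
  move=> /T0 Tl; have rl := rho_gt0 l; have al := aa_ge0 l; rewrite /sig; nneg.
(* The first summand serves the lattice points themselves, where [lagrange] equals [c]; the second
   serves the rest of the cell. *)
pose tau l := C2 * aa l + Cg * sig l.
have tau0 l : L l -> 0 <= tau l.
  by move=> /sig0 sl; have al := aa_ge0 l; rewrite /tau; nneg.
have [B HB] : exists B, sum_le L (fun l => `|tau l|) B.
  have p1 : 0 <= C2 by nneg.
  have p2 : 0 <= Cg by nneg.
  have p3 : 0 <= 2 * M by nneg.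
  have p4 : 0 <= M by nneg.
  have p5 : 0 <= K * M by nneg.
  have p6 : 0 <= 8 * K ^+ 3 * M by nneg.
  eexists; apply: (@le_sum_le _ _ _ tau) => [l Ll|]; first by rewrite ger0_norm ?tau0.
  exact: (sum_leD (sum_leZ p1 LA) (sum_leZ p2 (sum_leD (sum_leD (sum_leD (sum_leZ p3 LA) (sum_leZ p4 LA1)) (sum_leZ p5 LA2)) (sum_leZ p6 LA3)))).
(* On the cell [rho l <= (1 + K) rho z], which replaces [rho z] by [rho l]. The absolute value keeps
   [k] nonnegative off [L] as well, as the covering lemma requires. *)
pose k l := (1 + K) ^+ 2 * `|tau l| / rho l ^+ 2.
have k0 l : 0 <= k l by rewrite /k; have tl := normr_ge0 (tau l); have rl := rho_gt0 l; nneg.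
pose W := fock_density phi rho (lagrange g L c).
have Wc : continuous W by exact: (fock_density_continuous FR (lagrange_differentiable FR LA)).
have W0 := fock_density_ge0 FR (lagrange g L c).
have pt z : exists l, [/\ L l, cabs (z - l) <= K * rho z, cabs (z - l) <= K * rho l &
    cabs (lagrange g L c z) * expR (- phi z) <= `|tau l|].
  have [Lz|nL] := pselect (L z).
    exists z; rewrite subrr cabs0; split=> //; try by rewrite mulr_ge0 ?(ltW K_gt0) ?(ltW (rho_gt0 _)).
    rewrite (lagrange_interp FR c Lz) ger0_norm ?tau0//.
    have [h _] := coef_equiv FR c Lz; rewrite (le_trans h)// /tau -/C2 lerDl.
    by rewrite mulr_ge0 ?(ltW Cg_gt0) ?sig0.
  have [l [Ll h1 h2]] := frame_cover FR z; exists l; split=> //.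
  rewrite (le_trans (cell_bound (HT l Ll) Ll nL h1 h2))// ger0_norm ?tau0// /tau /sig lerDr.
  by rewrite mulr_ge0 ?(ltW C20).
apply: (@le_lt_trans _ _ ((1 + K) ^+ 2 * (2 * K) ^+ 2 * B)%:E); last exact: ltry.
apply: (plane_integral_le Wc W0) => n.
(* A point of the square of half-side [n] has modulus at most [2 n], and the centre of its cell is
   within [K rho z <= K (rho 0 + 2 n)] of it. *)
have [S hS HS] := lattice_locally_finite FR erefl (2 * n%:R + K * (rho 0 + 2 * n%:R)).
apply: le_trans (@plane_integral_cover _ W Wc W0 S (fun l => K * rho l) k _ _ _ k0 _) _.
- exact: square_measurable.
- by move=> l; rewrite mulr_gt0.
- move=> p /squareE/box_cabs; rewrite subr0 => pn.
  have [l [Ll h1 h2 h3]] := pt (toC p); exists l; split.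
  + apply: HS => //; have := rho_lip (toC p) 0; rewrite subr0 => h4.
    rewrite -[l](subKr (toC p)) (le_trans (cabsB_le _ _))// lerD//.
    by rewrite (le_trans h1)// ler_wpM2l ?(ltW K_gt0)// (le_trans h4)// lerD2l.
  + by apply/squareE; apply: cabs_box.
  + rewrite /W /fock_density /k; have rl := rho_gt0 l; have rp := rho_gt0 (toC p).
    have h4 : rho l <= (1 + K) * rho (toC p).
      by rewrite (le_trans (rho_lip l (toC p)))// mulrDl mul1r lerD2l cabsC.
    have h5 : rho l ^+ 2 <= ((1 + K) * rho (toC p)) ^+ 2.
      by apply: lerXn2r => //; rewrite nnegrE; nneg.
    rewrite ler_pdivrMr ?exprn_gt0// mulrAC ler_pdivlMr ?exprn_gt0//.
    apply: (@le_trans _ _ (`|tau l| * ((1 + K) * rho (toC p)) ^+ 2)).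
      by apply: ler_pM => //; [rewrite mulr_ge0 ?cabs_ge0 ?expR_ge0|rewrite exprn_ge0 ?ltW].
    by rewrite le_eqVlt; apply/orP; left; apply/eqP; ring.
- rewrite lee_fin (_ : \sum_(l <- S) _ = (1 + K) ^+ 2 * (2 * K) ^+ 2 * \sum_(l <- S) `|tau l|).
    by apply: ler_wpM2l; [nneg|exact: HB].
  rewrite mulr_sumr; apply: eq_bigr => l _; rewrite /k; field.
  by rewrite gt_eqF.
Qed.

End Sufficiency.

(** * Second-order Taylor bounds *)

Section Taylor.
Variable R : realType.
Implicit Types (f u : R -> R) (a al : R).

Lemma mvt f (f' : R -> R) (x y : R) : x < y -> (forall t : R, x <= t <= y -> is_derive t 1 f (f' t)) ->
  exists2 c, x < c < y & f y - f x = f' c * (y - x).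
Proof.
move=> xy df; have [||c + ->] := @MVT _ f f' x y xy.
- by move=> t; rewrite in_itv /= => /andP[/ltW h1 /ltW h2]; apply: df; rewrite h1.
- apply: derivable_within_continuous => t; rewrite in_itv /= => h.
  by apply: ex_derive; exact: df.
- by rewrite in_itv /= => h; exists c.
Qed.

(** The mean value theorem for [f'] shows that [f] minus its quadratic majorant has a derivative of
    the sign of [- t]; a second use of it between [0] and [a] concludes. *)
Lemma taylor2_upper f (f' f'' : R -> R) (r a al : R) : `|a| < r ->
  (forall t : R, `|t| < r -> is_derive t 1 f (f' t)) ->
  (forall t : R, `|t| < r -> is_derive t 1 f' (f'' t)) ->
  (forall t, `|t| < r -> f'' t <= al) ->
  f a <= f 0 + f' 0 * a + al / 2 * a ^+ 2.
Proof.
move=> ar df df' h''.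
have inr (x y t : R) : `|x| < r -> `|y| < r -> x <= t <= y -> `|t| < r.
  rewrite !ltr_norml => /andP[? ?] /andP[? ?] /andP[? ?]; apply/andP; split; lra.
have r0 : `|0 : R| < r by rewrite normr0 (le_lt_trans _ ar).
have gr (x y : R) : `|x| < r -> `|y| < r -> x < y -> f' y - f' x <= al * (y - x).
  move=> hx hy xy; have [t th|c /andP[c1 c2] ->] := @mvt f' f'' x y xy.
    by apply: df'; exact: inr hx hy th.
  apply: ler_wpM2r; first by rewrite subr_ge0 ltW.
  by apply: h''; apply: (inr x y) => //; rewrite !ltW.
have [a0|a0|->] := ltgtP a 0; last by rewrite expr0n !mulr0 !addr0.
  have [t th|c /andP[c1 c2]] := @mvt (fun t => f t - f' 0 * t - al / 2 * t ^+ 2) (fun t => f' t - f' 0 - al * t) a 0 a0.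
    have := df t (inr _ _ _ ar r0 th) => dft.
    by apply: is_derive_eq; rewrite /GRing.scale /=; field.
  have cr : `|c| < r by apply: (inr a 0) => //; rewrite !ltW.
  have h := gr c 0 cr r0 c2; rewrite sub0r in h.
  rewrite expr0n /= !mulr0 !subr0 sub0r => E.
  have : 0 <= (f' c - f' 0 - al * c) * - a by rewrite mulr_ge0 ?oppr_ge0 ?(ltW a0)//; lra.
  by rewrite -E; lra.
have [t th|c /andP[c1 c2]] := @mvt (fun t => f t - f' 0 * t - al / 2 * t ^+ 2) (fun t => f' t - f' 0 - al * t) 0 a a0.
  have := df t (inr _ _ _ r0 ar th) => dft.
  by apply: is_derive_eq; rewrite /GRing.scale /=; field.
have cr : `|c| < r by apply: (inr 0 a) => //; rewrite !ltW.
have h := gr 0 c r0 cr c1; rewrite subr0 in h.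
rewrite expr0n /= !mulr0 !subr0 => E.
have : (f' c - f' 0 - al * c) * a <= 0 by rewrite mulr_le0_ge0 ?(ltW a0)//; lra.
by rewrite -E; lra.
Qed.

Lemma trig_integral (a0 a1 a2 a3 a4 a5 : R) :
  (\int[lebesgue_measure]_(t in `[0%R, (2 * pi)%R])
     (a0 + a1 * cos t + a2 * sin t + a3 * (cos t * sin t) + a4 * cos t ^+ 2 + a5 * sin t ^+ 2)%:E
   = (2 * pi * a0 + pi * (a4 + a5))%:E)%E.
Proof.
pose F (t : R) := a0 * t + a1 * sin t - a2 * cos t + a3 / 2 * sin t ^+ 2 +
  a4 / 2 * (t + sin t * cos t) + a5 / 2 * (t - sin t * cos t).
have dF (t : R) : is_derive t 1 F (a0 + a1 * cos t + a2 * sin t + a3 * (cos t * sin t) + a4 * cos t ^+ 2 + a5 * sin t ^+ 2).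
  apply: is_derive_eq; rewrite /GRing.scale /=.
  have E : cos t ^+ 2 = 1 - sin t ^+ 2 by rewrite -(cos2Dsin2 t) addrK.
  by rewrite -[cos t * cos t]/(cos t ^+ 2) E; field.
have cF : continuous F by move=> t; apply: differentiable_continuous; apply/derivable1_diffP.
have p0 : 0 < 2 * pi :> R by rewrite mulr_gt0// pi_gt0.
rewrite (@continuous_FTC2 _ _ F _ _ p0).
- have s2 : sin (2 * pi) = 0 :> R by rewrite mulr_natl mulr2n sinD sinpi; ring.
  have c2 : cos (2 * pi) = 1 :> R by rewrite mulr_natl mulr2n cosD sinpi cospi; ring.
  by rewrite -EFinB /F s2 c2 sin0 cos0; congr (_%:E); field.
- apply: continuous_subspaceT => t; apply: differentiable_continuous; apply/derivable1_diffP.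
  by apply: ex_derive.
- by split; [move=> t _; exact: ex_derive|exact/cvg_at_right_filter/cF|exact/cvg_at_left_filter/cF].
- by move=> t _; rewrite derive1E; exact: derive_val.
Qed.

End Taylor.

(** * Sub-mean values and the sign of the Laplacian *)

Section PartialDerivatives.
Variable R : realType.
Implicit Types (u : R * R -> R) (p : R * R).

Lemma is_derive_partialx u (x y : R) : derivable u (x, y) ((1, 0) : R * R) ->
  is_derive x 1 (fun t => u (t, y)) (partial false u (x, y)).
Proof.
move=> H; have E : (fun h : R => h^-1 *: (u (h *: ((1, 0) : R * R) + (x, y)) - u (x, y))) =
    (fun h : R => h^-1 *: (u (h *: 1 + x, y) - u (x, y))).
  apply/funext => h; have -> : h *: ((1, 0) : R * R) + (x, y) = (h *: 1 + x, h *: 0 + y) by [].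
  by rewrite [h *: 0]scaler0 add0r.
by split; rewrite /derivable /derive /partial /derive -?E.
Qed.

Lemma is_derive_partialy u (x y : R) : derivable u (x, y) ((0, 1) : R * R) ->
  is_derive y 1 (fun t => u (x, t)) (partial true u (x, y)).
Proof.
move=> H; have E : (fun h : R => h^-1 *: (u (h *: ((0, 1) : R * R) + (x, y)) - u (x, y))) =
    (fun h : R => h^-1 *: (u (x, h *: 1 + y) - u (x, y))).
  apply/funext => h; have -> : h *: ((0, 1) : R * R) + (x, y) = (h *: 0 + x, h *: 1 + y) by [].
  by rewrite [h *: 0]scaler0 add0r.
by split; rewrite /derivable /derive /partial /derive -?E.
Qed.

Lemma is_derive_shift (f : R -> R) (x t l : R) : is_derive (x + t) 1 f l ->
  is_derive t 1 (fun s => f (x + s)) l.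
Proof.
move=> H; have E : (fun h : R => h^-1 *: (f (x + (h *: 1 + t)) - f (x + t))) =
    (fun h : R => h^-1 *: (f (h *: 1 + (x + t)) - f (x + t))).
  by apply/funext => h; rewrite addrCA.
have [H1 H2] := H.
by split; [rewrite /derivable /= E|rewrite -H2 /derive /= E].
Qed.

Lemma continuous_box u (x y e : R) : continuous u -> 0 < e ->
  exists2 r : R, 0 < r & forall a b, `|a| < r -> `|b| < r -> `|u (x + a, y + b) - u (x, y)| <= e.
Proof.
move=> uc e0; have /cvgrPdist_le/(_ e e0)[[A B] /= [/nbhs_ballP[r1 r10 H1] /nbhs_ballP[r2 r20 H2]] AB] := uc (x, y).
exists (Num.min r1 r2) => [|a b]; first by rewrite lt_min r10 r20.
rewrite !lt_min => /andP[a1 _] /andP[_ b2]; rewrite distrC; apply: (AB (_, _)); split => /=.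
  by apply: H1; rewrite /ball /= opprD addNKr normrN.
by apply: H2; rewrite /ball /= opprD addNKr normrN.
Qed.

Section SecondOrder.
Variables u d1 d2 d11 d22 d12 : R * R -> R.
Hypothesis u1 : forall x y : R, is_derive x 1 (fun t => u (t, y)) (d1 (x, y)).
Hypothesis u2 : forall x y : R, is_derive y 1 (fun t => u (x, t)) (d2 (x, y)).
Hypothesis u11 : forall x y : R, is_derive x 1 (fun t => d1 (t, y)) (d11 (x, y)).
Hypothesis u22 : forall x y : R, is_derive y 1 (fun t => d2 (x, t)) (d22 (x, y)).
Hypothesis u12 : forall x y : R, is_derive y 1 (fun t => d1 (x, t)) (d12 (x, y)).
Hypotheses (cu : continuous u) (c11 : continuous d11) (c22 : continuous d22) (c12 : continuous d12).

(** Following the broken path through [(x, y + b)], only one mixed derivative occurs, and no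
    symmetry of second derivatives is involved. Continuity replaces nearby second derivatives by
    those at [(x, y)] up to [e]. *)
Lemma second_order_bound (x y e : R) : 0 < e -> exists2 r : R, 0 < r &
  forall a b, `|a| <= r -> `|b| <= r ->
  u (x + a, y + b) <= u (x, y) + a * d1 (x, y) + b * d2 (x, y) + a * b * d12 (x, y) + e * `|a * b| +
    (d11 (x, y) + e) / 2 * a ^+ 2 + (d22 (x, y) + e) / 2 * b ^+ 2.
Proof.
move=> e0.
have [r1 r10 H1] := continuous_box x y c11 e0.
have [r2 r20 H2] := continuous_box x y c22 e0.
have [r3 r30 H3] := continuous_box x y c12 e0.
pose q := Num.min r1 (Num.min r2 r3).
have q0 : 0 < q by rewrite !lt_min r10 r20 r30.
exists (q / 2) => [|a b ha hb]; first by rewrite divr_gt0.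
have q2 : q / 2 < q by rewrite ltr_pdivrMr// ltr_pMr// ltr1n.
have aq : `|a| < q by exact: le_lt_trans ha q2.
have bq : `|b| < q by exact: le_lt_trans hb q2.
have qr1 (t : R) : `|t| < q -> `|t| < r1 by rewrite !lt_min => /and3P[].
have qr2 (t : R) : `|t| < q -> `|t| < r2 by rewrite !lt_min => /and3P[].
have qr3 (t : R) : `|t| < q -> `|t| < r3 by rewrite !lt_min => /and3P[].
have z1 : `|0 : R| < r1 by rewrite normr0.
have z2 : `|0 : R| < r2 by rewrite normr0.
have z3 : `|0 : R| < r3 by rewrite normr0.
have I1 : u (x + a, y + b) <= u (x + 0, y + b) + d1 (x + 0, y + b) * a + (d11 (x, y) + e) / 2 * a ^+ 2.
  apply: (@taylor2_upper R (fun t => u (x + t, y + b)) (fun t => d1 (x + t, y + b)) (fun t => d11 (x + t, y + b)) q) => // t tq.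
  - exact: (is_derive_shift (f := fun t => u (t, y + b))).
  - exact: (is_derive_shift (f := fun t => d1 (t, y + b))).
  - have := H1 t b (qr1 t tq) (qr1 b bq); rewrite ler_norml => /andP[_].
    by rewrite lerBlDl.
have I2 : u (x, y + b) <= u (x, y + 0) + d2 (x, y + 0) * b + (d22 (x, y) + e) / 2 * b ^+ 2.
  apply: (@taylor2_upper R (fun t => u (x, y + t)) (fun t => d2 (x, y + t)) (fun t => d22 (x, y + t)) q) => // t tq.
  - exact: (is_derive_shift (f := fun t => u (x, t))).
  - exact: (is_derive_shift (f := fun t => d2 (x, t))).
  - have := H2 0 t z2 (qr2 t tq); rewrite ler_norml addr0 => /andP[_].
    by rewrite lerBlDl.
have dD (t : R) : is_derive t 1 (fun s => d1 (x, y + s)) (d12 (x, y + t)).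
  exact: (is_derive_shift (f := fun t => d1 (x, t))).
have bnd (c : R) : `|c| < q -> `|d12 (x, y + c) - d12 (x, y)| <= e.
  by move=> cq; have := H3 0 c z3 (qr3 c cq); rewrite addr0.
have I3 : d1 (x, y + b) * a <= a * d1 (x, y) + a * b * d12 (x, y) + e * `|a * b|.
  have key (c : R) : `|c| < q -> d1 (x, y + b) - d1 (x, y) = d12 (x, y + c) * b ->
      d1 (x, y + b) * a <= a * d1 (x, y) + a * b * d12 (x, y) + e * `|a * b|.
    move=> cq /eqP; rewrite subr_eq => /eqP ->.
    have -> : (d12 (x, y + c) * b + d1 (x, y)) * a =
      a * d1 (x, y) + a * b * d12 (x, y) + (d12 (x, y + c) - d12 (x, y)) * (a * b) by ring.
    by rewrite lerD2l (le_trans (ler_norm _))// normrM ler_wpM2r// bnd.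
  have [b0|b0|b0] := ltgtP b 0.
  - have [c /andP[c1 c2]] := @mvt R _ _ b 0 b0 (fun t _ => dD t).
    rewrite addr0 sub0r => E; apply: (key c).
      by rewrite ltr_norml in bq; case/andP: bq => *; rewrite ltr_norml; apply/andP; split; lra.
    by apply: oppr_inj; rewrite opprB E mulrN.
  - have [c /andP[c1 c2]] := @mvt R _ _ 0 b b0 (fun t _ => dD t).
    rewrite addr0 subr0 => E; apply: (key c) => //.
    by rewrite ltr_norml in bq; case/andP: bq => *; rewrite ltr_norml; apply/andP; split; lra.
  - by apply: (key 0); rewrite ?normr0// b0 addr0 subrr mulr0.
rewrite addr0 in I1; rewrite addr0 in I2.
by move: I1 I2 I3; move: (_ * a ^+ 2) (_ * b ^+ 2) (d1 _ * a) (e * _) => *; lra.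
Qed.

Hypothesis mean : forall (x y r : R), 0 < r ->
  ((u (x, y))%:E <= ((2 * pi)^-1)%:E * \int[lebesgue_measure]_(t in `[0%R, (2 * pi)%R])
     (u (x + r * cos t, y + r * sin t)%R)%:E)%E.

(** Averaged over a small circle, the first-order and mixed terms disappear and the trace remains.
    The choice [e / 6] balances error weights [4 + 1 + 1]. *)
Lemma submean_trace_ge0 (x y : R) : 0 <= d11 (x, y) + d22 (x, y).
Proof.
apply/ler_addgt0Pr => e e0; have e60 : 0 < e / 6 by rewrite divr_gt0.
have [r r0 Hr] := second_order_bound x y e60.
have H2 := mean x y r0.
move: (d11 (x, y)) (d22 (x, y)) Hr => al be Hr.
pose Q (t : R) := (u (x, y) + e / 6 * r ^+ 2) + (r * d1 (x, y)) * cos t + (r * d2 (x, y)) * sin t +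
  (r ^+ 2 * d12 (x, y)) * (cos t * sin t) + ((al + e / 6) / 2 * r ^+ 2) * cos t ^+ 2 + ((be + e / 6) / 2 * r ^+ 2) * sin t ^+ 2.
have p0 : 0 < pi :> R := pi_gt0 _.
have cs : continuous (fun t : R => (x + r * cos t, y + r * sin t) : R * R).
  move=> t; apply: (@pair_continuous _ _ _ (fun t : R => x + r * cos t) (fun t : R => y + r * sin t)).
    by apply: cvgD; [exact: cvg_cst|apply: cvgM; [exact: cvg_cst|exact: continuous_cos]].
  by apply: cvgD; [exact: cvg_cst|apply: cvgM; [exact: cvg_cst|exact: continuous_sin]].
have cU : continuous (fun t : R => u (x + r * cos t, y + r * sin t)).
  by move=> t; apply: (continuous_comp (cs t)); exact: cu.
have cQ : continuous Q.
  by move=> t; apply: differentiable_continuous; apply/derivable1_diffP; apply: ex_derive.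
have le t : u (x + r * cos t, y + r * sin t) <= Q t.
  have h1 : `|r * cos t| <= r by rewrite normrM gtr0_norm// ler_piMr ?(ltW r0)// ler_norml cos_geN1 cos_le1.
  have h2 : `|r * sin t| <= r by rewrite normrM gtr0_norm// ler_piMr ?(ltW r0)// ler_norml sin_geN1 sin_le1.
  apply: le_trans (Hr _ _ h1 h2) _.
  have h3 : e / 6 * `|r * cos t * (r * sin t)| <= e / 6 * r ^+ 2.
    by rewrite ler_wpM2l ?(ltW e60)// normrM expr2 ler_pM.
  apply: le_trans (lerD (lerD (lerD (lexx _) h3) (lexx _)) (lexx _)) _.
  by rewrite /Q le_eqVlt; apply/orP; left; apply/eqP; ring.
have : (\int[lebesgue_measure]_(t in `[0%R, (2 * pi)%R]) (u (x + r * cos t, y + r * sin t)%R)%:E <=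
    \int[lebesgue_measure]_(t in `[0%R, (2 * pi)%R]) (Q t)%:E)%E.
  by apply: le_integral => //; [apply: integrable_segment => t _; exact: cU|apply: integrable_segment => t _; exact: cQ|move=> t _; rewrite lee_fin].
rewrite trig_integral => H1.
have ip : (0 <= ((2 * pi)^-1)%:E :> \bar R)%E by rewrite lee_fin invr_ge0 mulr_ge0 ?ltW.
have := le_trans H2 (lee_wpmul2l ip H1).
rewrite -EFinM lee_fin mulrC ler_pdivlMr ?mulr_gt0// => H.
have {H} : 0 <= (pi * r ^+ 2 / 2) * (4 * (e / 6) + (al + e / 6) + (be + e / 6)).
  by rewrite -subr_ge0 in H; move: H; congr (0 <= _); field.
rewrite pmulr_rge0; last by rewrite divr_gt0// mulr_gt0// exprn_gt0.
by move=> h; lra.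
Qed.

End SecondOrder.
End PartialDerivatives.

Lemma laplacian_ge0 (R : realType) (phi : R[i] -> R) : smooth phi -> subharmonic phi ->
  forall p, 0 <= laplacian phi p.
Proof.
move=> Hs [_ Hsub] [x y]; rewrite /laplacian.
apply: (@submean_trace_ge0 R (phi \o @toC R) (partial false (phi \o @toC R)) (partial true (phi \o @toC R))
  _ _ (partial true (partial false (phi \o @toC R)))).
- by move=> *; apply: is_derive_partialx; exact: ((Hs [::]).2 _).1.
- by move=> *; apply: is_derive_partialy; exact: ((Hs [::]).2 _).2.
- by move=> *; apply: is_derive_partialx; exact: ((Hs [:: false]).2 _).1.
- by move=> *; apply: is_derive_partialy; exact: ((Hs [:: true]).2 _).2.
- by move=> *; apply: is_derive_partialy; exact: ((Hs [:: false]).2 _).2.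
- exact: (Hs [::]).1.
- exact: (Hs [:: false; false]).1.
- exact: (Hs [:: true; true]).1.
- exact: (Hs [:: true; false]).1.
- by move=> x' y' r /(Hsub (toC (x', y'))).
Qed.

(** * The radius function of a weight *)

(** Intermediate value at the supremum of the set where [F <= 1]; the hypothesis excludes upward
    jumps only, and this forces the value 1 from both sides. *)
Lemma modulus_crossing (R : realType) (F : R -> R) (Q : R) : 0 < Q -> F 0 < 1 -> 1 <= F Q ->
  (forall e : R, 0 < e -> exists2 d : R, 0 < d & forall r r' : R, 0 <= r -> r <= r' -> r' <= Q ->
     r' - r < d -> F r' <= F r + e) ->
  exists2 r : R, 0 < r & F r = 1.
Proof.
move=> Q0 F0 FQ md; pose S := [set r : R | 0 <= r <= Q /\ F r <= 1].
have S0 : S 0 by split; [rewrite lexx ltW|exact: ltW].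
have hS : has_sup S by split; [exists 0|exists Q => r [/andP[]]].
pose r0 := sup S.
have r00 : 0 <= r0 by apply: ub_le_sup => //; exact: hS.2.
have r0Q : r0 <= Q by apply: ge_sup; [exists 0|move=> r [/andP[]]].
have le1 : F r0 <= 1.
  rewrite leNgt; apply/negP => gt1; have e0 : 0 < (F r0 - 1) / 2 by rewrite divr_gt0// subr_gt0.
  have [e e1 He] := md _ e0; have [r [/andP[ra rb] rc] rr] := sup_adherent e1 hS.
  have rr0 : r <= r0 by apply: ub_le_sup; [exact: hS.2|split=> //; rewrite ra].
  have := He r r0 ra rr0 r0Q; rewrite ltrBlDr -ltrBlDl.
  have h : r0 - e < r by exact: rr.
  by move=> /(_ h) h1; lra.
have ge1 : 1 <= F r0.
  rewrite leNgt; apply/negP => lt1; have e0 : 0 < 1 - F r0 by rewrite subr_gt0.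
  have r0Q' : r0 < Q by rewrite lt_neqAle r0Q andbT; apply/eqP => E; rewrite -E leNgt lt1 in FQ.
  have [e e1 He] := md _ e0; pose q := Num.min (e / 2) (Q - r0).
  have q0 : 0 < q by rewrite lt_min divr_gt0// subr_gt0.
  have qe : q < e by rewrite gt_min ltr_pdivrMr// ltr_pMr// ltr1n.
  have qQ : r0 + q <= Q by rewrite -lerBrDl ge_min lexx orbT.
  have h : r0 <= r0 + q by rewrite lerDl ltW.
  have := He r0 (r0 + q) r00 h qQ; rewrite addrAC subrr add0r => /(_ qe) H.
  have : r0 + q <= r0.
    apply: ub_le_sup; first exact: hS.2.
    by split; [rewrite qQ (le_trans r00)|rewrite (le_trans H)// addrC subrK].
  by rewrite gerDl leNgt q0.
have E : F r0 = 1 by apply/eqP; rewrite eq_le le1.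
exists r0 => //; rewrite lt_neqAle r00 andbT eq_sym; apply/eqP => r0E.
by rewrite r0E in E; rewrite E ltxx in F0.
Qed.

(** * Masses of discs for a continuous nonnegative density *)

Section DiscMass.
Variable R : realType.
Variable G : R * R -> R.
Hypotheses (Gc : continuous G) (G0 : forall p, 0 <= G p).
Implicit Types (z w : R[i]) (r : R).
Local Notation plane := (measurableTypeR R * measurableTypeR R)%type.
Local Notation leb := (@lebesgue_measure R).

Definition pdisc z r : set plane := @toC R @^-1` disc z r.

Lemma pdisc_measurable z r : measurable (pdisc z r).
Proof.
apply: open_measurable_plane; rewrite /pdisc.
rewrite (_ : _ @^-1` _ = (fun p : R * R => cabs (toC p - z)) @^-1` [set` `]-oo, r[]); last first.
  by apply/seteqP; split => p /=; rewrite /disc /= in_itv.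
apply: open_comp => [p _|]; last exact: interval_open.
apply: (@toC_continuous R (fun w => w - z)); apply: cdifferentiable_continuous.
by apply: cdifferentiableB; [exact: cdifferentiable_id|exact: cdifferentiable_cst].
Qed.
Hint Resolve pdisc_measurable : core.

Lemma pdisc_square z r : pdisc z r `<=` square z r.
Proof. by move=> p /= h; apply/squareE; apply: cabs_box; exact: ltW. Qed.

Lemma pdiscS z w r r' : cabs (w - z) + r <= r' -> pdisc w r `<=` pdisc z r'.
Proof.
move=> h p; rewrite /pdisc /disc /= => hp; apply: lt_le_trans h.
by rewrite (le_lt_trans (cabs_triangle w _ _))// addrC ltrD2l.
Qed.

(** Vertical sections of the annulus lie in two intervals of length [w], over a base of length
    [2 r']. The bound is coarse but tends to [0] with [r' - r] for bounded radii, which suffices for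
    continuity of masses. *)
Lemma annulus_area z r r' : 0 <= r -> 0 < r' ->
  (leb2 (pdisc z r' `\` pdisc z r) <= (4 * r' * Num.sqrt (r' ^+ 2 - r ^+ 2))%:E)%E.
Proof.
move=> r0 r'0; set A := _ `\` _; set w := Num.sqrt _.
have mA : measurable A by exact: measurableD.
have w0 : 0 <= w by exact: sqrtr_ge0.
pose I := [set` `[complex.Re z - r', complex.Re z + r']] : set (measurableTypeR R).
have mI : measurable I by exact: measurable_itv.
have sec x : (leb (xsection A x) <= ((cst (2 * w)%:E) \_ I) x)%E.
  rewrite patchE; case: ifPn => [xI|xI]; last first.
    rewrite (_ : xsection A x = set0) ?measure0// -subset0 => y; rewrite /xsection /= => /set_mem[/pdisc_square/squareE[h _] _].
    by move/negP: xI; apply; apply/mem_set; rewrite /I /= in_itv /= -ler_distl; move: h; rewrite /toC; case: (z).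
  (* [s] is the half-chord of the inner disc, and [0] when the line misses that disc, because the
     square root of a negative number is [0]. *)
  pose X := x - complex.Re z; pose s := Num.sqrt (r ^+ 2 - X ^+ 2); pose y0 := complex.Im z.
  have s0 : 0 <= s by exact: sqrtr_ge0.
  pose I1 := [set` `[y0 + s, y0 + s + w]] : set (measurableTypeR R).
  pose I2 := [set` `[y0 - s - w, y0 - s]] : set (measurableTypeR R).
  have mI1 : measurable I1 by exact: measurable_itv.
  have mI2 : measurable I2 by exact: measurable_itv.
  have sub : xsection A x `<=` I1 `|` I2.
    move=> y; rewrite /xsection /= => /set_mem[].
    rewrite /pdisc /disc /= => h1 /negP; rewrite -leNgt => h2.
    have E : cabs (toC (x, y) - z) = Num.sqrt (X ^+ 2 + (y - y0) ^+ 2).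
      by rewrite /X /y0 /toC /=; case: (z) => a b; rewrite /= -cabs_sqrt.
    set Y := y - y0 in E; rewrite E in h1; rewrite E in h2.
    have q1 : X ^+ 2 + Y ^+ 2 < r' ^+ 2.
      by rewrite -(sqr_sqrtr (_ : 0 <= X ^+ 2 + Y ^+ 2)) ?addr_ge0 ?sqr_ge0// ltrXn2r// sqrtr_ge0.
    have q2 : r ^+ 2 <= X ^+ 2 + Y ^+ 2.
      by rewrite -(sqr_sqrtr (_ : 0 <= X ^+ 2 + Y ^+ 2)) ?addr_ge0 ?sqr_ge0// lerXn2r// nnegrE sqrtr_ge0.
    have wE : w ^+ 2 = r' ^+ 2 - r ^+ 2 by rewrite sqr_sqrtr// subr_ge0 (le_trans q2)// ltW.
    have sE : r ^+ 2 - X ^+ 2 <= s ^+ 2.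
      have [h|h] := leP 0 (r ^+ 2 - X ^+ 2); first by rewrite sqr_sqrtr.
      by rewrite (le_trans (ltW h))// sqr_ge0.
    have sY : s <= `|Y|.
      have [h|h] := leP 0 (r ^+ 2 - X ^+ 2).
        rewrite -(ler_pXn2r (ltn0Sn 1)) ?nnegrE// sqr_sqrtr// real_normK ?num_real//.
        by rewrite lerBlDl.
      by rewrite /s ler0_sqrtr// ltW.
    have Yw : `|Y| <= s + w.
      rewrite -(ler_pXn2r (ltn0Sn 1)) ?nnegrE ?addr_ge0// real_normK ?num_real//.
      have p2 : 0 <= 2 * s * w by rewrite !mulr_ge0.
      rewrite (_ : (s + w) ^+ 2 = s ^+ 2 + 2 * s * w + w ^+ 2); last by ring.
      by move: p2 q1 wE sE; move: (X ^+ 2) (Y ^+ 2) (s ^+ 2) (w ^+ 2) (2 * s * w) => *; lra.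
    have [Y0|Y0] := leP 0 Y.
      left; rewrite /I1 /= in_itv /=; rewrite ger0_norm// in sY Yw; move: sY Yw; rewrite /Y => ? ?.
      by apply/andP; split; lra.
    right; rewrite /I2 /= in_itv /=; rewrite ltr0_norm// in sY Yw; move: sY Yw; rewrite /Y => ? ?.
    by apply/andP; split; lra.
  have mX : measurable (xsection A x) by exact: measurable_xsection.
  apply: (@le_trans _ _ (leb (I1 `|` I2))).
    by apply: le_measure => //; apply/mem_set => //; exact: measurableU.
  apply: (@le_trans _ _ (leb I1 + leb I2)%E); first exact: measureU2.
  rewrite /cst mulr_natl mulr2n EFinD; apply: leeD; rewrite lebesgue_measure_itv /=; case: ifP => _; rewrite ?lee_fin//.
    by lra.
  by lra.
have -> : leb2 A = (\int[leb]_x leb (xsection A x))%E by [].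
apply: (@le_trans _ _ (\int[leb]_x ((cst (2 * w)%:E) \_ I) x)%E).
  apply: ge0_le_integral => //.
  - exact: measurable_fun_xsection.
  - by apply/(measurable_restrictT _ _).1 => //; exact: measurable_cst.
rewrite -integral_mkcond integral_cst_itv; last by rewrite ltrD2l gt0_cp.
by rewrite lee_fin; lra.
Qed.

Definition dmass z r := (\int[leb2]_(p in pdisc z r) (G p)%:E)%E.

Lemma square_bound z r : exists2 B : R, 0 <= B & forall p, square z r p -> G p <= B.
Proof.
have [r0|r0] := ltP r 0.
  exists 0 => // p /squareE[h _].
  by have := le_trans (normr_ge0 _) h; rewrite leNgt r0.
have [c _ cmax] : exists2 c, c \in square z r & forall t, t \in square z r -> G t <= G c.
  apply: compact_EVT_max; last by apply: continuous_in_subspaceT => x _; exact: Gc.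
    exists (complex.Re z, complex.Im z); apply/squareE; rewrite /toC /=.
    have -> : complex.Re z +i* complex.Im z = z by case: (z).
    exact: box_center.
  exact: square_compact.
by exists (G c) => // p /mem_set/cmax.
Qed.

Lemma dmass_ge0 z r : (0 <= dmass z r)%E. Proof. exact: plane_integral_ge0. Qed.

Lemma dmass_fin z r : dmass z r \is a fin_num.
Proof.
rewrite ge0_fin_numE ?dmass_ge0//; have [B B0 HB] := square_bound z r.
have [r0|r0] := leP r 0.
  rewrite /dmass (_ : pdisc z r = set0) ?integral_set0// -subset0 => p.
  by rewrite /pdisc /disc /= ltNge (le_trans r0)// cabs_ge0.
apply: (@le_lt_trans _ _ (\sum_(l <- [:: z]) B * (2 * r) ^+ 2)%:E); last exact: ltry.
apply: (@plane_integral_cover _ G Gc G0 [:: z] (fun=> r) (fun=> B)) => // p /pdisc_square h.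
by exists z; rewrite mem_head; split=> //; exact: HB.
Qed.

Definition rmass z r := fine (dmass z r).

Lemma rmassE z r : (rmass z r)%:E = dmass z r.
Proof. by rewrite fineK// dmass_fin. Qed.

Lemma rmass_ge0 z r : 0 <= rmass z r.
Proof. by rewrite -lee_fin rmassE dmass_ge0. Qed.

Lemma rmassS z w r r' : cabs (w - z) + r <= r' -> rmass w r <= rmass z r'.
Proof.
by move=> h; rewrite -lee_fin !rmassE; apply: plane_integral_subset => //; exact: pdiscS.
Qed.

Lemma rmass_disjoint z w1 w2 r1 r2 r : cabs (w1 - z) + r1 <= r -> cabs (w2 - z) + r2 <= r ->
  r1 + r2 <= cabs (w1 - w2) -> rmass w1 r1 + rmass w2 r2 <= rmass z r.
Proof.
move=> h1 h2 h; rewrite -lee_fin EFinD !rmassE {3}/dmass.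
have s1 := pdiscS h1; have s2 := pdiscS h2.
rewrite (@plane_integral_setD _ G Gc G0 (pdisc w1 r1))// leeD2l//.
apply: plane_integral_subset => //; first exact: measurableD.
move=> p p2; split; first exact: s2.
move: p2; rewrite /pdisc /disc /= => p2 p1.
have := cabs_triangle (toC p) w1 w2; rewrite (cabsC w1 (toC p)) => h3.
by move: p1 p2 h h3; move: (cabs (toC p - w1)) (cabs (toC p - w2)) (cabs (w1 - w2)) => *; lra.
Qed.

Lemma rmass_modulus z (Q : R) : 0 < Q -> forall e : R, 0 < e -> exists2 d : R, 0 < d &
  forall r r' : R, 0 <= r -> r <= r' -> r' <= Q -> r' - r < d -> rmass z r' <= rmass z r + e.
Proof.
move=> Q0 e e0; have [B B0 HB] := square_bound z Q.
pose k := B * (4 * Q) + 1; have k0 : 0 < k by rewrite ltr_wpDl// mulr_ge0// mulr_ge0// ltW.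
pose q := e / k; have q0 : 0 < q by exact: divr_gt0.
(* [r' ^ 2 - r ^ 2 <= 2 Q (r' - r)], so the square root in [annulus_area] is at most [q]. *)
exists (q ^+ 2 / (2 * Q)) => [|r r' r0 rr' r'Q rd]; first by apply: divr_gt0; [exact: exprn_gt0|exact: mulr_gt0].
have [r'0|r'0] := leP r' 0.
  have -> : r' = r by apply/eqP; rewrite eq_le rr' (le_trans r'0).
  by rewrite lerDl ltW.
have sq : Num.sqrt (r' ^+ 2 - r ^+ 2) <= q.
  rewrite -(ler_pXn2r (ltn0Sn 1)) ?nnegrE ?sqrtr_ge0 ?(ltW q0)// sqr_sqrtr; last first.
    by rewrite subr_ge0 lerXn2r// nnegrE// ltW.
  rewrite ltr_pdivlMr ?mulr_gt0// in rd; apply: le_trans (ltW rd).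
  rewrite subr_sqr ler_wpM2l ?subr_ge0//.
  by lra.
have rs : pdisc z r `<=` pdisc z r' by apply: pdiscS; rewrite subrr cabs0 add0r.
have h : (dmass z r' = dmass z r + \int[leb2]_(p in pdisc z r' `\` pdisc z r) (G p)%:E)%E.
  exact: (plane_integral_setD Gc G0).
have mA : measurable (pdisc z r' `\` pdisc z r) by exact: measurableD.
have h2 : (\int[leb2]_(p in pdisc z r' `\` pdisc z r) (G p)%:E <= e%:E)%E.
  apply: (@le_trans _ _ (\int[leb2]_(p in pdisc z r' `\` pdisc z r) B%:E)%E).
    apply: ge0_le_integral => //.
    - by move=> p _; rewrite lee_fin.
    - by apply: measurable_funTS; apply/measurable_EFinP; exact: continuous_measurable_plane.
    - move=> p [/pdisc_square/squareE[p1 p2] _]; rewrite lee_fin; apply: HB; apply/squareE.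
      by split; [exact: le_trans p1 r'Q|exact: le_trans p2 r'Q].
  rewrite integral_cst// (le_trans (lee_wpmul2l _ (annulus_area z r0 r'0)))//.
  rewrite -EFinM lee_fin; apply: (@le_trans _ _ (B * (4 * Q * q))).
    apply: ler_wpM2l => //; apply: ler_pM => //; rewrite ?sqrtr_ge0//; last by rewrite ler_pM2l.
    by rewrite mulr_ge0// ltW.
  rewrite mulrA /q mulrCA -[leRHS]mulr1; apply: ler_wpM2l; first exact: ltW.
  by rewrite ler_pdivrMr// mul1r /k lerDl.
by rewrite -lee_fin EFinD !rmassE h leeD2l.
Qed.

Section Doubling.
Hypothesis Gpos : exists p, 0 < G p.
Hypothesis dbl : exists2 C : R, 0 < C & forall z r, 0 < r -> rmass z (2 * r) <= C * rmass z r.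

(** A null disc would make all its doublings null, yet they reach a point where the continuous
    density is positive. *)
Lemma rmass_gt0 z r : 0 < r -> 0 < rmass z r.
Proof.
move=> r0; rewrite lt_neqAle rmass_ge0 andbT eq_sym; apply/eqP => m0.
have [C C0 HC] := dbl; have [[x y] Gp] := Gpos.
have mn n : rmass z (2 ^+ n * r) <= 0.
  elim: n => [|n IH]; first by rewrite expr0 mul1r m0.
  rewrite exprS -mulrA (le_trans (HC _ _ _))//; first by rewrite mulr_gt0 ?exprn_gt0.
  by rewrite pmulr_rle0.
have [e e0 He] := continuous_box x y Gc (divr_gt0 Gp (ltr0Sn _ 1)).
have [n Hn] : exists n, cabs (toC (x, y) - z) + e <= 2 ^+ n * r.
  pose t := (cabs (toC (x, y) - z) + e) / r; exists (Num.trunc t).+1; rewrite -ler_pdivrMr//.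
  by rewrite (le_trans (ltW (truncnS_gt t)))// -natrX ler_nat ltnW// ltn_expl.
have e20 : 0 < e / 2 by rewrite divr_gt0.
have e40 : 0 < e / 4 by rewrite divr_gt0.
have : ((G (x, y) / 2 * (2 * (e / 4)) ^+ 2)%:E <= (rmass z (2 ^+ n * r))%:E)%E.
  rewrite rmassE -(square_integral_cst (toC (x, y)) e40) ?divr_ge0 ?(ltW Gp)//.
  have sub : (square (toC (x, y)) (e / 4) : set plane) `<=` pdisc z (2 ^+ n * r).
    move=> p /squareE/box_cabs h; apply: (pdiscS Hn); rewrite /pdisc /disc /=.
    by rewrite (le_lt_trans h)//; lra.
  apply: (@le_trans _ _ (\int[leb2]_(p in (square (toC (x, y)) (e / 4) : set plane)) (G p)%:E)%E).
    apply: ge0_le_integral => //.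
    - exact: square_measurable.
    - by move=> p _; rewrite lee_fin divr_ge0// ltW.
    - by apply: measurable_funTS; apply/measurable_EFinP; exact: continuous_measurable_plane.
    - move=> [p q] /squareE[]; rewrite /toC /= => h1 h2; rewrite lee_fin.
      have := He (p - x) (q - y) (le_lt_trans h1 _) (le_lt_trans h2 _).
      rewrite ![_ + (_ - _)]addrC !subrK ler_norml.
      have e4 : e / 4 < e by lra.
      by move=> /(_ e4 e4)/andP[h _]; lra.
  by apply: plane_integral_subset => //; exact: square_measurable.
rewrite lee_fin => h; have := le_trans h (mn n); rewrite leNgt.
by rewrite mulr_gt0 ?divr_gt0// exprn_gt0// mulr_gt0.
Qed.

Lemma cabs_toC (x : R) : 0 <= x -> cabs (x +i* 0) = x.
Proof. by move=> x0; rewrite cabs_sqrt expr0n addr0 sqrtr_sqr ger0_norm. Qed.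

(** Beside the smaller disc the larger one contains a disjoint disc of radius [(r' - r) / 2], of
    positive mass. *)
Lemma rmass_strict z r r' : 0 < r -> r < r' -> rmass z r < rmass z r'.
Proof.
move=> r0 rr'; pose s := (r' - r) / 2; have s0 : 0 < s by rewrite divr_gt0 ?subr_gt0.
pose w := z + ((r + r') / 2 +i* 0).
have wz : cabs (w - z) = (r + r') / 2.
  by rewrite /w addrC addKr cabs_toC// divr_ge0// addr_ge0 ?ltW// (lt_trans r0).
have := @rmass_disjoint z z w r s r'.
rewrite subrr cabs0 add0r wz (cabsC z w) wz => /(_ (ltW rr')) H.
have : rmass z r + rmass w s <= rmass z r' by apply: H; rewrite /s; lra.
by have := rmass_gt0 w s0; lra.
Qed.

(* Reverse doubling: [disc z (4 * r)] contains two disjoint discs of radius [r] of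
   comparable masses. *)
Lemma rmass_unbounded z : exists2 r, 0 < r & 1 <= rmass z r.
Proof.
have [C C0 HC] := dbl; pose a := (C ^+ 2)^-1; have a0 : 0 < a by rewrite invr_gt0 exprn_gt0.
have grow r : 0 < r -> (1 + a) * rmass z r <= rmass z (4 * r).
  move=> r0; pose w := z + (2 * r +i* 0).
  have wz : cabs (w - z) = 2 * r by rewrite /w addrC addKr cabs_toC// mulr_ge0// ltW.
  have h1 : rmass z r <= rmass w (4 * r).
    by apply: rmassS; rewrite cabsC wz; lra.
  have h2 : rmass w (4 * r) <= C ^+ 2 * rmass w r.
    rewrite (_ : 4 * r = 2 * (2 * r)); last by ring.
    rewrite (le_trans (HC _ _ _)) ?mulr_gt0// expr2 -mulrA ler_pM2l//.
    exact: HC.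
  have h3 : a * rmass z r <= rmass w r.
    by rewrite /a ler_pdivrMl ?exprn_gt0// (le_trans h1).
  have := @rmass_disjoint z z w r r (4 * r).
  rewrite subrr cabs0 add0r wz (cabsC z w) wz => H.
  by rewrite mulrDl mul1r (le_trans _ (H _ _ _)) ?lerD2l//; lra.
pose m1 := rmass z 1; have m10 : 0 < m1 by exact: rmass_gt0.
have lin n : m1 * (1 + n%:R * a) <= rmass z (4 ^+ n).
  elim: n => [|n IH]; first by rewrite mul0r addr0 mulr1 expr0.
  rewrite exprS; apply: le_trans (grow _ _); last by rewrite exprn_gt0.
  apply: le_trans (ler_wpM2l _ IH); last by rewrite addr_ge0// ltW.
  have p : 0 <= m1 * (n%:R * a * a) by rewrite !mulr_ge0// ltW.
  rewrite -[n.+1%:R]natr1.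
  rewrite (_ : (1 + a) * _ = m1 * (1 + (n%:R + 1) * a) + m1 * (n%:R * a * a)); last by ring.
  by rewrite lerDl.
exists (4 ^+ (Num.trunc (m1^-1 / a)).+1); first by rewrite exprn_gt0.
apply: le_trans (lin _); rewrite -ler_pdivrMl// mulr1 -lerBlDl -ler_pdivrMr//.
apply: le_trans (ltW (truncnS_gt _)); apply: ler_wpM2r; first by rewrite invr_ge0 ltW.
by rewrite gerBl.
Qed.

Lemma rmass_unit z : exists2 r, 0 < r & rmass z r = 1.
Proof.
have [Q Q0 HQ] := rmass_unbounded z.
apply: (@modulus_crossing _ _ Q) => //; last exact: rmass_modulus.
rewrite -lte_fin rmassE /dmass (_ : pdisc z 0 = set0) ?integral_set0 ?lte_fin// -subset0 => p.
by rewrite /pdisc /disc /= ltNge cabs_ge0.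
Qed.

(** Otherwise the disc around [z] of radius [s + |z - w|], strictly smaller than that of radius [r],
    would contain the unit-mass disc around [w]. *)
Lemma rmass_unit_lip z w r s : 0 < r -> 0 < s -> rmass z r = 1 -> rmass w s = 1 ->
  r <= s + cabs (z - w).
Proof.
move=> r0 s0 hr hs; rewrite leNgt; apply/negP => h.
have := @rmassS w w s s; rewrite subrr cabs0 add0r => _.
have h1 : rmass w s <= rmass z (s + cabs (z - w)) by apply: rmassS; rewrite cabsC addrC.
have p : 0 < s + cabs (z - w) by rewrite ltr_pwDl ?cabs_ge0.
by have := rmass_strict z p h; rewrite hr; rewrite hs in h1; rewrite ltNge h1.
Qed.

End Doubling.

End DiscMass.

Section WeightRadius.
Variables (R : realType) (phi : R[i] -> R).
Hypothesis W : weight phi.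

Let Gc : continuous (laplacian phi).
Proof.
have [Hs _ _ _] := W; move=> p; apply: cvgD.
  exact: (Hs [:: false; false]).1.
exact: (Hs [:: true; true]).1.
Qed.

Let G0 p : 0 <= laplacian phi p.
Proof. by have [Hs Hsub _ _] := W; exact: laplacian_ge0. Qed.

Let Gpos : exists p, 0 < laplacian phi p.
Proof.
have [_ _ nh _] := W; apply: contrapT => /forallNP H; apply: nh => p.
by apply/eqP; rewrite eq_le G0 andbT leNgt; apply/negP.
Qed.

Let massE z r : lap_mass phi (disc z r) = (rmass (laplacian phi) z r)%:E.
Proof. by rewrite rmassE. Qed.

Let dbl : exists2 C : R, 0 < C & forall z (r : R), 0 < r ->
  rmass (laplacian phi) z (2 * r) <= C * rmass (laplacian phi) z r.
Proof.
have [_ _ _ [C [C0 HC]]] := W; exists C => // z r /(HC z).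
by rewrite !massE -EFinM lee_fin.
Qed.

(** A radius of mass 1 exists by [rmass_unit], so [xget] does not return its default. *)
Lemma rho_spec z : 0 < rho phi z /\ rmass (laplacian phi) z (rho phi z) = 1.
Proof.
have [r r0 Hr] := rmass_unit Gc G0 Gpos dbl z.
rewrite /rho; case: xgetP => [s -> [s0]|/(_ r) []]; last by split=> //; rewrite massE Hr.
by rewrite massE => -[].
Qed.

Lemma rho_gt0 z : 0 < rho phi z. Proof. exact: (rho_spec z).1. Qed.

Lemma rho_lip z w : rho phi z <= rho phi w + cabs (z - w).
Proof.
have [z0 hz] := rho_spec z; have [w0 hw] := rho_spec w.
exact: (rmass_unit_lip Gc G0 Gpos dbl).
Qed.

Lemma weight_continuous z : ccontinuous (fun w => (phi w)%:C) z.
Proof.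
have [Hs _ _ _] := W; move=> e e0; case: z => x y.
have [r r0 Hr] := continuous_box x y (Hs [::]).1 e0.
exists r => // -[x' y'] h; rewrite -rmorphB cabs_real.
have h1 : `|x' - x| < r by rewrite (le_lt_trans _ h)//; exact: (ler_Re_cabs ((x' +i* y') - (x +i* y))).
have h2 : `|y' - y| < r by rewrite (le_lt_trans _ h)//; exact: (ler_Im_cabs ((x' +i* y') - (x +i* y))).
by have := Hr _ _ h1 h2; rewrite ![_ + (_ - _)]addrC !subrK.
Qed.

End WeightRadius.

(** * Lengths of paths *)

Section Paths.
Variable R : realType.
Variable rho : R[i] -> R.
Hypothesis rho_gt0 : forall z, 0 < rho z.
Hypothesis rho_lip : forall z w, rho z <= rho w + cabs (z - w).
Implicit Types (z w : R[i]) (gamma : R -> R[i]).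
Local Notation leb := (@lebesgue_measure R).

Lemma lipschitz_continuous : continuous (fun p : R * R => rho (toC p)).
Proof.
apply: real_ccontinuous => z e e0; exists e => // w wz; rewrite -rmorphB cabs_real ler_norml.
have := rho_lip w z; have := rho_lip z w; rewrite cabsC.
by move: (ltW wz) => h h1 h2; apply/andP; split; lra.
Qed.

Lemma cabs_sqr z : cabs z ^+ 2 = complex.Re z ^+ 2 + complex.Im z ^+ 2.
Proof. by case: z => a b; rewrite cabs_sqrt sqr_sqrtr// addr_ge0 ?sqr_ge0. Qed.

Definition path_length gamma : \bar R :=
  (\int[leb]_(t in `[0%R, 1%R]) (speed gamma t / rho (gamma t))%:E)%E.

Lemma C1_continuous (X : R -> R) : C1 X -> continuous X.
Proof. by move=> [dX _] t; apply: differentiable_continuous; apply/derivable1_diffP. Qed.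

Section Potential.
Variables (R0 : R) (A0 : R[i]).
Hypothesis R00 : 0 < R0.
Hypothesis rhoA : forall w, rho w <= 2 * R0 + cabs (w - A0).
(* The gradient of [U] is at most [4 / rho]. *)
Let U z := ln (R0 ^+ 2 + cabs (z - A0) ^+ 2).

Section Piece.
Variables X Y X' Y' : R -> R.
Hypotheses (dX : forall t : R, is_derive t 1 X (X' t)) (dY : forall t : R, is_derive t 1 Y (Y' t)).
Hypotheses (cX' : continuous X') (cY' : continuous Y').
Let F (t : R) := cabs (X' t +i* Y' t) / rho (X t +i* Y t).

Let cX : continuous X.
Proof. by move=> t; apply: differentiable_continuous; apply/derivable1_diffP. Qed.

Let cY : continuous Y.
Proof. by move=> t; apply: differentiable_continuous; apply/derivable1_diffP. Qed.

Let F_continuous : continuous F.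
Proof.
move=> t; apply: cvgM.
  have E : (fun t : R => cabs (X' t +i* Y' t)) =
      (fun t : R => Num.sqrt (X' t ^+ 2 + Y' t ^+ 2)).
    by apply/funext => s; rewrite cabs_sqrt.
  rewrite E; apply: (@continuous_comp _ _ _ (fun t : R => X' t ^+ 2 + Y' t ^+ 2) (@Num.sqrt R)).
    by apply: cvgD; apply: cvgM; (exact: cX' || exact: cY').
  exact: sqrt_continuous.
apply: cvgV; first by rewrite gt_eqF.
apply: (@continuous_comp _ _ _ (fun t : R => (X t, Y t) : R * R) (fun p => rho (toC p))).
  by apply: (@pair_continuous _ _ _ X Y); [exact: cX|exact: cY].
exact: lipschitz_continuous.
Qed.

(** With [y] the distance to the pole, the gradient of [U] is [2 y / (R0 ^ 2 + y ^ 2)] in size, and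
    [rho <= 2 R0 + y]; their product is at most 4. The number [k] is later [1] or [-1], for the two
    directions of travel. *)
Lemma piece_lower (k a b : R) : `|k| <= 1 -> a < b ->
  ((k * (U (X b +i* Y b) - U (X a +i* Y a)) / 4)%:E <= \int[leb]_(t in `]a, b[) (F t)%:E)%E.
Proof.
move=> k1 ab; pose p := complex.Re A0; pose q := complex.Im A0.
pose V (t : R) := R0 ^+ 2 + ((X t - p) ^+ 2 + (Y t - q) ^+ 2).
have VE t : V t = R0 ^+ 2 + cabs ((X t +i* Y t) - A0) ^+ 2.
  by rewrite cabs_sqr /V /p /q; case: (A0).
have V0 t : 0 < V t by rewrite ltr_pwDl ?exprn_gt0// addr_ge0 ?sqr_ge0.
pose V' (t : R) := 2 * ((X t - p) * X' t + (Y t - q) * Y' t).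
have dV (t : R) : is_derive t 1 V (V' t).
  by apply: is_derive_eq; rewrite /V' /GRing.scale /=; ring.
have dl (t : R) : is_derive t 1 (fun t => k / 4 * ln (V t)) (k / 4 * (V' t / V t)).
  have h : is_derive t 1 (fun t => ln (V t)) (V' t / V t).
    have := is_derive1_comp (is_derive1_ln (V0 t)) (dV t).
    by rewrite mulrC.
  by apply: is_derive_eq; rewrite /GRing.scale /=; ring.
have cV : continuous V by move=> t; apply: differentiable_continuous; apply/derivable1_diffP.
have cV' : continuous V'.
  move=> t; apply: cvgM; first exact: cvg_cst.
  apply: cvgD; apply: cvgM; try (exact: cX'); try (exact: cY').
    by apply: cvgB; [exact: cX|exact: cvg_cst].
  by apply: cvgB; [exact: cY|exact: cvg_cst].
have ch : continuous (fun t => k / 4 * (V' t / V t)).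
  move=> t; apply: cvgM; first exact: cvg_cst.
  by apply: cvgM; [exact: cV'|apply: cvgV; [rewrite gt_eqF|exact: cV]].
have cl : continuous (fun t => k / 4 * ln (V t)).
  by move=> t; apply: differentiable_continuous; apply/derivable1_diffP.
have le t : k / 4 * (V' t / V t) <= F t.
  pose y := cabs ((X t +i* Y t) - A0); pose v := cabs (X' t +i* Y' t).
  have y0 : 0 <= y by exact: cabs_ge0.
  have v0 : 0 <= v by exact: cabs_ge0.
  have h1 : `|V' t| <= 2 * (y * v).
    rewrite normrM ger0_norm// ler_pM2l//.
    have -> : (X t - p) * X' t + (Y t - q) * Y' t =
        complex.Re (((X t - p) -i* (Y t - q)) * (X' t +i* Y' t)).
      by rewrite /=; ring.
    rewrite (le_trans (ler_Re_cabs _))// cabsM ler_wpM2r//.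
    rewrite -(ler_pXn2r (ltn0Sn 1)) ?nnegrE ?cabs_ge0// /y !cabs_sqr /p /q; case: (A0) => a1 a2 /=.
    by rewrite sqrrN.
  have rp := rho_gt0 (X t +i* Y t).
  have h2 : rho (X t +i* Y t) <= 2 * R0 + y by exact: rhoA.
  apply: (@le_trans _ _ (4^-1 * (`|V' t| / V t))).
    rewrite (_ : k / 4 * _ = 4^-1 * (k * V' t / V t)); last by ring.
    rewrite ler_pM2l ?invr_gt0// ler_pM2r ?invr_gt0//.
    by rewrite (le_trans (ler_norm _))// normrM ler_piMl.
  rewrite /F -/v ler_pdivlMr// (_ : _ * rho _ = `|V' t| * rho (X t +i* Y t) / (4 * V t)); last first.
    by field; rewrite gt_eqF.
  rewrite ler_pdivrMr ?mulr_gt0// VE -/y.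
  apply: (@le_trans _ _ (2 * (y * v) * (2 * R0 + y))).
    by rewrite ler_pM// ltW.
  (* [4 (R0 ^ 2 + y ^ 2) - 2 y (2 R0 + y) = 2 (R0 - y) ^ 2 + 2 R0 ^ 2]. *)
  have h4 : 0 <= v * (2 * (R0 - y) ^+ 2) by apply: mulr_ge0 => //; apply: mulr_ge0 => //; exact: sqr_ge0.
  rewrite -subr_ge0 (_ : _ - _ = v * (2 * (R0 - y) ^+ 2) + v * (2 * R0 ^+ 2)); last by ring.
  by apply: addr_ge0 => //; apply: mulr_ge0 => //; apply: mulr_ge0 => //; exact: sqr_ge0.
have := @continuous_FTC2 R (fun t => k / 4 * (V' t / V t)) (fun t => k / 4 * ln (V t)) a b ab.
move=> /(_ _ _ _)/[dup] H.
have {}H : (\int[leb]_(t in `[a, b]) (k / 4 * (V' t / V t))%:E = (k / 4 * ln (V b))%:E - (k / 4 * ln (V a))%:E)%E.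
  apply: H.
  - exact: continuous_subspaceT.
  - by split; [move=> t _; exact: ex_derive|exact/cvg_at_right_filter/cl|exact/cvg_at_left_filter/cl].
  - by move=> t _; rewrite derive1E; exact: derive_val.
move=> _; have -> : (k * (U (X b +i* Y b) - U (X a +i* Y a)) / 4)%:E =
    (\int[leb]_(t in `[a, b]) (k / 4 * (V' t / V t))%:E)%E.
  by rewrite H -EFinB !VE /U; congr (_%:E); ring.
rewrite -(integral_itv_bndoo true false); last first.
  by apply/measurable_EFinP; apply: measurable_funTS; exact: continuous_measurable_fun.
apply: le_integral => //.
- by apply: integrable_segment => t _; exact: ch.
- by apply: integrable_segment => t _; exact: F_continuous.
- by move=> t _; rewrite lee_fin.
Qed.

Lemma piece_measurable (a b : R) : measurable_fun `]a, b[ F.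
Proof. by apply: measurable_funTS; exact: continuous_measurable_fun. Qed.

End Piece.

Variable gamma : R -> R[i].
Let f (t : R) := speed gamma t / rho (gamma t).
Let f0 t : 0 <= f t.
Proof. by rewrite divr_ge0 ?cabs_ge0 ?ltW. Qed.

(** Half-open intervals tile the parameter range. Measurability is carried through the induction
    because the integrand is known only piece by piece, in the interior of each piece. *)
Lemma chain_lower (k : R) (s : seq R) (a : R) : `|k| <= 1 -> path <%R a s ->
  (forall j, (j < size s)%N -> exists eta : R -> R[i],
    [/\ C1 (fun t => complex.Re (eta t)), C1 (fun t => complex.Im (eta t)) &
        {in `[nth 0 (a :: s) j, nth 0 s j], gamma =1 eta}]) ->
  measurable_fun `]a, last a s] f /\
  ((k * (U (gamma (last a s)) - U (gamma a)) / 4)%:E <= \int[leb]_(t in `]a, last a s]) (f t)%:E)%E.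
Proof.
move=> k1; elim: s a => [|x s IH] a.
  move=> _ _; rewrite /= set_itvoc0 integral_set0 subrr mulr0 mul0r; split=> //.
  exact: measurable_fun_set0.
move=> /= /andP[ax xs] H.
have [mf2 h2] := IH x xs (fun j js => H j.+1 js).
have [eta [[dX cX] [dY cY] ge]] := H 0 isT; rewrite /= in ge.
have {}dX (t : R) : is_derive t 1 (fun t => complex.Re (eta t)) (derive1 (fun t => complex.Re (eta t)) t).
  by rewrite derive1E; apply: derivableP; exact: dX.
have {}dY (t : R) : is_derive t 1 (fun t => complex.Im (eta t)) (derive1 (fun t => complex.Im (eta t)) t).
  by rewrite derive1E; apply: derivableP; exact: dY.
have xl : x <= last x s.
  by rewrite -[x]/(head x (x :: s)); move: xs; clear; elim: s x => //= y s IH x /andP[/ltW xy /IH]; exact: le_trans.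
pose F (t : R) := cabs (derive1 (fun t => complex.Re (eta t)) t +i* derive1 (fun t => complex.Im (eta t)) t) /
  rho (complex.Re (eta t) +i* complex.Im (eta t)).
have etaE t : complex.Re (eta t) +i* complex.Im (eta t) = eta t by case: (eta t).
have fF t : t \in `]a, x[ -> F t = f t.
  move=> tax; have nr : \forall s \near t, gamma s = eta s.
    have : \forall s \near t, s \in `]a, x[ by exact: near_in_itvoo.
    apply: filterS => u uax; apply: ge; move: uax; rewrite !in_itv /= => /andP[h1 h2'].
    by rewrite !ltW.
  have gt := nbhs_singleton nr.
  rewrite /F /f /speed etaE gt !derive1E; congr (cabs (_ +i* _) / _); apply/esym/near_eq_derive.
    by apply: filterS nr => u ->.
  by apply: filterS nr => u ->.
have mfo : measurable_fun `]a, x[ f.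
  apply: (eq_measurable_fun F); last exact: (piece_measurable dX dY cX cY).
  by move=> t /set_mem/fF.
have mf1 : measurable_fun `]a, x] f by apply/measurable_fun_itv_bndo_bndcP.
have split_itv : [set` `]a, last x s]] = [set` `]a, x]] `|` [set` `]x, last x s]] :> set R.
  by rewrite -itv_bndbnd_setU// ?bnd_simp// ltW.
have m1 : measurable ([set` `]a, x]] : set (measurableTypeR R)) by exact: measurable_itv.
have m2 : measurable ([set` `]x, last x s]] : set (measurableTypeR R)) by exact: measurable_itv.
have mf : measurable_fun `]a, last x s] f by rewrite split_itv; apply/measurable_funU.
split=> //; rewrite split_itv ge0_integral_setU//; last 3 first.
- by rewrite -split_itv; exact/measurable_EFinP.
- by move=> t _; rewrite lee_fin.
- apply/disj_setPRL => t /=; rewrite !in_itv /= => /andP[h _] /andP[_ h'].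
  by rewrite ltNge h' in h.
have -> : k * (U (gamma (last x s)) - U (gamma a)) / 4 =
  k * (U (gamma x) - U (gamma a)) / 4 + k * (U (gamma (last x s)) - U (gamma x)) / 4 by ring.
rewrite EFinD; apply: leeD => //.
have ga : gamma a = eta a by apply: ge; rewrite in_itv /= lexx ltW.
have gx : gamma x = eta x by apply: ge; rewrite in_itv /= lexx ltW.
have := piece_lower dX dY cX cY k1 ax; rewrite !etaE -ga -gx => h1.
have E : (\int[leb]_(t in `]a, x[) (F t)%:E = \int[leb]_(t in `]a, x[) (f t)%:E)%E.
  by apply: eq_integral => t /set_mem/fF ->.
have {}h1 : ((k * (U (gamma x) - U (gamma a)) / 4)%:E <= \int[leb]_(t in `]a, x[) (F t)%:E)%E by exact: h1.
rewrite E in h1; apply: (le_trans h1).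
apply: ge0_subset_integral => //.
- by apply/measurable_EFinP.
- by move=> t _; rewrite lee_fin.
- by move=> t /=; rewrite !in_itv /= => /andP[-> /ltW].
Qed.

Lemma length_potential (k : R) : `|k| <= 1 -> piecewise_C1 gamma ->
  ((k * (U (gamma 1) - U (gamma 0)) / 4)%:E <= path_length gamma)%E.
Proof.
move=> k1 [s [[ps /eqP ls] H]]; have [mf] := chain_lower k1 ps H.
rewrite ls => /le_trans; apply; rewrite /path_length.
rewrite ls in mf.
by rewrite -integral_itv_obnd_cbnd//; exact/measurable_EFinP.
Qed.

End Potential.

Lemma path_length_ge0 gamma : (0 <= path_length gamma)%E.
Proof.
by apply: integral_ge0 => t _; rewrite lee_fin divr_ge0 ?cabs_ge0// ltW.
Qed.

Lemma length_lower gamma z w : piecewise_C1 gamma ->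
  (gamma 0 = z /\ gamma 1 = w) \/ (gamma 0 = w /\ gamma 1 = z) ->
  ((ln (1 + cabs (w - z) / rho z) / 4)%:E <= path_length gamma)%E.
Proof.
move=> pg ends; have [->|wz] := eqVneq w z.
  by rewrite subrr cabs0 mul0r addr0 ln1 mul0r path_length_ge0.
pose x := cabs (w - z); have x0 : 0 < x by rewrite cabs_gt0 subr_eq0.
pose R0 := rho z; have R00 : 0 < R0 := rho_gt0 z.
pose e := (w - z) / x%:C; have e1 : cabs e = 1.
  by rewrite cabsM cabsV cabs_real gtr0_norm// mulfV// gt_eqF.
(* With the pole at [z] itself [U] would only grow quadratically near [z]. *)
pose A0 := z - R0%:C * e.
have zA : cabs (z - A0) = R0.
  by rewrite /A0 opprB addrC subrK cabsM e1 mulr1 cabs_real gtr0_norm.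
have wA : cabs (w - A0) = x + R0.
  have -> : w - A0 = (x + R0)%:C * e.
    have -> : w = z + x%:C * e by rewrite /e mulrC divfK ?subrKC ?addrC ?subrK// eq_complex /= eqxx andbT gt_eqF.
    by rewrite /A0 rmorphD; ring.
  by rewrite cabsM e1 mulr1 cabs_real ger0_norm// addr_ge0// ltW.
have rhoA u : rho u <= 2 * R0 + cabs (u - A0).
  have := rho_lip u z; have := cabs_triangle A0 u z; rewrite (cabsC A0) zA -/R0.
  by move: (cabs _) (cabs _) => *; lra.
pose U u := ln (R0 ^+ 2 + cabs (u - A0) ^+ 2).
have UE : ln (1 + cabs (w - z) / rho z) <= U w - U z.
  rewrite /U wA zA -ln_div ?posrE ?addr_gt0 ?exprn_gt0 ?addr_gt0//.
  rewrite ler_ln ?posrE ?divr_gt0 ?addr_gt0 ?exprn_gt0 ?addr_gt0//; last by rewrite divr_gt0.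
  rewrite ler_pdivlMr ?addr_gt0 ?exprn_gt0// -/x -/R0.
  rewrite -subr_ge0 (_ : _ - _ = x ^+ 2); last by field; rewrite gt_eqF.
  exact: sqr_ge0.
have [[g0 g1]|[g0 g1]] := ends.
  have := @length_potential R0 A0 R00 rhoA gamma 1; rewrite normr1 => /(_ (lexx _) pg).
  by rewrite g0 g1; apply: le_trans; rewrite lee_fin mul1r ler_pM2r ?invr_gt0.
have := @length_potential R0 A0 R00 rhoA gamma (-1); rewrite normrN1 => /(_ (lexx _) pg).
by rewrite g0 g1; apply: le_trans; rewrite lee_fin mulN1r opprB ler_pM2r ?invr_gt0.
Qed.

(** On the straight segment [rho >= rho l / 2], by the Lipschitz property. *)
Lemma segment_length z l : cabs (z - l) <= rho l / 2 ->
  exists gamma, [/\ piecewise_C1 gamma, gamma 0 = z, gamma 1 = l &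
    (path_length gamma <= (2 * cabs (z - l) / rho l)%:E)%E].
Proof.
move=> h; pose X (t : R) := complex.Re z + t * (complex.Re l - complex.Re z).
pose Y (t : R) := complex.Im z + t * (complex.Im l - complex.Im z).
have dX (t : R) : is_derive t 1 X (complex.Re l - complex.Re z).
  by apply: is_derive_eq; rewrite /GRing.scale /=; ring.
have dY (t : R) : is_derive t 1 Y (complex.Im l - complex.Im z).
  by apply: is_derive_eq; rewrite /GRing.scale /=; ring.
have X' t : derive1 X t = complex.Re l - complex.Re z by rewrite derive1E; exact: derive_val.
have Y' t : derive1 Y t = complex.Im l - complex.Im z by rewrite derive1E; exact: derive_val.
pose gamma t := X t +i* Y t.
have g0 : gamma 0 = z by rewrite /gamma /X /Y !mul0r !addr0; case: (z).
have g1 : gamma 1 = l by rewrite /gamma /X /Y !mul1r ![_ + (_ - _)]addrC !subrK; case: (l).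
have C1X : C1 X.
  split; first by move=> t; exact: ex_derive.
  by rewrite (_ : derive1 X = fun=> complex.Re l - complex.Re z); [move=> t; exact: cvg_cst|exact/funext].
have C1Y : C1 Y.
  split; first by move=> t; exact: ex_derive.
  by rewrite (_ : derive1 Y = fun=> complex.Im l - complex.Im z); [move=> t; exact: cvg_cst|exact/funext].
have sp t : speed gamma t = cabs (z - l).
  by rewrite /speed /= X' Y' cabsC; case: (z) (l) => a b [c d].
have rl := rho_gt0 l.
exists gamma; split=> //.
  exists [:: 1]; split; first by split; rewrite /= ?ltr01 ?eqxx.
  by move=> [|//] _; exists gamma.
have le t : 0 <= t <= 1 -> speed gamma t / rho (gamma t) <= 2 * cabs (z - l) / rho l.
  move=> /andP[t0 t1]; rewrite sp; have gl : cabs (l - gamma t) <= rho l / 2.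
    have -> : l - gamma t = (1 - t)%:C * (l - z).
      by rewrite /gamma /X /Y; case: (z) (l) => a b [c d]; apply/eqP; rewrite eq_complex /=; apply/andP; split; apply/eqP; ring.
    rewrite cabsM cabs_real ger0_norm ?subr_ge0// cabsC (le_trans _ h)// ler_piMl ?cabs_ge0//.
    by rewrite gerBl.
  have h1 : rho l / 2 <= rho (gamma t) by have := rho_lip l (gamma t); lra.
  rewrite [2 * _]mulrC -mulrA; apply: ler_wpM2l; first exact: cabs_ge0.
  rewrite -[2 / rho l]invrK invf_div lef_pV2 ?posrE ?divr_gt0//.
rewrite /path_length.
apply: (@le_trans _ _ (\int[leb]_(t in `[0%R, 1%R]) (2 * cabs (z - l) / rho l)%:E)%E); last first.
  by rewrite integral_cst_itv// subr0 mulr1.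
apply: ge0_le_integral => //.
- by move=> t _; rewrite lee_fin divr_ge0 ?cabs_ge0// ltW.
- apply/measurable_EFinP; rewrite (_ : (fun t => _) = (fun t => cabs (z - l) / rho (gamma t))); last by apply/funext => t; rewrite sp.
  apply: measurable_funTS; apply: continuous_measurable_fun => t; apply: cvgM; first exact: cvg_cst.
  apply: cvgV; first by rewrite gt_eqF.
  apply: (@continuous_comp _ _ _ (fun t : R => (X t, Y t) : R * R) (fun p => rho (toC p))).
    by apply: (@pair_continuous _ _ _ X Y); exact: C1_continuous.
  exact: lipschitz_continuous.
Qed.

End Paths.

(** * Multipliers of a doubling weight *)

Section FrameCriterion.
Variables (R : realType) (phi rho d : R[i] -> R) (g : R[i] -> R[i]) (L : set R[i]).
Variables (delta M K Cg : R).
Hypothesis FR : multiplier_frame phi rho d g L delta M K Cg.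
Variable c : R[i] -> R[i].
Implicit Types (l : R[i]).
Let b l := c l / cderiv g l.
Let rho_gt0 := frame_rho_gt0 FR.
Let delta_gt0 : 0 < delta. Proof. by case/andP: (frame_delta FR). Qed.

Lemma coef_sumP : (exists C, sum_le L (fun l => cabs (c l) * expR (- phi l)) C) <->
  (exists C, sum_le L (fun l => cabs (b l) / rho l) C).
Proof.
have C0 : 0 <= 8 * expR 1 * Cg by rewrite mulr_ge0 ?mulr_ge0 ?expR_ge0// (le_trans ler01)// (frame_Cg FR).
split=> -[C H]; exists (8 * expR 1 * Cg * C); apply: le_sum_le (sum_leZ C0 H) => l Ll.
  exact: (coef_equiv FR c Ll).2.
exact: (coef_equiv FR c Ll).1.
Qed.

Variable A : R.
Hypothesis LA : sum_le L (fun l => cabs (b l) / rho l) A.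

Lemma csum_first l' : L l' ->
  csum (L `\ l') (fun l => c l / (cderiv g l * (l - l'))) = - pseries g c (L `\ l') l'.
Proof.
move=> Ll'; have LAl : sum_le (L `\ l') (fun l => cabs (b l) / rho l) A by apply: sum_leS LA => x [].
have sep l : (L `\ l') l -> delta * rho l <= cabs (l' - l).
  by move=> [Ll /= /eqP]; rewrite eq_sym => /eqP ll'; have [] := frame_sep FR Ll' Ll ll'.
rewrite -[RHS]mulN1r; apply: cvsum_csum.
apply: (cvsum_ext _ (cvsumZ (-1) (csumP (pseries_summable FR LAl delta_gt0 sep)))) => l _.
by rewrite mulN1r -(opprB l l') invrN mulrN opprK invfM mulrA.
Qed.

Lemma csum_second l' :
  csum (L `\ l') (fun l => c l / (cderiv g l * (l - l') ^+ 2)) =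
  csum (L `\ l') (fun l => b l / (l' - l) ^+ 2).
Proof.
congr csum; apply/funext => l.
by rewrite -(opprB l l') sqrrN invfM mulrA.
Qed.

End FrameCriterion.

Lemma frame_interpolation (R : realType) (phi rho d : R[i] -> R) (g : R[i] -> R[i]) (L : set R[i])
    (delta M K Cg : R) (c : R[i] -> R[i]) :
  multiplier_frame phi rho d g L delta M K Cg ->
  (exists f : R[i] -> R[i], [/\ forall z, cdifferentiable f z,
     (\int[leb2]_p (fock_density phi rho f p)%:E < +oo)%E & forall l, L l -> f l = c l]) <->
  [/\ (\esum_(l in L) (cabs (c l) * expR (- phi l))%:E < +oo)%E,
      (\esum_(l' in L)
         (cabs (csum (L `\ l') (fun l => c l / (cderiv g l * (l - l')))))%:E < +oo)%E &
      (\esum_(l' in L)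
         (cabs ((rho l')%:C *
            csum (L `\ l') (fun l => c l / (cderiv g l * (l - l') ^+ 2))))%:E < +oo)%E].
Proof.
move=> FR; have rho_gt0 := frame_rho_gt0 FR; split.
  move=> [f [fd ffin fc]].
  have LA := coef_summable FR erefl fd ffin fc.
  have frep := lagrange_representation FR erefl fd ffin fc.
  split; apply/esum_ltyP.
  - by apply/(coef_sumP FR c); eexists; exact: LA.
  - have [C HC] := first_sums FR erefl fd ffin fc frep; exists C.
    by apply: le_sum_le HC => l' Ll'; rewrite (csum_first FR LA Ll') cabsN.
  - have [C HC] := second_sums FR erefl fd ffin fc frep; exists C.
    by apply: le_sum_le HC => l' Ll'; rewrite cabsM cabs_real gtr0_norm// csum_second.
move=> [/esum_ltyP/(coef_sumP FR c)[A LA] /esum_ltyP[A1 LA1] /esum_ltyP[A2 LA2]].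
exists (lagrange g L c); split.
- exact: (lagrange_differentiable FR LA).
- apply: (lagrange_fock FR LA (A1 := A1) (A2 := A2)).
    by apply: le_sum_le LA1 => l' Ll'; rewrite (csum_first FR LA Ll') cabsN.
  by apply: le_sum_le LA2 => l' Ll'; rewrite cabsM cabs_real gtr0_norm// csum_second.
- exact: (lagrange_interp FR c).
Qed.

(** [e^(m / 2) (1 - m / 2) <= 1], while [(1 + m) (1 - m / 2) = 1 + m (1 - m) / 2 >= 1]. *)
Lemma ln1D_ge (R : realType) (m : R) : 0 <= m <= 1 -> m / 2 <= ln (1 + m).
Proof.
move=> /andP[m0 m1]; rewrite -ler_expR lnK ?posrE; last by lra.
have p : 0 < 1 - m / 2 by lra.
have h := expR_ge1Dx (- (m / 2)); rewrite expRN in h.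
have e0 := expR_gt0 (m / 2).
have h1 : expR (m / 2) * (1 - m / 2) <= 1 by rewrite mulrC -ler_pdivlMr// mul1r.
rewrite -(ler_pM2r p) (le_trans h1)//.
have : 0 <= m * (1 - m) by rewrite mulr_ge0// subr_ge0.
by rewrite (_ : (1 + m) * _ = 1 + m * (1 - m) / 2); [lra|field].
Qed.

(** * The frame of an actual multiplier *)

Section WeightFrame.
Variables (R : realType) (phi : R[i] -> R) (g : R[i] -> R[i]).
Hypothesis Wphi : weight phi.
Let rho_gt0 := rho_gt0 Wphi.
Let rho_lip := rho_lip Wphi.

Lemma dphi_ge0 z w : (0 <= dphi phi z w)%E.
Proof.
by apply: le_ereal_inf_tmp => _ [gamma _ <-]; exact: (path_length_ge0 rho_gt0).
Qed.

Lemma dphi_lower z w :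
  ((ln (1 + cabs (z - w) / rho phi z) / 4)%:E <= dphi phi z w)%E /\
  ((ln (1 + cabs (z - w) / rho phi w) / 4)%:E <= dphi phi z w)%E.
Proof.
split; apply: le_ereal_inf_tmp => _ [gamma [pg g0 g1] <-].
  by rewrite cabsC; apply: (length_lower rho_gt0 rho_lip pg); left.
by apply: (length_lower rho_gt0 rho_lip pg); right.
Qed.

Lemma dphi_upper z l : cabs (z - l) <= rho phi l / 2 ->
  (dphi phi z l <= (2 * cabs (z - l) / rho phi l)%:E)%E.
Proof.
move=> /(segment_length rho_gt0 rho_lip)[gamma [pg g0 g1 h]].
by apply: ge_ereal_inf; exists (rho_length phi gamma) => //; exists gamma.
Qed.

Lemma multiplier_frame_exists : multiplier phi g ->
  exists d delta M K Cg, multiplier_frame phi (rho phi) d g (zeros g) delta M K Cg.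
Proof.
move=> [ge [delta' [delta'0 sep]] [M' HM'] [C [C0 HC]]].
pose M := Num.max M' 1; pose delta := Num.min delta' 1.
(* The infimum defining the distance need not be attained, so a zero at distance below [M + 1] is
   chosen; [ln (1 + |z - l| / rho) / 4 < M + 1] then yields [K], with [rho] at either end. *)
pose Cg := Num.max C 1; pose K := expR (4 * (M + 1)).
pose d z := fine (dphi_set phi z (zeros g)).
have d0 z : (0 <= dphi_set phi z (zeros g))%E.
  by apply: le_ereal_inf_tmp => _ [l _ <-]; exact: dphi_ge0.
have dM z : (dphi_set phi z (zeros g) <= M%:E)%E.
  by rewrite (le_trans (HM' z))// lee_fin le_max lexx.
have dE z : (d z)%:E = dphi_set phi z (zeros g).
  by rewrite fineK// ge0_fin_numE// (le_lt_trans (dM z))// ltry.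
have M1 : 1 <= M by rewrite le_max lexx orbT.
have C1 : C <= Cg by rewrite le_max lexx.
have Cg1 : 1 <= Cg by rewrite le_max lexx orbT.
have delta0 : 0 < delta by rewrite lt_min delta'0 ltr01.
have dd : delta <= delta' by rewrite ge_min lexx.
have dn z : 0 <= d z by rewrite -lee_fin dE.
exists d, delta, M, K, Cg; split.
- exact: rho_gt0.
- exact: rho_lip.
- by rewrite delta0 ge_min lexx orbT.
- move=> l l' Ll Ll' ll'; have h := sep l l' Ll Ll' ll'.
  have key x : x <= Num.max (rho phi l) (rho phi l') -> 0 <= x -> delta * x <= cabs (l - l').
    move=> xm x0; rewrite (le_trans _ h)// ler_pM// ltW//.
  by split; apply: key; rewrite ?le_max ?lexx ?orbT ?(ltW (rho_gt0 _)).
- exact: M1.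
- by move=> z; rewrite dn -lee_fin dE dM.
- move=> z l Ll h; have rl := rho_gt0 l; rewrite -ler_pdivlMr// -lee_fin dE.
  apply: le_trans (dphi_upper h).
  by apply: ereal_inf_lbound; exists l.
- by rewrite -expR0 ler_expR; move: M1 => ?; lra.
- move=> z; have [l Ll hl] : exists2 l, zeros g l & (dphi phi z l < (M + 1)%:E)%E.
    apply: contrapT => H; have : ((M + 1)%:E <= dphi_set phi z (zeros g))%E.
      apply: le_ereal_inf_tmp => _ [l Ll <-]; rewrite leNgt; apply/negP => h; apply: H.
      by exists l.
    by move=> /le_trans/(_ (dM z)); rewrite lee_fin; apply/negP; rewrite -ltNge ltrDl.
  have key (x : R) : 0 < x -> ((ln (1 + cabs (z - l) / x) / 4)%:E <= dphi phi z l)%E ->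
      cabs (z - l) <= K * x.
    move=> x0 h; have p : 0 < 1 + cabs (z - l) / x by rewrite ltr_pwDl// divr_ge0 ?cabs_ge0// ltW.
    have h1 : ln (1 + cabs (z - l) / x) < (M + 1) * 4.
      by rewrite -ltr_pdivrMr// -lte_fin (le_lt_trans h).
    rewrite -ler_pdivrMr// (@le_trans _ _ (1 + cabs (z - l) / x)) ?lerDr//.
    by rewrite /K (mulrC 4) -[leLHS]lnK ?posrE// ler_expR; exact: ltW.
  have [h1 h2] := dphi_lower z l.
  by exists l; split=> //; apply: key.
(* The factor [1 / 8] is a quarter from [dphi_lower] times a half from [ln1D_ge]. *)
- move=> z m hm H; rewrite -lee_fin dE; apply: le_ereal_inf_tmp => _ [l Ll <-].
  have [_ h] := dphi_lower z l; apply: le_trans h; rewrite lee_fin.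
  have /andP[m0 m1] := hm; have rl := rho_gt0 l.
  have h1 : m / 2 <= ln (1 + cabs (z - l) / rho phi l).
    rewrite (le_trans (ln1D_ge hm))// ler_ln ?posrE ?ltr_pwDl ?divr_ge0 ?cabs_ge0 ?(ltW rl)//.
    by rewrite lerD2l ler_pdivlMr//; exact: H.
  by lra.
- exact: weight_continuous.
- by move=> z; exact/derivableP_cdiff/ge.
- exact: Cg1.
- move=> z; have [h _] := HC z; rewrite -dE -EFinM lee_fin -mulrA ler_pdivrMl// in h.
  by rewrite (le_trans h)// ler_wpM2r ?cabs_ge0.
- move=> z; have [_ h] := HC z; rewrite -dE -EFinM lee_fin in h; rewrite (le_trans h)//.
  by rewrite ler_wpM2r// ler_wpM2r ?expR_ge0.
- by [].
Qed.

End WeightFrame.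

Theorem theorem10 (R : realType) (phi : R[i] -> R) (g : R[i] -> R[i])
    (L : set R[i]) (c : R[i] -> R[i]) :
  weight phi -> critical_lattice phi g L -> L 0 ->
  (exists f : R[i] -> R[i], fock1 phi f /\ forall l, L l -> f l = c l) <->
  [/\ (\esum_(l in L) (cabs (c l) * expR (- phi l))%:E < +oo)%E,
      (\esum_(l' in L)
         (cabs (csum (L `\ l') (fun l => c l / (cderiv g l * (l - l')))))%:E
       < +oo)%E &
      (\esum_(l' in L)
         (cabs ((rho phi l')%:C *
            csum (L `\ l') (fun l => c l / (cderiv g l * (l - l') ^+ 2))))%:E
       < +oo)%E].
Proof.
move=> Wphi [gm ->] _; have [d [delta [M [K [Cg FR]]]]] := multiplier_frame_exists Wphi gm.
rewrite -(frame_interpolation c FR); split=> -[f].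
  move=> [[fe ffin] fc]; exists f; split=> // z.
  exact/derivableP_cdiff/fe.
move=> [fd ffin fc]; exists f; split=> //; split=> // z.
exact/derivableP_cdiff/fd.
Qed.
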